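(* For every $c>0$ and every positive integer $d$ there exists $n_0=n_0(c,d)$ with the following property. Let $f(x,y,z)\in\mathbb{R}[x,y,z]$ be a polynomial of degree $d$ such that, for some $n>n_0$, the graph $w=f(x,y,z)$ contains at least $c\,n^3$ points of $A\times B\times C\times D$, where $A,B,C,D\subset\mathbb{R}$ each have size $n$. Then there exist polynomials $g,k,l,m\in\mathbb{R}[t]$ such that either $$f(x,y,z)=g(k(x)+l(y)+m(z))\quad\text{or}\quad f(x,y,z)=g(k(x)\cdot l(y)\cdot m(z)).$$
   Context: A point $(a,b,c',e)\in A\times B\times C\times D$ lies on the graph $w=f(x,y,z)$ if $e=f(a,b,c')$. *)

(* Defs.v *)
From HB Require Import structures.
From mathcomp Require Import all_boot all_order all_algebra.
From mathcomp Require Import reals.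
From mathcomp Require Import mpoly.
Set Implicit Arguments. Unset Strict Implicit. Unset Printing Implicit Defensive.
Import Order.TTheory GRing.Theory Num.Theory.
Local Open Scope ring_scope.

Definition ev3 (R : ringType) (f : {mpoly R[3]}) (x y z : R) : R :=
  f.@[fun i : 'I_3 => nth 0 [:: x; y; z] i].

(* number of points (a,b,c,e) of A x B x C x D with e = f(a,b,c);
   e is determined by (a,b,c), so this counts triples with f(a,b,c) in D.
   (A, B, C are assumed duplicate-free where used.) *)
Definition graph_count (R : realType) (f : {mpoly R[3]}) (A B C D : seq R) : nat :=
  (\sum_(a <- A) \sum_(b <- B) \sum_(c <- C) (ev3 f a b c \in D))%N.

(* Main.v *)
(* Sort the points of the graph by their value: by the Cauchy-Schwarz inequality about [n^5] pairs of triples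
   satisfy [f(x,b,c) = f(x',b',c')], so a positive proportion of the [n^4] curves in the plane
   [(x, x')] with parameters [(b,c,b',c')] are rich in points of [A x A].  A curve of bounded
   degree is a union of boundedly many monotone pieces, hence meets only [O(r)] cells when the
   grid is cut into [r x r] cells of constant size; by pigeonhole many curves have the same
   pattern of several points in a cell.  Taking many parameters at once, these curves all
   share a common component.  After writing [f = F(p(x), q(y), r(z))] with [F] indecomposable
   in each variable, a Lueroth-type argument shows that the common component is a line, that is
   [f(x,b,c) = f(Tx,b',c')] for an affine map [T], and only [O(n)] lines are rich.  Applying the
   same argument in [y] and then in [z] produces affine symmetries [f(Tx,Sy,Uz) = f(x,y,z)],
   many of them with the same [U], and hence nontrivial symmetries [(T,S,1)] and [(1,S',U')].
   If these are translations, [f] is a polynomial in a linear form [a x + b y + c z]; if they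
   are dilations, [f] is a polynomial in a monomial around the fixed points. *)
Require Import Defs.
From HB Require Import structures.
From mathcomp Require Import all_boot all_order all_algebra.
From mathcomp Require Import polyXY polyorder polyrcf.
From mathcomp Require Import boolp reals.
From mathcomp Require Import mpoly.
From mathcomp Require Import ring lra zify.
Set Implicit Arguments. Unset Strict Implicit. Unset Printing Implicit Defensive.
Import Order.TTheory GRing.Theory Num.Theory.
Local Open Scope ring_scope.

(** The obstacle is that one curve [P x = Q y] may contain many grid points on components that are
    not lines. Only a whole family of curves excludes this, and a family selected by pigeonhole
    might be special. Two devices deal with it. First, having small degree, or being a polynomial in
    a fixed [p], are linear conditions on a slice of [f]; by Vandermonde they spread from
    sufficiently many slices to all of them. The selected class always keeps a fraction of order 1/n
    of the parameters, which is enough slices, so it inherits the degree and the indecomposability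
    of [f]. Second, the common component is found by Euclid's algorithm over R(x), and the degrees
    in x stay bounded in terms of [d] alone. Hence a constant number of shared points is enough, and
    cells of constant size, with boundedly many patterns each, suffice. *)

Lemma scalep_inj (A : idomainType) (a : A) : a != 0 -> injective (fun g : {poly A} => a *: g).
Proof.
move=> a0 g h /=; rewrite -!mul_polyC; apply: mulfI; by rewrite polyC_eq0.
Qed.

(** * Pairs of curves with a common component *)

Section Gauss.
Variable F : fieldType.
Implicit Types (p q s : {poly F}) (g h : {poly {poly F}}).

Lemma irreducible_factor p : (1 < size p)%N -> exists2 q, irreducible_poly q & q %| p.
Proof.
have [n] := ubnP (size p); elim: n p => // n IHn p; rewrite ltnS => len sp.
have [irr|nirr] := pselect (irreducible_poly p); first by exists p; rewrite ?dvdpp.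
have [q [sq qp neq]] : exists q, [/\ size q != 1, q %| p & ~~ (q %= p)].
  apply: contrapT => H; apply: nirr; split=> // q sq qp; apply: contrapT => /negP neq.
  by apply: H; exists q.
have p0 : p != 0 by rewrite -size_poly_gt0; apply: leq_trans sp.
have q0 : q != 0 by apply: contraTneq qp => ->; rewrite dvd0p.
have ltqp : (size q < size p)%N.
  by rewrite ltn_neqAle (dvdp_leq p0 qp) andbT dvdp_size_eqp.
have [||r irr rq] := IHn q; first exact: leq_trans ltqp len.
  by move: q0 sq; rewrite -size_poly_gt0; case: (size q) => [|[]].
by exists r => //; apply: dvdp_trans qp.
Qed.

(** Gauss's argument: if neither factor is divisible, take the lowest coefficients [g]_j[and]h[_l]
    not divisible by [p]. In coefficient [j + l] of the product every other term is divisible by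
    [p]. *)
Lemma content_prime p g h : irreducible_poly p ->
  (forall j, p %| (g * h)`_j) -> (forall j, p %| g`_j) \/ (forall j, p %| h`_j).
Proof.
move=> irr pgh.
have [|/existsNP [j0 /negP jg]] := pselect (forall j, p %| g`_j); first by left.
have [|/existsNP [l0 /negP lh]] := pselect (forall j, p %| h`_j); first by right.
exfalso.
have exj : exists j, ~~ (p %| g`_j) by exists j0.
have exl : exists l, ~~ (p %| h`_l) by exists l0.
case: (ex_minnP exj) => j nj minj; case: (ex_minnP exl) => l nl minl.
have := pgh (j + l)%N; rewrite coefM.
have jl : (j < (j + l).+1)%N by rewrite ltnS leq_addr.
rewrite (bigD1 (Ordinal jl)) //= addKn dvdp_addl; last first.
  apply: (big_ind (fun q => p %| q)); [exact: dvdp0 | by move=> ? ? ? ?; apply: dvdp_add |].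
  move=> i; rewrite -val_eqE /= => ij.
  have [lij|] := ltnP i j.
    apply: dvdp_mulr; apply: contraLR lij => /minj; by rewrite -leqNgt.
  move=> leji; have ltji : (j < i)%N by rewrite ltn_neqAle eq_sym ij.
  apply: dvdp_mull; apply/negPn/negP => /minl; rewrite leqNgt => /negP; apply.
  have := ltn_ord i; rewrite ltnS => ilejl; rewrite ltn_subLR //.
  by rewrite ltn_add2r.
have cop q : ~~ (p %| q) -> coprimep p q.
  move=> nq; rewrite /coprimep; apply/negPn/negP => s1.
  have := irr.2 _ s1 (dvdp_gcdl _ _) => /andP[_ pg].
  by move/negP: nq; apply; apply: dvdp_trans pg (dvdp_gcdr _ _).
by rewrite (Gauss_dvdpr _ (cop _ nj)) (negPf nl).
Qed.

Lemma dvd_coefs p g : p != 0 -> (forall j, p %| g`_j) -> exists g', g = p *: g'.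
Proof.
move=> p0 H; exists (map_poly (fun a => a %/ p) g).
apply/polyP => j; rewrite coefZ coef_map_id0 ?div0p //.
by rewrite mulrC divpK.
Qed.

(** Pseudo-division only factors a multiple [s *: f]. The irreducible factors of [s] are removed one
    by one, each from the content of [g0] or of [h0]; those taken from [g0] are collected in [w], so
    that [g] truly divides [f]. *)
Lemma gauss_factor s g0 h0 (f : {poly {poly F}}) : s != 0 -> s *: f = g0 * h0 ->
  exists w g h, [/\ w != 0, g0 = w *: g & f = g * h].
Proof.
have [n] := ubnP (size s); elim: n s g0 h0 => // n IHn s g0 h0; rewrite ltnS => len s0 E.
have [s1|s1] := leqP (size s) 1.
  have /size_poly1P [c c0 Es] : size s == 1 by rewrite eqn_leq s1 size_poly_gt0.
  exists 1, g0, (c^-1%:P *: h0); rewrite oner_neq0 scale1r; split=> //.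
  rewrite -scalerAr -E Es scalerA -polyCM mulVf // scale1r //.
have [p irr /dvdpP [s' Es]] := irreducible_factor s1.
have p0 : p != 0 by rewrite -size_poly_gt0; apply: leq_trans irr.1.
have s'0 : s' != 0 by apply: contraNneq s0 => H; rewrite Es H mul0r.
have ls' : (size s' < n)%N.
  apply: leq_trans len; rewrite Es size_mul //.
  by case: (size p) irr.1 => [|[|k]] // _; rewrite !addnS /= ltnS leq_addr.
have [|H|H] := content_prime (p := p) (g := g0) (h := h0) irr.
- move=> j; rewrite -E coefZ Es; apply: dvdp_mulr; exact: dvdp_mull.
- have [g' Eg] := dvd_coefs p0 H.
  have [w [g [h [w0 Eg' Ef]]]] := IHn s' g' h0 ls' s'0 (ltac:(
    by apply: (scalep_inj p0); rewrite scalerA mulrC -Es E Eg scalerAl)).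
  exists (p * w), g, h; split=> //; first by rewrite mulf_neq0.
  by rewrite Eg Eg' scalerA.
have [h' Eh] := dvd_coefs p0 H.
apply: (IHn s' g0 h' ls' s'0).
by apply: (scalep_inj p0); rewrite scalerA mulrC -Es E Eh scalerAr.
Qed.

End Gauss.

(** * An effective Lueroth theorem for polynomials *)

Section Luroth.
Variable F : fieldType.
Implicit Types (p q r w c : {poly F}) (g h : {poly {poly F}}).
Import Pdiv.CommonRing.

(** This is p(X) - p(Y), with X the outer and Y the inner variable. *)
Definition bidiff p : {poly {poly F}} := p^:P - p%:P.

(** The index type may be infinite; building elements as finite sums lets an induction meet only
    finitely many generators. *)
Inductive bidiff_ideal (I : Type) (Q : I -> {poly F}) : {poly {poly F}} -> Prop :=
| bidiff_ideal0 : bidiff_ideal Q 0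
| bidiff_idealD i U H : bidiff_ideal Q H -> bidiff_ideal Q (U * bidiff (Q i) + H).

Lemma bidiffE p : bidiff p = p^:P - p%:P. Proof. by []. Qed.

Lemma bidiffM p q : bidiff (p * q) = bidiff p * q^:P + p%:P * bidiff q.
Proof. rewrite !bidiffE rmorphM /= polyCM; ring. Qed.

Lemma bidiff_horner p : (bidiff p).['X] = 0.
Proof. by rewrite bidiffE hornerD hornerN hornerC -/('X) -[_.['X]]/(p \Po 'X) comp_polyXr subrr. Qed.

Lemma size_bidiff p : (1 < size p)%N -> size (bidiff p) = size p.
Proof.
move=> sp; rewrite bidiffE size_polyDl ?size_map_polyC // size_polyN.
exact: leq_ltn_trans (size_polyC_leq1 _) _.
Qed.

Lemma lead_coef_bidiff p : (1 < size p)%N -> lead_coef (bidiff p) = (lead_coef p)%:P.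
Proof.
move=> sp; rewrite bidiffE lead_coefDl ?lead_coef_map_inj //; first exact: polyC_inj.
rewrite size_polyN size_map_polyC; exact: leq_ltn_trans (size_polyC_leq1 _) _.
Qed.

Lemma swapXY_bidiff p : swapXY (bidiff p) = - bidiff p.
Proof. by rewrite bidiffE rmorphB /= swapXY_polyC swapXY_map_polyC opprB. Qed.

(** Division by a monic [g] needs no denominators, so the remainder of [w *: h] is [w] times that of
    [h]. *)
Lemma monic_cancel g h w : g \is monic -> w != 0 ->
  (exists T, w *: h = T * g) -> exists T, h = T * g.
Proof.
move=> gm w0 [T E]; apply/Pdiv.RingMonic.rdvdpP => //; apply/eqP.
have := congr1 (fun x => rmodp x g) E.
rewrite Pdiv.RingMonic.rmodpZ // Pdiv.RingMonic.rmodp_mull // => /eqP.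
by rewrite -mul_polyC mulf_eq0 polyC_eq0 (negPf w0) /= => /eqP.
Qed.

(** Putting Y = 0 gives q = q(0) + q1 (p - p(0)). By the product rule, and after cancelling p(Y) -
    p(0), [bidiff p] also divides [bidiff q1]; the smaller q1 is then a polynomial in [p] by
    induction. *)
Lemma bidiff_dvd_comp p q T : (1 < size p)%N -> bidiff q = T * bidiff p ->
  exists r, q = r \Po p.
Proof.
move=> sp; have [n] := ubnP (size q); elim: n q T => // n IHn q T.
rewrite ltnS => len E; have [s1|s1] := leqP (size q) 1.
  by exists q; rewrite (size1_polyC s1) comp_polyC.
set q1 := map_poly (horner_eval 0) T.
have ev0 r : map_poly (horner_eval 0) (bidiff r) = r - r.[0]%:P.
  rewrite bidiffE rmorphB /= map_polyC /=; congr (_ - _).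
  by apply/polyP => k; rewrite !coef_map /= /horner_eval hornerC.
have Eq : q = q.[0]%:P + q1 * (p - p.[0]%:P).
  by have := congr1 (map_poly (horner_eval 0)) E; rewrite rmorphM /= !ev0 => /eqP;
     rewrite subr_eq addrC => /eqP.
set p1 := p - p.[0]%:P in Eq.
have sp1 : size p1 = size p.
  by rewrite size_polyDl // size_polyN; exact: leq_ltn_trans (size_polyC_leq1 _) _.
have p10 : p1 != 0 by rewrite -size_poly_gt0 sp1; apply: leq_trans sp.
have q10 : q1 != 0.
  by apply: contraTneq s1 => H; rewrite Eq H mul0r addr0 -leqNgt size_polyC_leq1.
have bdc (r : {poly F}) (a : F) : bidiff (a%:P + r) = bidiff r.
  by rewrite !bidiffE rmorphD /= map_polyC polyCD opprD addrACA subrr add0r.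
have bp1 : bidiff p1 = bidiff p by rewrite /p1 addrC -polyCN bdc.
have [T' ET'] : exists T, bidiff q1 = T * bidiff p.
  set l := lead_coef p.
  have l0 : l != 0 by rewrite lead_coef_eq0 -size_poly_gt0; apply: leq_trans sp.
  have [] := @monic_cancel (l^-1%:P *: bidiff p) (bidiff q1) p1 _ p10.
  - by rewrite monicE lead_coefZ lead_coef_bidiff // -polyCM mulVf.
  - exists (l%:P *: (T - q1^:P)).
    rewrite -scalerAl -scalerAr scalerA -polyCM mulfV // scale1r mulrBl -E Eq bdc mulrC.
    rewrite bidiffM bp1 -mul_polyC; ring.
  - by move=> S ES; exists (l^-1%:P *: S); rewrite -scalerAl scalerAr.
have [|h Eh] := IHn q1 T' _ ET'.
  have : size q = size (q1 * p1).
    have s2 : (1 < size (q1 * p1)%R)%N.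
      rewrite size_mul // sp1; move: q10; rewrite -size_poly_gt0.
      by case: (size q1) (size p) sp => // a [|[|b]] //; rewrite !addnS.
    rewrite Eq addrC size_polyDl //; exact: leq_ltn_trans (size_polyC_leq1 _) _.
  rewrite size_mul // sp1 => Es; apply: leq_trans len; rewrite Es.
  by case: (size p) sp => [|[|b]] // _; rewrite !addnS /= ltnS leq_addr.
exists (q.[0]%:P + h * ('X - p.[0]%:P)).
by rewrite comp_polyD comp_polyM comp_polyB comp_polyX !comp_polyC -Eh -Eq.
Qed.

Variables (I : Type) (Q : I -> {poly F}).
Local Notation J := (bidiff_ideal Q).

Lemma bidiff_ideal_add g h : J g -> J h -> J (g + h).
Proof.
move=> Jg Jh; elim: Jg => [|i U H _ IH]; first by rewrite add0r.
by rewrite -addrA; apply: bidiff_idealD.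
Qed.

Lemma bidiff_ideal_mul g h : J h -> J (g * h).
Proof.
elim=> [|i U H _ IH]; first by rewrite mulr0; constructor.
by rewrite mulrDr mulrA; apply: bidiff_idealD.
Qed.

Lemma bidiff_ideal_gen i : J (bidiff (Q i)).
Proof. by rewrite -[bidiff _]addr0 -[bidiff _]mul1r; do 2!constructor. Qed.

Lemma bidiff_ideal_horner g : J g -> g.['X] = 0.
Proof.
elim=> [|i U H _ IH]; first by rewrite horner0.
by rewrite hornerD hornerM IH bidiff_horner mulr0 addr0.
Qed.

(** An element of least degree in X generates the ideal over the field F(Y); the factor [c] clears
    the denominators. *)
Lemma bidiff_ideal_generator g : J g -> g != 0 ->
  exists g0, [/\ J g0, g0 != 0 & forall h, J h -> exists c u, c != 0 /\ c *: h = u * g0].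
Proof.
have [n] := ubnP (size g); elim: n g => // n IHn g; rewrite ltnS => len Jg g0.
have [|/existsNP [h /not_implyP [Jh nh]]] :=
  pselect (forall h, J h -> exists c u, c != 0 /\ c *: h = u * g); first by exists g.
have E := Pdiv.Idomain.divp_eq h g.
have lc0 : lead_coef g ^+ scalp h g != 0 by rewrite expf_neq0 // lead_coef_eq0.
apply: (IHn (h %% g)).
- by apply: leq_trans len; rewrite ltn_modp.
- have -> : h %% g = (lead_coef g ^+ scalp h g)%:P * h + (- (h %/ g)) * g.
    by rewrite mul_polyC E; ring.
  by apply: bidiff_ideal_add; apply: bidiff_ideal_mul.
- apply/eqP => r0; apply: nh; exists (lead_coef g ^+ scalp h g), (h %/ g).
  by rewrite E r0 addr0.
Qed.

(* Comparing [g(Z;Y)] with [g(Z;X)] modulo [g(X;Y)] shows that the roots of [g(.;Y)] are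
   an equivalence class; the comparison is made by monic division by [g(Z;X)]. *)
Lemma bidiff_ideal_coef g w : g \is monic -> w != 0 -> J (w *: g) ->
  (forall i, exists t, bidiff (Q i) = t * g) ->
  forall j, exists t, bidiff g`_j = t * g.
Proof.
move=> gm w0 Jwg dvQ j.
(* With Z outermost, then X, and Y innermost, [mY H] is H(Z;Y) and [mX H] is H(Z;X). *)
pose mY (H : {poly {poly F}}) : {poly {poly {poly F}}} := map_poly polyC H.
pose mX (H : {poly {poly F}}) : {poly {poly {poly F}}} := map_poly (map_poly polyC) H.
have mm : mX g \is monic by apply: monic_map.
have key H : J H -> exists T1 T2, mY H = T1 * mX g + g%:P * T2.
  elim=> [|i U H' _ [T1 [T2 E]]].
    by exists 0, 0; rewrite /mY rmorph0 mulr0 mul0r addr0.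
  have [t Et] := dvQ i.
  have E1 : mY (bidiff (Q i)) = mX (bidiff (Q i)) + (bidiff (Q i))%:P.
    rewrite /mY /mX !bidiffE !rmorphB /= !map_polyC /=.
    rewrite -!map_poly_comp.
    rewrite (@eq_map_poly _ _ (map_poly polyC \o polyC) (polyC \o polyC)); last first.
      by move=> a /=; rewrite map_polyC.
    by ring.
  exists (T1 + mY U * mX t), (T2 + mY U * t%:P).
  have -> : mY (U * bidiff (Q i) + H') = mY U * mY (bidiff (Q i)) + mY H'.
    by rewrite /mY rmorphD rmorphM.
  rewrite E E1 Et; have -> : mX (t * g) = mX t * mX g by rewrite /mX rmorphM.
  by rewrite polyCM; ring.
have [T1 [T2]] := key _ Jwg.
have -> : mY (w *: g) = w%:P *: mY g by rewrite /mY map_polyZ.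
move=> /(congr1 (fun x => rmodp x (mX g))).
rewrite Pdiv.RingMonic.rmodpZ // Pdiv.RingMonic.rmodpD // Pdiv.RingMonic.rmodp_mull // add0r.
rewrite mul_polyC Pdiv.RingMonic.rmodpZ //.
have -> : rmodp (mY g) (mX g) = mY g - mX g.
  rewrite -[in LHS](subrK (mX g) (mY g)) addrC -[X in X + _]mul1r.
  apply: Pdiv.RingMonic.rmodp_addl_mul_small => //.
  have sX : size (mX g) = size g.
    by apply: size_map_inj_poly; [apply: map_inj_poly => //; exact: polyC_inj | rewrite rmorph0].
  have sY : size (mY g) = size g by rewrite size_map_polyC.
  have gpos : (0 < size g)%N by rewrite size_poly_gt0 monic_neq0.
  rewrite sX -(prednK gpos) ltnS; apply/leq_sizeP => k; rewrite leq_eqVlt => /orP[/eqP <-|lk].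
    rewrite coefB !coef_map /= -lead_coefE (monicP gm).
    by rewrite map_polyC subrr.
  rewrite coefB !coef_map /= nth_default ?rmorph0 ?subrr //.
  by rewrite -(prednK gpos).
move=> /(congr1 (fun x : {poly {poly {poly F}}} => x`_j)).
rewrite !coefZ coefB !coef_map /= => E.
apply: (monic_cancel gm w0); exists (- (rmodp T2 (mX g))`_j).
rewrite mulNr mulrC -E bidiffE -mul_polyC; ring.
Qed.

(** Over F(Y) the ideal has a monic generator [g] with coefficients in F[Y], and it vanishes at X =
    Y. In degree 1 it is X - Y. In higher degree some coefficient [t] of [g] is nonconstant, and a
    comparison of degrees in Y makes [bidiff t] a scalar multiple of [g]; hence [bidiff t] divides
    every [bidiff (Q i)]. *)
Lemma luroth_dichotomy i0 : (1 < size (Q i0))%N ->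
  (exists p, (2 < size p)%N /\ forall i, exists r, Q i = r \Po p) \/
  (exists w, w != 0 /\ J (w *: ('X - 'X%:P))).
Proof.
move=> s0.
have [|g0 [Jg0 g00 dvJ]] := bidiff_ideal_generator (bidiff_ideal_gen i0).
  by rewrite -size_poly_gt0 size_bidiff //; apply: leq_trans s0.
have [c [u [c0 E]]] := dvJ _ (bidiff_ideal_gen i0).
rewrite mulrC in E; have [w1 [g1 [h1 [w10 Eg0 Ef]]]] := gauss_factor c0 E.
have lc1 : size (lead_coef g1) == 1.
  have : size (lead_coef g1 * lead_coef h1) == 1.
    rewrite -lead_coefM -Ef lead_coef_bidiff // size_polyC lead_coef_eq0 -size_poly_gt0.
    by rewrite (ltnW s0).
  by rewrite size_mul_eq1 => /andP[].
have [l l0 El] := size_poly1P _ lc1.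
pose g := l^-1%:P *: g1; pose w := l%:P * w1.
have w0 : w != 0 by rewrite mulf_neq0 // polyC_eq0.
have gm : g \is monic by rewrite monicE lead_coefZ El -polyCM mulVf.
have Jwg : J (w *: g).
  by rewrite scalerA /w mulrC mulrA -polyCM mulVf // mul1r -Eg0.
have dvQ i : exists t, bidiff (Q i) = t * g.
  have [c' [u' [c'0 E']]] := dvJ _ (bidiff_ideal_gen i).
  apply: (monic_cancel gm c'0); exists (w *: u').
  rewrite E' -scalerAl scalerAr; congr (_ * _).
  by rewrite scalerA /w mulrC mulrA -polyCM mulVf // mul1r -Eg0.
have gX : g.['X] = 0.
  have := bidiff_ideal_horner Jwg; rewrite hornerZ => /eqP.
  by rewrite mulf_eq0 (negPf w0) => /eqP.
have gn0 : g != 0 by apply: monic_neq0.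
have sg : (1 < size g)%N.
  rewrite ltnNge; apply/negP => /size1_polyC Eg; move: gX gn0.
  by rewrite Eg hornerC => ->; rewrite eqxx.
have [s2|s2] := leqP (size g) 2.
  right; exists w; split=> //; suff <- : g = 'X - 'X%:P by [].
  have E2 : size g = 2 by apply/eqP; rewrite eqn_leq s2 sg.
  have g1E : g`_1 = 1 by have := monicP gm; rewrite lead_coefE E2.
  have Eg : g = 'X + (g`_0)%:P.
    apply/polyP => k; rewrite coefD coefX coefC; case: k => [|[|k]] /=.
    - by rewrite add0r.
    - by rewrite g1E addr0.
    by rewrite addr0 nth_default // E2.
  have := gX; rewrite {1}Eg hornerD hornerX hornerC => /eqP.
  by rewrite addrC addr_eq0 => /eqP E0; rewrite Eg E0 polyCN.
left.
have dvc := bidiff_ideal_coef gm w0 Jwg dvQ.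
(* With constant coefficients only, [g] would be a nonzero polynomial over F with the transcendental
   root Y. *)
have [j sj] : exists j, (1 < size (g`_j)%R)%N.
  apply: contrapT => H.
  pose g' := map_poly (fun a : {poly F} => a`_0) g.
  have Eg : g = g'^:P.
    apply/polyP => k; rewrite coef_map /= coef_map_id0 ?coef0 //.
    apply: size1_polyC; rewrite leqNgt; apply/negP => Hk; by apply: H; exists k.
  move: gX gn0; rewrite Eg -[_.['X]]/(g' \Po 'X) comp_polyXr => ->.
  by rewrite rmorph0 eqxx.
set t := g`_j in sj; have [q Eq] := dvc j; rewrite -/t in Eq.
have t0 : t != 0 by rewrite -size_poly_gt0 ltnW.
have bt0 : bidiff t != 0 by rewrite -size_poly_gt0 size_bidiff // size_poly_gt0.
have q0 : q != 0 by apply: contraNneq bt0 => Hq; rewrite Eq Hq mul0r.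
(* Swapping turns the degree in Y into a size. As [t] is a coefficient of [g], the factor [g]
   already has the whole Y-degree of [bidiff t], so none is left for [q]. *)
have Es : swapXY q * swapXY g = - bidiff t by rewrite -swapXY_bidiff Eq rmorphM.
have sq : (size (swapXY q) <= 1)%N.
  have : size (swapXY q * swapXY g) = size t by rewrite Es size_polyN size_bidiff.
  rewrite size_mul ?swapXY_eq0 // => E1.
  have : (size t <= size (swapXY g))%N by rewrite -sizeYE max_size_coefXY.
  have : (0 < size (swapXY g))%N by rewrite size_poly_gt0 swapXY_eq0.
  move: E1; move: (size (swapXY g)) (size (swapXY q)) (size t) => x y z; clear; lia.
have [a Ea] : exists a : {poly F}, swapXY q = a%:P.
  by exists (swapXY q)`_0; apply: size1_polyC.
have [b b0 Eb] : exists2 b : F, b != 0 & a = b%:P.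
  apply/size_poly1P; have : size (a * lead_coef (swapXY g)) == 1.
    rewrite -[a]lead_coefC -Ea -lead_coefM Es lead_coefN lead_coef_bidiff // size_polyN.
    by rewrite size_polyC lead_coef_eq0 t0.
  by rewrite size_mul_eq1 => /andP[].
have Eq' : q = b%:P%:P by rewrite -[q]swapXYK Ea Eb swapXY_polyC map_polyC.
exists t; split.
  by rewrite -size_bidiff // Eq Eq' mul_polyC size_scale ?polyC_eq0.
move=> i; have [T ET] := dvQ i.
apply: (@bidiff_dvd_comp t (Q i) (b^-1%:P%:P * T)) => //.
rewrite Eq Eq' mulrACA -polyCM -polyCM mulVf // mul1r; exact: ET.
Qed.
End Luroth.

(** * Families of curves with many common points come from an affine map *)

Section AffineRelation.
Variable R : realFieldType.
Import Pdiv.CommonRing.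

Lemma poly_nonroot (p : {poly R}) : p != 0 -> exists a, p.[a] != 0.
Proof.
move=> p0; apply: contrapT => H.
have := @max_poly_roots _ p [seq i%:R | i <- iota 0 (size p)] p0.
rewrite size_map size_iota ltnn => E; apply: (notF (E _ _)).
  apply/allP => x _; apply/rootP; apply: contrapT => /eqP Hx; by apply: H; exists x.
rewrite map_inj_uniq ?iota_uniq // => i j /eqP; rewrite eqr_nat; exact: eqP.
Qed.

Lemma poly_eq_off (t p q : {poly R}) : t != 0 ->
  (forall a, t.[a] != 0 -> p.[a] = q.[a]) -> p = q.
Proof.
move=> t0 H; apply/eqP; rewrite -subr_eq0; apply/negPn/negP => d0.
have [a] := poly_nonroot (mulf_neq0 t0 d0).
rewrite hornerM mulf_eq0 negb_or => /andP[ta].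
by rewrite hornerD hornerN (H a ta) subrr eqxx.
Qed.

Definition coef_bounded b (g : {poly {poly R}}) := forall j, (size (g`_j)%R <= b)%N.

(** Each of the [m] elimination steps multiplies by the leading coefficient of [g] and thus raises
    the bound on the inner degrees by at most [b]. *)
Lemma pseudo_remainder (g : {poly {poly R}}) b m (h : {poly {poly R}}) c :
  g != 0 -> coef_bounded b g -> coef_bounded c h -> (size h <= (size g).-1 + m)%N ->
  exists s u r, [/\ s != 0, s *: h = u * g + r, (size r < size g)%N &
                    coef_bounded (c + m * b) r].
Proof.
move=> g0 bg; have sg : (0 < size g)%N by rewrite size_poly_gt0.
elim: m h c => [|m IHm] h c bh sh.
  exists 1, 0, h; rewrite oner_neq0 scale1r mul0r add0r mul0n !addn0; split=> //.
  by move: sh; rewrite addn0 -ltnS prednK.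
pose lh := h`_((size g).-1 + m).
pose h' := lead_coef g *: h - lh *: ('X^m * g).
have [||s [u [r [s0 E sr br]]]] := IHm h' (c + b)%N.
- move=> j; rewrite /h' coefB !coefZ coefXnM.
  apply: leq_trans (size_polyD _ _) _; rewrite geq_max size_polyN; apply/andP; split.
    apply: leq_trans (size_polyMleq _ _) _; rewrite -subn1 leq_subLR.
    apply: leq_trans (leq_add (bg _) (bh j)) _; rewrite addnC; exact: leq_addl.
  case: ifP => _; first by rewrite mulr0 size_poly0.
  apply: leq_trans (size_polyMleq _ _) _; rewrite -subn1 leq_subLR.
  apply: leq_trans (leq_add (bh _) (bg _)) _; exact: leq_addl.
- apply/leq_sizeP => j; rewrite leq_eqVlt => /orP[/eqP <-|lt].
    rewrite /h' coefB !coefZ coefXnM ltnNge leq_addl /= addnK -lead_coefE mulrC.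
    by rewrite subrr.
  have hg : (size g <= j - m)%N by rewrite -(prednK sg) ltn_subRL addnC.
  have hh : (size h <= j)%N by apply: leq_trans sh _; rewrite addnS.
  by rewrite /h' coefB !coefZ coefXnM (nth_default _ hg) (nth_default _ hh) !mulr0 if_same mulr0 subrr.
exists (s * lead_coef g), (u + s%:P * lh%:P * 'X^m), r; split=> //.
- by rewrite mulf_neq0 // lead_coef_eq0.
- rewrite -scalerA -[lead_coef g *: h](subrK (lh *: ('X^m * g))) -/h' scalerDr E.
  rewrite -!mul_polyC; ring.
- by rewrite mulSn addnA.
Qed.

(** Divisors belonging to distinct values of [p] are coprime, because the polynomials q - p(a) that
    they divide differ by nonzero constants. Each of them splits off from [w] and lowers its degree,
    and there is an infinite supply. *)
Lemma coprime_divisors_absurd (w t p q : {poly R}) : w != 0 -> t != 0 -> (1 < size p)%N ->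
  (forall a, t.[a] != 0 -> exists g : {poly R}, [/\ (1 < size g)%N, g %| w & g %| q - p.[a]%:P]) -> False.
Proof.
move=> w0 t0 sp; have [n] := ubnP (size w); elim: n w t w0 t0 => // n IHn w t w0 t0.
rewrite ltnS => len H; have [a ta] := poly_nonroot t0.
have [g [sg /dvdpP [w1 Ew] gq]] := H a ta.
have w10 : w1 != 0 by apply: contraNneq w0 => E; rewrite Ew E mul0r.
have g0 : g != 0 by rewrite -size_poly_gt0 ltnW.
have pa0 : p - p.[a]%:P != 0.
  rewrite -size_poly_gt0 size_polyDl ?(ltnW sp) // size_polyN.
  exact: leq_ltn_trans (size_polyC_leq1 _) _.
apply: (IHn w1 (t * (p - p.[a]%:P))) => //.
- by rewrite mulf_neq0.
- apply: leq_trans len; rewrite Ew size_mul //.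
  by case: (size g) sg => [|[|k]] // _; rewrite !addnS /= ltnS leq_addr.
move=> b; rewrite hornerM mulf_eq0 negb_or !hornerE => /andP[tb pb].
have [g' [sg' g'w g'q]] := H b tb; exists g'; split=> //.
rewrite Ew in g'w; rewrite -(@Gauss_dvdpl _ w1 g g') //.
rewrite /coprimep; apply/eqP.
have : gcdp g' g %| (p.[b] - p.[a])%:P.
  have -> : (p.[b] - p.[a])%:P = (q - p.[a]%:P) - (q - p.[b]%:P) by rewrite polyCB; ring.
  apply: dvdp_sub; first exact: dvdp_trans (dvdp_gcdr _ _) gq.
  exact: dvdp_trans (dvdp_gcdl _ _) g'q.
move/dvdp_leq; rewrite polyC_eq0 pb size_polyC pb => /(_ isT) le1.
apply/eqP; rewrite eqn_leq le1 size_poly_gt0 gcdp_eq0 negb_and.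
by rewrite g0 orbT.
Qed.

(* Reading [w(Y)(X - Y) = g(Y) A + g(X) B] modulo the monic polynomial [g(X)] of degree at
   least [2] in [X] leaves the left-hand side unchanged. *)
Lemma two_copies_dvdp (g w : {poly R}) A B : (2 < size g)%N ->
  w *: ('X - 'X%:P) = g%:P * A + g^:P * B -> g %| w.
Proof.
move=> sg E; have lg : lead_coef g != 0.
  by rewrite lead_coef_eq0 -size_poly_gt0 (leq_trans _ sg).
pose m := (lead_coef g)^-1 *: g.
have mm : m^:P \is monic by rewrite monic_map // monicE lead_coefZ mulVf.
have Eg : g = lead_coef g *: m by rewrite scalerA mulfV // scale1r.
have sm : size m^:P = size g by rewrite size_map_polyC size_scale ?invr_neq0.
have := congr1 (fun x => rmodp x m^:P) E.
rewrite Pdiv.RingMonic.rmodpD // mul_polyC !Pdiv.RingMonic.rmodpZ //.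
rewrite (_ : g^:P * B = ((lead_coef g)%:P%:P * B) * m^:P); last first.
  by rewrite {1}Eg -mul_polyC rmorphM /= map_polyC /=; ring.
rewrite Pdiv.RingMonic.rmodp_mull // addr0 rmodp_small; last by rewrite size_XsubC sm.
move=> /(congr1 (fun x : {poly {poly R}} => x`_1)).
rewrite !coefZ coefB coefX coefC subr0 mulr1 => ->; exact: dvdp_mulr.
Qed.

Variables (I : Type) (P Q : I -> {poly R}).

(** The equation of the curve P(x) = Q(y), with y the outer and x the inner variable. *)
Definition graph_poly i : {poly {poly R}} := (P i)%:P - (Q i)^:P.

Lemma graph_poly_horner i x y : (graph_poly i).[y, x] = (P i).[x] - (Q i).[y].
Proof.
rewrite /graph_poly !hornerE /= -[in RHS](hornerC (Q i).[y] x); congr (_ - _.[_]).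
by rewrite horner_map.
Qed.

(** Bound on the inner degrees after [k] Euclidean rounds: a round divides a [graph_poly] in at most
    [d + 1] steps by a polynomial with the previous bound. *)
Fixpoint coef_bound d k := if k is k'.+1 then (d.+1 + d.+1 * coef_bound d k')%N else d.+1.

Lemma coef_boundS d k : (coef_bound d k <= coef_bound d k.+1)%N.
Proof. elim: k => [|k IH] /=; [exact: leq_addr | by rewrite leq_add2l leq_mul2l IH orbT]. Qed.

Lemma coef_bound_le d k l : (k <= l)%N -> (coef_bound d k <= coef_bound d l)%N.
Proof.
elim: l => [|l IH]; first by rewrite leqn0 => /eqP ->.
rewrite leq_eqVlt => /orP[/eqP -> //|]; rewrite ltnS => /IH H.
exact: leq_trans H (coef_boundS _ _).
Qed.

(** Euclid's algorithm for the whole family. If [g] does not divide some [graph_poly i] over R(x),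
    the remainder is nonzero, still vanishes on [tau] and has smaller degree in y. So there are at
    most [d] rounds, however large the family is. *)
Lemma minimal_relation d (tau : seq (R * R)) e (g : {poly {poly R}}) : (e <= d)%N ->
  (forall i, coef_bounded d.+1 (graph_poly i)) -> (forall i, (size (graph_poly i) <= d.+1)%N) ->
  (forall i p, p \in tau -> (graph_poly i).[p.2, p.1] = 0) ->
  g != 0 -> (size g <= e.+1)%N -> coef_bounded (coef_bound d (d - e)) g ->
  (forall p, p \in tau -> g.[p.2, p.1] = 0) ->
  exists g' : {poly {poly R}}, [/\ g' != 0, coef_bounded (coef_bound d d) g',
    (forall p, p \in tau -> g'.[p.2, p.1] = 0) &
    forall i, exists s u, s != 0 /\ s *: graph_poly i = u * g'].
Proof.
move=> led bF sF vF; elim: e g led => [|e IHe] g led g0 sg bg vg.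
all: have [H|/existsNP [i nH]] :=
  pselect (forall i, exists s u, s != 0 /\ s *: graph_poly i = u * g).
1,3: by exists g; split=> // j; apply: leq_trans (bg j) _; apply: coef_bound_le; exact: leq_subr.
all: have [|s [u [r [s0 E sr br]]]] := pseudo_remainder (m := d.+1) g0 bg (bF i).
1,3: by apply: leq_trans (sF i) (leq_addl _ _).
  exfalso; apply: nH; exists s, u; split=> //; rewrite E.
  suff -> : r = 0 by rewrite addr0.
  by apply/eqP; rewrite -size_poly_leq0 -ltnS; apply: leq_trans sr sg.
have r0 : r != 0.
  by apply/eqP => r0; apply: nH; exists s, u; rewrite E r0 addr0.
apply: (IHe r) => //.
- exact: ltnW.
- by rewrite -ltnS; apply: leq_trans sr sg.
- by rewrite -subSS subSn.
move=> p pt; move: E (vF i p pt) (vg p pt); move: (graph_poly i) => f E.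
move: (congr1 (fun x : {poly {poly R}} => x.[p.2, p.1]) E); rewrite !(hornerZ, hornerM, hornerD).
by move=> H f0 g'0; move: H; rewrite f0 g'0 !mulr0 add0r.
Qed.

Lemma graph_poly_eval i a : map_poly (horner_eval a) (graph_poly i) = (P i).[a]%:P - Q i.
Proof.
rewrite /graph_poly rmorphB /= map_polyC /=; congr (_ - _).
by apply/polyP => k; rewrite !coef_map /= /horner_eval hornerC.
Qed.

(** Suppose [g] had degree at least 2 in y. The [Q i] have no common inner polynomial, so their
    ideal contains w(Y)(X - Y). At x = a, [g] becomes a divisor g_a of all [(P i).[a]%:P - Q i], so
    the ideal lies in the one generated by g_a(X) and g_a(Y), and g_a divides [w]. This for almost
    all [a] contradicts [coprime_divisors_absurd]. *)
Lemma relation_degree (g : {poly {poly R}}) i1 i2 :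
  (1 < size (Q i1))%N -> (1 < size (P i2))%N ->
  (forall p : {poly R}, (2 < size p)%N -> exists i, forall r, Q i <> r \Po p) ->
  g != 0 -> (forall i, exists s u, s != 0 /\ s *: graph_poly i = u * g) -> (size g <= 2)%N.
Proof.
move=> s1 s2 indec g0 dv; rewrite leqNgt; apply/negP => sg.
have [[p [sp H]]|[w [w0 Jw]]] := luroth_dichotomy s1.
  by have [i Hi] := indec p sp; have [r Er] := H i; case: (Hi r).
(* The polynomial [t] is the product of the denominators [s] of the finitely many generators
   occurring in [H]. *)
have key H : bidiff_ideal Q H -> exists2 t : {poly R}, t != 0 & forall a, t.[a] != 0 ->
    exists A B, H = (map_poly (horner_eval a) g)%:P * A + (map_poly (horner_eval a) g)^:P * B.
  elim=> [|i U H' _ [t t0 Ht]].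
    by exists 1; [exact: oner_neq0 | move=> a _; exists 0, 0; rewrite !mulr0 addr0].
  have [s [u [s0 E]]] := dv i.
  exists (t * s); first by rewrite mulf_neq0.
  move=> a; rewrite hornerM mulf_eq0 negb_or => /andP[ta sa].
  have [A [B EH]] := Ht a ta; set ga := map_poly _ g in EH *.
  pose v := - (s.[a]^-1 *: map_poly (horner_eval a) u).
  have EQ : Q i = (P i).[a]%:P + v * ga.
    have := congr1 (map_poly (horner_eval a)) E; rewrite rmorphM /= -mul_polyC rmorphM /=.
    rewrite map_polyC graph_poly_eval /= /horner_eval -/ga mul_polyC => E'.
    rewrite /v mulNr -scalerAl -E' scalerA mulVf // scale1r; ring.
  exists (A - U * v%:P), (B + U * v^:P).
  rewrite EH bidiffE EQ !rmorphD /= !rmorphM /= !map_polyC /=; ring.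
have [t t0 Ht] := key _ Jw.
have [s [u [s0 E]]] := dv i2.
apply: (@coprime_divisors_absurd w (t * lead_coef g * s) (P i2) (Q i2)) => //.
  by rewrite !mulf_neq0 // lead_coef_eq0.
move=> a; rewrite !hornerM !mulf_eq0 !negb_or => /andP[/andP[ta la] sa].
have [A [B EH]] := Ht a ta; exists (map_poly (horner_eval a) g).
have sga : size (map_poly (horner_eval a) g) = size g by apply: size_map_poly_id0.
split; first by rewrite sga; apply: leq_trans sg.
  by apply: two_copies_dvdp EH; rewrite sga.
have := congr1 (map_poly (horner_eval a)) E; rewrite rmorphM /= -mul_polyC rmorphM /=.
rewrite map_polyC graph_poly_eval /= /horner_eval mul_polyC => E'.
rewrite -opprB dvdpNr -(dvdpZr _ _ sa) E'; exact: dvdp_mull.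
Qed.

(** Now y = -k0/k1 is a rational function of x in lowest terms, and P = Q(-k0/k1) is a polynomial.
    This forces [k1] to be constant, and the common degree bound [D] then forces degree 1. *)
Lemma relation_affine (g : {poly {poly R}}) D i1 i2 :
  (0 < D)%N -> (forall i, (size (P i) <= D.+1)%N) -> size (Q i1) = D.+1 -> (1 < size (P i2))%N ->
  size g = 2%N -> (forall i, exists s u, s != 0 /\ s *: graph_poly i = u * g) ->
  exists al be, [/\ al != 0, forall i, P i = Q i \Po (al *: 'X + be%:P) &
    forall x y : R, (g`_1).[x] != 0 -> g.[y, x] = 0 -> y = al * x + be].
Proof.
move=> D0 sP sQ s2 sg dv.
have Eg y x : g.[y, x] = (g`_1).[x] * y + (g`_0).[x].
  have {1}-> : g = (g`_1)%:P * 'X + (g`_0)%:P.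
    apply/polyP => k; rewrite !coefE; case: k => [|[|k]] /=; rewrite ?mulr0 ?mulr1 ?add0r ?addr0 //.
    by rewrite nth_default // sg.
  by rewrite !hornerE.
have g10 : g`_1 != 0 by rewrite -[1%N]/(2.-1) -sg -lead_coefE lead_coef_eq0 -size_poly_gt0 sg.
have rel i : exists2 s : {poly R}, s != 0 & forall x y, s.[x] != 0 -> g.[y, x] = 0 ->
    (P i).[x] = (Q i).[y].
  have [s [u [s0 E]]] := dv i; exists s => // x y sx gyx.
  have := congr1 (fun h : {poly {poly R}} => h.[y, x]) E.
  rewrite -mul_polyC !hornerM hornerC graph_poly_horner gyx mulr0 => /eqP.
  by rewrite mulf_eq0 (negPf sx) subr_eq0 => /eqP.
set h := gcdp g`_0 g`_1.
pose k0 := g`_0 %/ h; pose k1 := g`_1 %/ h.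
have Ek0 : g`_0 = k0 * h by rewrite divpK // dvdp_gcdl.
have Ek1 : g`_1 = k1 * h by rewrite divpK // dvdp_gcdr.
have h0 : h != 0 by rewrite gcdp_eq0 negb_and g10 orbT.
have k10 : k1 != 0 by apply: contraNneq g10 => Z; rewrite Ek1 Z mul0r.
have cop : coprimep k1 (- k0) by rewrite -scaleN1r coprimepZr ?oppr_eq0 ?oner_eq0 // coprimep_sym coprimep_div_gcd ?g10 ?orbT.
have Ekg y x : g.[y, x] = h.[x] * (k1.[x] * y + k0.[x]).
  by rewrite Eg Ek0 Ek1 !hornerM; ring.
(* The numerator of [Q i1] at -k0/k1. Modulo [k1] only the term with (-k0)^D survives. *)
pose N := \sum_(j < D.+1) (Q i1)`_j *: ((- k0) ^+ j * k1 ^+ (D - j)).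
have EN : N = k1 ^+ D * P i1.
  have [s s0 Hs] := rel i1.
  apply: (@poly_eq_off (s * k1)); first by rewrite mulf_neq0.
  move=> a; rewrite hornerM mulf_eq0 negb_or => /andP[sa ka].
  rewrite hornerM (Hs a (- k0.[a] / k1.[a])) //; last first.
    by rewrite Ekg [X in _ * (X + _)]mulrC divfK // addNr mulr0.
  rewrite horner_sum horner_exp (horner_coef (Q i1)) sQ mulr_sumr; apply: eq_bigr => j _.
  rewrite !(hornerZ, hornerM, horner_exp, hornerN) expr_div_n.
  have -> : k1.[a] ^+ D = k1.[a] ^+ (D - j) * k1.[a] ^+ j by rewrite -exprD subnK // -ltnS.
  by field; rewrite expf_neq0.
have sk1 : size k1 == 1.
  rewrite -dvdp1 -(@Gauss_dvdpr _ _ ((- k0) ^+ D)) ?coprimep_expr // mulr1.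
  have lq : (Q i1)`_D != 0.
    by rewrite -[D]/(D.+1.-1) -sQ -lead_coefE lead_coef_eq0 -size_poly_gt0 sQ.
  rewrite -(dvdpZr _ _ lq).
  have : k1 %| N by rewrite EN; apply: dvdp_mulr; rewrite -(prednK D0) exprS dvdp_mulr.
  rewrite /N big_ord_recr /= subnn mulr1 dvdp_addr //.
  apply: (big_ind (fun p => k1 %| p)); [exact: dvdp0 | by move=> ? ? ? ?; apply: dvdp_add |].
  move=> j _; rewrite -mul_polyC; do 2!apply: dvdp_mull.
  by rewrite -(prednK (_ : 0 < D - j)%N) ?subn_gt0 // exprS dvdp_mulr.
have [c c0 Ec] := size_poly1P _ sk1.
have [rho rhoE] : exists rho : {poly R}, forall x, h.[x] * (c * rho.[x] + k0.[x]) = 0.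
  exists (- (c^-1 *: k0)) => x.
  by rewrite hornerN hornerZ mulrN mulrA mulfV // mul1r addNr mulr0.
have PQ i : P i = Q i \Po rho.
  have [s s0 Hs] := rel i; apply: (@poly_eq_off s) => // a sa.
  rewrite horner_comp; apply: Hs => //; by rewrite Ekg Ec hornerC rhoE.
have srho : (size rho <= 2)%N.
  have := size_comp_poly (Q i1) rho; rewrite -PQ sQ /= => E.
  have := sP i1; rewrite -ltnS => l1.
  have : (D * (size rho).-1 <= D)%N by rewrite -E; clear -l1; case: (size _) l1.
  by rewrite -[X in (_ <= X)%N]muln1 leq_pmul2l //; case: (size rho) => [|[|[]]].
have Erho : rho = rho`_1 *: 'X + (rho`_0)%:P.
  apply/polyP => k; rewrite !coefE; case: k => [|[|k]] /=; rewrite ?mulr0 ?mulr1 ?add0r ?addr0 //.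
  by rewrite nth_default //; apply: leq_trans srho _.
exists rho`_1, rho`_0; split.
- apply: contraTneq s2 => r1; rewrite -leqNgt PQ Erho r1 scale0r add0r comp_polyCr.
  exact: size_polyC_leq1.
- by move=> i; rewrite -Erho -PQ.
move=> x y gx gyx; have := rhoE x; rewrite {1}Erho !hornerE.
have hx : h.[x] != 0 by apply: contraNneq gx => Z; rewrite Ek1 hornerM Z mulr0.
move=> /eqP; rewrite mulf_eq0 (negPf hx) /= => /eqP E1.
move: gyx; rewrite Ekg Ec hornerC => /eqP; rewrite mulf_eq0 (negPf hx) /= => /eqP E2.
by apply: (mulfI c0); apply: (@addIr _ k0.[x]); rewrite E2 E1.
Qed.

(** [tau] has more distinct first coordinates than a nonzero polynomial of size at most
    [coef_bound d d] has roots. Hence the common divisor involves y, and its leading coefficient is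
    nonzero somewhere on [tau]. The resulting point of [tau] on the line locates the line in a known
    cell. *)
Lemma affine_relation d D (tau : seq (R * R)) i1 i2 :
  (0 < D <= d)%N -> (forall i, (size (P i) <= D.+1)%N) -> (forall i, (size (Q i) <= D.+1)%N) ->
  size (Q i1) = D.+1 -> (1 < size (P i2))%N ->
  (forall p : {poly R}, (2 < size p)%N -> exists i, forall r, Q i <> r \Po p) ->
  uniq [seq p.1 | p <- tau] -> (coef_bound d d <= size tau)%N ->
  (forall i p, p \in tau -> (P i).[p.1] = (Q i).[p.2]) ->
  exists al be, [/\ al != 0, forall i, P i = Q i \Po (al *: 'X + be%:P) &
    exists2 p, p \in tau & p.2 = al * p.1 + be].
Proof.
move=> /andP[D0 Dd] sP sQ s1 s2 indec utau stau vtau.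
have sF i : (size (graph_poly i) <= d.+1)%N.
  apply: leq_trans (size_polyD _ _) _; rewrite geq_max size_polyN size_map_polyC.
  rewrite (leq_trans (size_polyC_leq1 _)) //=; exact: leq_trans (sQ i) _.
have bF i : coef_bounded d.+1 (graph_poly i).
  move=> j; rewrite /graph_poly coefB coefC coef_map /=.
  apply: leq_trans (size_polyD _ _) _; rewrite geq_max size_polyN.
  rewrite [X in _ && X](leq_trans (size_polyC_leq1 _)) // andbT.
  by case: ifP => _; rewrite ?size_poly0 //; apply: leq_trans (sP i) _.
have vF i p : p \in tau -> (graph_poly i).[p.2, p.1] = 0.
  by move=> pt; rewrite graph_poly_horner (vtau i p pt) subrr.
have F0 : graph_poly i1 != 0.
  apply/eqP => /(congr1 (fun h : {poly {poly R}} => h`_D)).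
  rewrite /graph_poly coefB coefC coef_map /= coef0 eqn0Ngt D0 sub0r => /eqP.
  by rewrite oppr_eq0 polyC_eq0 -[D]/(D.+1.-1) -s1 -lead_coefE lead_coef_eq0 -size_poly_eq0 s1.
have [|g [g0 bg vg dv]] := minimal_relation (leqnn d) bF sF vF F0 (sF i1) _ (vF i1).
  by rewrite subnn; apply: bF.
have noroot (q : {poly R}) : q != 0 -> (size q <= coef_bound d d)%N ->
    exists2 p, p \in tau & q.[p.1] != 0.
  move=> q0 sq; apply: contrapT => H.
  have := max_poly_roots q0 _ utau; rewrite size_map ltnNge (leq_trans sq stau) => E.
  apply: notF; apply: E; apply/allP => x /mapP [p pt ->].
  by apply/rootP; apply: contrapT => /eqP Hx; apply: H; exists p.
have s1' : (1 < size (Q i1))%N by rewrite s1.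
have sg2 : (size g <= 2)%N := relation_degree s1' s2 indec g0 dv.
have sg : size g = 2%N.
  apply/eqP; rewrite eqn_leq sg2 ltnNge; apply/negP => /size1_polyC Eg.
  have g00 : g`_0 != 0 by apply: contraNneq g0 => Z; rewrite Eg Z.
  have [p pt] := noroot _ g00 (bg 0%N); have := vg p pt.
  by rewrite {1}Eg hornerC => ->; rewrite eqxx.
have [al [be [al0 E H]]] := relation_affine D0 sP s1 s2 sg dv.
exists al, be; split=> //.
have g10 : g`_1 != 0 by rewrite -[1%N]/(2.-1) -sg -lead_coefE lead_coef_eq0.
have [p pt Hp] := noroot _ g10 (bg 1%N); exists p => //.
by apply: H => //; apply: vg.
Qed.

End AffineRelation.

(** * Curves meet few blocks of a grid *)

Section Pieces.
Variable R : rcfType.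
Implicit Types (p : {poly R}).

Lemma root_list p : p != 0 -> exists rs : seq R, [/\ uniq rs, (size rs < size p)%N &
  forall x, root p x = (x \in rs)].
Proof.
move=> p0; exists (rootsR p).
have ru : uniq (rootsR p) by apply: (sorted_uniq lt_trans); [exact: ltxx | exact: sorted_roots].
have rE x : root p x = (x \in rootsR p) by rewrite -roots_on_rootsR.
split=> //; apply: max_poly_roots => //; apply/allP => x; by rewrite -rE.
Qed.

Lemma count_lt_between (rs : seq R) (x y r : R) : x <= r < y -> r \in rs ->
  (count (< x) rs < count (< y) rs)%N.
Proof.
move=> /andP[xr ry] /path.splitPr [s1 s2]; rewrite !count_cat /= ry ltNge xr /=.
rewrite add0n add1n addnS ltnS; apply: leq_add; apply: sub_count => z /= zx;
  by apply: lt_trans zx (le_lt_trans xr ry).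
Qed.

Lemma count_lt_mono (rs : seq R) (x y : R) : x <= y -> (count (< x) rs <= count (< y) rs)%N.
Proof. by move=> xy; apply: sub_count => z /= zx; apply: lt_le_trans zx xy. Qed.

(** The colour of a point counts the roots of the derivative strictly below it. No such root lies
    strictly between two points of the same colour, so the derivative has one sign inside a colour
    class. *)
Lemma monotone_pieces p : (1 < size p)%N -> exists (col : R -> nat) (up : nat -> bool),
  (forall x, (col x < (size p).-1)%N) /\
  forall x y, x < y -> col x = col y ->
    if up (col x) then p.[x] < p.[y] else p.[y] < p.[x].
Proof.
move=> sp; have sp' : size p^`() = (size p).-1 by rewrite size_deriv // pchar_num.
have p'0 : p^`() != 0 by rewrite -size_poly_gt0 sp'; case: (size p) sp => [|[]].
have [rs [_ srs rootE]] := root_list p'0.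
pose col x := count (< x) rs.
have nr x y r : col x = col y -> x <= r < y -> p^`().[r] != 0.
  move=> cE xry; apply/negP => Hr.
  have := count_lt_between xry (_ : r \in rs); rewrite -rootE => /(_ Hr).
  by rewrite -/(col x) -/(col y) cE ltnn.
have same x y z : x <= z <= y -> col x = col y -> col z = col x.
  move=> /andP[xz zy] cE; apply/eqP; rewrite eqn_leq {1}cE.
  by rewrite /col !count_lt_mono.
have ivt (s t : R) : s <= t -> p^`().[s] * p^`().[t] <= 0 -> exists2 r, s <= r <= t & p^`().[r] = 0.
  move=> st H; exists (odflt 0 (has_ivt_root p^`() s t)); last by apply/rootP/ivt_rootP.
  by have := ivt_root_in st H; rewrite in_itv.
have no_change s t : col s = col t -> p^`().[t] != 0 -> p^`().[s] != 0 ->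
    ~ p^`().[s] * p^`().[t] <= 0.
  move=> cE t0 s0 H; have [st|ts] := leP s t.
    have [r /andP[sr rt] Er] := ivt _ _ st H.
    have : s <= r < t by rewrite sr lt_neqAle rt andbT; apply: contraNneq t0 => <-; rewrite Er.
    by move=> /(nr _ _ _ cE); rewrite Er eqxx.
  rewrite mulrC in H.
  have [r /andP[tr rs'] Er] := ivt _ _ (ltW ts) H.
  have : t <= r < s by rewrite tr lt_neqAle rs' andbT; apply: contraNneq s0 => <-; rewrite Er.
  by move=> /(nr _ _ _ (esym cE)); rewrite Er eqxx.
have mv x y : x < y -> col x = col y -> exists s, [/\ p^`().[s] != 0, col s = col x,
    (p.[x] < p.[y]) = (0 < p^`().[s]) & (p.[y] < p.[x]) = (p^`().[s] < 0)].
  move=> xy cE; have [s] := poly_mvt p xy; rewrite in_itv /= => /andP[xs sy] E; exists s.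
  have yx : 0 < y - x by rewrite subr_gt0.
  split; [apply: nr cE _ | apply: same cE | |]; rewrite ?(ltW xs) ?(ltW sy) //.
    by rewrite -subr_gt0 E pmulr_lgt0.
  by rewrite -subr_lt0 E pmulr_llt0.
pose up c := `[< exists x y, [/\ x < y, col x = c, col y = c & p.[x] < p.[y]] >].
exists col, up; split; first by move=> x; apply: leq_ltn_trans (count_size _ _) _; rewrite -sp'.
move=> x y xy cE; have [s [s0 sE lts gts]] := mv x y xy cE.
have [|] := boolP (up (col x)).
  move=> /asboolP [u [v [uv uE vE]]]; have [t [t0 tE -> _]] := mv u v uv (etrans uE (esym vE)).
  move=> t_gt; rewrite lts lt0r s0 /= leNgt; apply/negP => s_lt.
  apply: (@no_change s t) => //; first by rewrite sE tE uE.
  by rewrite pmulr_lle0 // ltW.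
move=> /asboolPn nup; rewrite gts lt_neqAle s0 /= leNgt; apply/negP => s_gt.
by apply: nup; exists x, y; split=> //; rewrite lts.
Qed.

End Pieces.

Section Cells.

Lemma card_imset_factor (T U V : finType) (E : {set T}) (f : T -> U) (g : T -> V) :
  {in E &, forall p q, g p = g q -> f p = f q} -> (#|f @: E| <= #|g @: E|)%N.
Proof.
move=> H; have [/set0Pn [p0 p0E]|/negbNE/eqP ->] := boolP (E != set0); last by rewrite !imset0 !cards0.
pose h v := f (odflt p0 [pick p in E | g p == v]).
apply: leq_trans (leq_imset_card h (g @: E)); apply: subset_leq_card.
apply/subsetP => _ /imsetP [p pE ->]; apply/imsetP; exists (g p); first by apply: imset_f.
rewrite /h; case: pickP => [q /andP[qE /eqP gq]|/(_ p)] /=; first by apply: H.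
by rewrite pE eqxx.
Qed.

Variable (R : rcfType).
Variables (N K r : nat) (B : 'I_N -> R).
Hypothesis B_incr : forall i j : 'I_N, (i < j)%N -> B i < B j.

Definition block (i : 'I_N) : 'I_r.+1 := inord (i %/ K).
Definition cell (p : 'I_N * 'I_N) := (block p.1, block p.2).

Hypothesis (K0 : (0 < K)%N) (NK : (N <= r.+1 * K)%N).

Lemma blockE i : block i = (i %/ K)%N :> nat.
Proof. by rewrite inordK // ltn_divLR //; apply: leq_trans (ltn_ord i) NK. Qed.

(* On a piece where [P] and [Q] are both strictly monotone the relation [P x = Q y] is a
   strictly monotone graph, so it meets at most [2 r + 1] blocks of the grid. *)
Lemma card_cells d (P Q : {poly R}) (E : {set 'I_N * 'I_N}) :
  (1 < size P <= d.+1)%N -> (1 < size Q <= d.+1)%N ->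
  (forall p, p \in E -> P.[B p.1] = Q.[B p.2]) ->
  (#|cell @: E| <= d.+1 * d.+1 * (2 * r).+1)%N.
Proof.
move=> /andP[sP lP] /andP[sQ lQ] EPQ.
have [cP [uP [cPb PP]]] := monotone_pieces sP.
have [cQ [uQ [cQb QQ]]] := monotone_pieces sQ.
(* Along an increasing graph both block indices grow weakly, so their sum determines the cell; for a
   decreasing graph the second index is reversed. Either way there are [2 * r + 1] levels. *)
pose lev (p : 'I_N * 'I_N) := (if uP (cP (B p.1)) == uQ (cQ (B p.2))
  then p.1 %/ K + p.2 %/ K else p.1 %/ K + (r - p.2 %/ K))%N.
have bl (i : 'I_N) : (i %/ K <= r)%N by rewrite -blockE -ltnS.
pose key (p : 'I_N * 'I_N) : 'I_d.+1 * 'I_d.+1 * 'I_(2 * r).+1 :=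
  (inord (cP (B p.1)), inord (cQ (B p.2)), inord (lev p)).
apply: (leq_trans (card_imset_factor (g := key) _)); last first.
  by apply: leq_trans (max_card _) _; rewrite !card_prod !card_ord.
have cPd x : (cP x < d.+1)%N by apply: leq_trans (cPb x) _; rewrite -ltnS prednK ltnW.
have cQd x : (cQ x < d.+1)%N by apply: leq_trans (cQb x) _; rewrite -ltnS prednK ltnW.
have levd p : (lev p < (2 * r).+1)%N.
  rewrite /lev; move: (bl p.1) (bl p.2); move: (p.1 %/ K)%N (p.2 %/ K)%N => a b.
  case: ifP => _; clear; lia.
have half (i j i' j' : 'I_N) : (i, j) \in E -> (i', j') \in E -> (i < i')%N ->
   cP (B i) = cP (B i') -> cQ (B j) = cQ (B j') ->
   if uP (cP (B i)) == uQ (cQ (B j)) then (j < j')%N else (j' < j)%N.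
  move=> e1 e2 lt_i EcP EcQ; have := PP _ _ (B_incr lt_i) EcP.
  rewrite (EPQ _ e1) (EPQ _ e2) /=; have [jj|jj|jj] := ltngtP j j'.
  - have := QQ _ _ (B_incr jj) EcQ; case: (uP _); case: (uQ _) => //= H1 H2;
    by have := lt_trans H1 H2; rewrite ltxx.
  - have := QQ _ _ (B_incr jj) (esym EcQ); rewrite -EcQ; case: (uP _); case: (uQ _) => //= H1 H2;
    by have := lt_trans H1 H2; rewrite ltxx.
  - by rewrite (ord_inj jj) !ltxx if_same.
move=> [i j] [i' j'] e1 e2 [] /(congr1 val) + /(congr1 val) + /(congr1 val).
rewrite /= !inordK // => EcP EcQ; rewrite /lev /= -EcP -EcQ => Ev.
have bi := bl i; have bi' := bl i'; have bj := bl j; have bj' := bl j'.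
suff [E1 E2] : (i %/ K = i' %/ K /\ j %/ K = j' %/ K)%N.
  by rewrite /cell; congr (_, _); apply: ord_inj; rewrite !blockE.
have dm (a b : 'I_N) : (a < b)%N -> (a %/ K <= b %/ K)%N by move=> ab; apply: leq_div2r; apply: ltnW.
have [ii|ii|ii] := ltngtP i i'.
- have := half _ _ _ _ e1 e2 ii EcP EcQ; have := dm _ _ ii; move: Ev bi bi' bj bj'.
  case: ifP => _ + + + + + + /dm; move: (i %/ K)%N (j %/ K)%N (i' %/ K)%N (j' %/ K)%N;
  clear => *; lia.
- have := half _ _ _ _ e2 e1 ii (esym EcP) (esym EcQ); have := dm _ _ ii; move: Ev bi bi' bj bj'.
  rewrite -EcP -EcQ; case: ifP => _ + + + + + + /dm;
  move: (i %/ K)%N (j %/ K)%N (i' %/ K)%N (j' %/ K)%N; clear => *; lia.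
- move: Ev bj bj'; rewrite (ord_inj ii); case: ifP => _;
  move: (j %/ K)%N (i' %/ K)%N (j' %/ K)%N; clear => *; lia.
Qed.

End Cells.

Section GoodCells.
Variable (R : rcfType).
Variables (N K r : nat) (B : 'I_N -> R).
Hypothesis B_incr : forall i j : 'I_N, (i < j)%N -> B i < B j.
Hypothesis (K0 : (0 < K)%N) (NK : (N <= r.+1 * K)%N).
Local Notation cell := (@cell N K r).

Definition cell_set (g : 'I_r.+1 * 'I_r.+1) : {set 'I_N * 'I_N} := [set p | cell p == g].
Definition good_cells m (E : {set 'I_N * 'I_N}) := [set g | (m < #|E :&: cell_set g|)%N].

Lemma card_cell_set g : (#|cell_set g| <= K * K)%N.
Proof.
have [k Ek] : exists k, K = k.+1 by case: (K) K0 => // k; exists k.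
pose loc (p : 'I_N * 'I_N) : 'I_k.+1 * 'I_k.+1 := (inord (p.1 %% K), inord (p.2 %% K)).
have <- : #|loc @: cell_set g| = #|cell_set g|.
  apply: card_in_imset => -[i j] [i' j']; rewrite !inE => /eqP <- /eqP Ec [].
  move=> /(congr1 (@nat_of_ord _)) + /(congr1 (@nat_of_ord _)) /=.
  rewrite !inordK -?Ek ?ltn_pmod // => E1 E2; move: Ec => [].
  move=> /(congr1 (@nat_of_ord _)) + /(congr1 (@nat_of_ord _)); rewrite !(blockE _ NK) // => E3 E4.
  have e1 : nat_of_ord i = i' by rewrite (divn_eq i K) (divn_eq i' K); congr (_ * _ + _)%N.
  have e2 : nat_of_ord j = j' by rewrite (divn_eq j K) (divn_eq j' K); congr (_ * _ + _)%N.
  by congr (_, _); apply: ord_inj.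
by apply: leq_trans (max_card _) _; rewrite card_prod !card_ord Ek.
Qed.

Lemma card_by_cells m (E : {set 'I_N * 'I_N}) :
  (#|E| <= m * #|cell @: E| + K * K * #|good_cells m E|)%N.
Proof.
rewrite -sum1_card (partition_big_imset cell) /=.
rewrite mulnC -sum_nat_const mulnC -sum_nat_const.
rewrite [X in (_ <= _ + X)%N](_ : _ = (\sum_g if (m < #|E :&: cell_set g|)%N then K * K else 0)%N).
  rewrite [X in (X <= _)%N]big_mkcond [X in (_ <= X + _)%N]big_mkcond -big_split /=.
  apply: leq_sum => g _; case: ifP => // _.
  rewrite [X in (X <= _)%N](_ : _ = #|E :&: cell_set g|); last first.
    by rewrite -sum1_card; apply: eq_bigl => p; rewrite !inE.
  case: ifPn; last by rewrite -leqNgt addn0.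
  move=> _; apply: leq_trans (leq_addl _ _); apply: leq_trans (card_cell_set g).
  by apply: subset_leq_card; apply: subsetIr.
by rewrite big_mkcond; apply: eq_bigr => g _; rewrite inE.
Qed.

(** [K] is so large that the cells with at most [m] points, of which the curve meets O(n/K), hold
    less than half of [E]. *)
Lemma many_good_cells n d k m (P Q : {poly R}) (E : {set 'I_N * 'I_N}) :
  (1 < size P <= d.+1)%N -> (1 < size Q <= d.+1)%N ->
  (forall p, p \in E -> P.[B p.1] = Q.[B p.2]) ->
  K = (8 * (k * m * (d.+1 * d.+1))).+1 -> (K <= n)%N -> (r * K <= n)%N -> (n <= k * #|E|)%N ->
  (n <= 2 * k * (K * K) * #|good_cells m E|)%N.
Proof.
move=> hP hQ hE EK Kn rn nE.
have := leq_trans (card_by_cells m E)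
  (leq_add (leq_mul (leqnn m) (card_cells B_incr K0 NK hP hQ hE)) (leqnn _)).
have n0 : (0 < n)%N := leq_trans K0 Kn.
have k0 : (0 < k)%N by move: (leq_trans n0 nE); rewrite muln_gt0 => /andP[].
rewrite -(leq_pmul2l k0).
move=> /(leq_trans nE); rewrite mulnDr => H.
set c := (k * m * (d.+1 * d.+1))%N in EK.
have {}H : (n <= c * (2 * r).+1 + k * (K * K * #|good_cells m E|))%N.
  by apply: leq_trans H _; rewrite leq_add2r /c !mulnA.
clearbody c; move: H; rewrite -!mulnA; move: (k * (K * _))%N => X; clear -EK Kn rn.
have : (8 * (c * r) <= n)%N.
  by apply: leq_trans rn; rewrite EK mulnS [(r * _)%N]mulnC -mulnA leq_addl.
by rewrite EK in Kn; lia.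
Qed.

End GoodCells.

(** * Averaging and pigeonhole *)

Section Counting.
Local Open Scope nat_scope.

Lemma card_pairs (T U : finType) (W : {set T}) (E : T -> {set U}) :
  #|[set x : T * U | (x.1 \in W) && (x.2 \in E x.1)]| = \sum_(w in W) #|E w|.
Proof.
rewrite -sum1_card (eq_bigl (fun x => (x.1 \in W) && (x.2 \in E x.1))) => [|x]; last by rewrite inE.
rewrite -(pair_big_dep (fun w => w \in W) (fun w p => p \in E w) (fun _ _ => 1)) /=.
by apply: eq_bigr => w _; rewrite sum1_card.
Qed.

(** Elements below the threshold contribute at most half of the total, and each remaining one at
    most [m * n]. *)
Lemma popular_card (T : finType) (W : {set T}) (X : T -> nat) n k m : 0 < n ->
  #|W| * n <= k * \sum_(w in W) X w -> (forall w, w \in W -> X w <= m * n) ->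
  #|W| <= 2 * k * m * #|[set w in W | n <= 2 * k * X w]|.
Proof.
move=> n0 H bX; set V := [set _ in _ | _].
have VW : V \subset W by apply/subsetP => w; rewrite inE => /andP[].
have H2 : 2 * k * \sum_(w in W) X w <= 2 * k * m * n * #|V| + #|W| * n.
  rewrite big_distrr /= (big_setID V) /= (setIidPr VW); apply: leq_add.
    rewrite [X in _ <= X]mulnC -sum_nat_const; apply: leq_sum => w /(subsetP VW) wW.
    by rewrite -[X in _ <= X]mulnA leq_mul2l bX ?orbT.
  apply: leq_trans (_ : #|W :\: V| * n <= _); last first.
    by rewrite leq_mul2r subset_leq_card ?orbT // subsetDl.
  rewrite -sum_nat_const; apply: leq_sum => w; rewrite !inE => /andP[+ wW].
  by rewrite wW /= -ltnNge => /ltnW.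
rewrite -(leq_pmul2r n0); move: H H2; move: (\sum_(w in W) X w) => S.
move: #|W| #|V| => a b H H2.
have : 2 * (a * n) <= 2 * k * m * n * b + a * n.
  by apply: leq_trans H2; rewrite -mulnA leq_mul2l.
by rewrite mul2n -addnn leq_add2r => H3; apply: leq_trans H3 _; rewrite -!mulnA [b * n]mulnC.
Qed.

(** The elements of small classes fill at most [kap] classes of size below |Z| / (2 kap), hence at
    most half of [Z]. *)
Lemma popular_class (T U : finType) (Z : {set T}) (key : T -> U) kap :
  #|key @: Z| <= kap ->
  #|Z| <= 2 * #|[set z in Z | #|Z| <= 2 * kap * #|[set y in Z | key y == key z]| ]|.
Proof.
move=> bk; set L := [set _ in _ | _].
have LZ : L \subset Z by apply/subsetP => w; rewrite inE => /andP[].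
have [->|/set0Pn [z0 z0Z]] := eqVneq Z set0; first by rewrite cards0.
have kap0 : 0 < kap.
  by apply: leq_trans bk; rewrite card_gt0; apply/set0Pn; exists (key z0); apply: imset_f.
suff : 2 * #|Z :\: L| <= #|Z|.
  by rewrite cardsD (setIidPr LZ); have := subset_leq_card LZ; lia.
rewrite -(leq_pmul2l kap0) mulnA [kap * 2]mulnC -sum1_card.
rewrite (partition_big_imset key) /= big_distrr /=.
apply: leq_trans (_ : \sum_(i in key @: (Z :\: L)) #|Z| <= _); last first.
  rewrite sum_nat_const leq_mul2r; apply/orP; right; apply: leq_trans bk.
  by apply: subset_leq_card; apply: imsetS; apply: subsetDl.
apply: leq_sum => _ /imsetP [z + ->]; rewrite !inE => /andP[+ zZ].
rewrite zZ /= -ltnNge => /ltnW; apply: leq_trans; rewrite leq_mul2l sum1_card; apply/orP; right.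
by apply: subset_leq_card; apply/subsetP => y; rewrite unfold_in !inE => /andP[/andP[_ ->] ->].
Qed.

Lemma pigeonhole_seq (T : finType) (X : eqType) (A : {set T}) (l : seq X) (r : T -> X -> bool) :
  A != set0 -> (forall a, a \in A -> exists2 x, x \in l & r a x) ->
  exists2 x, x \in l & #|A| <= size l * #|[set a in A | r a x]|.
Proof.
elim: l A => [|x l IH] A A0 H; first by have /set0Pn [a /H []] := A0.
pose A1 := [set a in A | r a x].
have A1A : A1 \subset A by apply/subsetP => a; rewrite inE => /andP[].
have [le|lt] := leqP #|A| ((size l).+1 * #|A1|); first by exists x; rewrite ?mem_head.
have cD : #|A :\: A1| = #|A| - #|A1| by rewrite cardsD (setIidPr A1A).
have [||y yl Hy] := IH (A :\: A1).
- rewrite -card_gt0 cD subn_gt0; apply: leq_ltn_trans lt; exact: leq_pmull.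
- move=> a; rewrite !inE => /andP[+ aA]; rewrite aA /= => nr.
  by have [y] := H a aA; rewrite inE => /predU1P [-> /(negP nr)//|yl ry]; exists y.
exists y; rewrite ?inE ?yl ?orbT //=.
have le2 : #|[set a in A :\: A1 | r a y]| <= #|[set a in A | r a y]|.
  by apply: subset_leq_card; apply/subsetP => a; rewrite !inE => /andP[/andP[_ ->] ->].
have := leq_trans Hy (leq_mul (leqnn _) le2); have := subset_leq_card A1A; rewrite cD.
move: lt; move: #|A| #|A1| #|[set a in A | r a y]| (size l) => a b c s; clear; nia.
Qed.

End Counting.

Section Keys.
Variables (N K r : nat).
Hypothesis (K0 : (0 < K)%N) (NK : (N <= r.+1 * K)%N).
Local Notation celltype := ('I_r.+1 * 'I_r.+1)%type.

(** For constant [K] the number of patterns is O(r^2), that is O(n^2). *)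
Lemma card_cell_patterns (A : {set celltype * {set 'I_N * 'I_N}}) :
  (forall a, a \in A -> a.2 \subset @cell_set N K r a.1) ->
  (#|A| <= r.+1 * r.+1 * 2 ^ (K * K))%N.
Proof.
move=> H; have sub : A \subset [set a | a.2 \in powerset (@cell_set N K r a.1)].
  by apply/subsetP => a aA; rewrite inE powersetE H.
apply: leq_trans (subset_leq_card sub) _; rewrite -sum1_card.
rewrite (eq_bigl (fun a => true && (a.2 \in powerset (@cell_set N K r a.1)))); last first.
  by move=> a; rewrite inE.
rewrite -(pair_big_dep predT (fun g s => s \in powerset (@cell_set N K r g)) (fun _ _ => 1%N)) /=.
apply: leq_trans (_ : \sum_(g : celltype) 2 ^ (K * K) <= _)%N.
  apply: leq_sum => g _; rewrite sum1_card card_powerset leq_pexp2l //; exact: (card_cell_set K0 NK).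
by rewrite sum_nat_const card_prod !card_ord.
Qed.

End Keys.

(** * Affine relations shared by many curves *)

Section RichLines.
Variable R : rcfType.

Definition line_pairs N (B : 'I_N -> R) (s : R * R) :=
  [set p : 'I_N * 'I_N | B p.2 == s.1 * B p.1 + s.2].

Lemma incr_inj N (B : 'I_N -> R) :
  (forall i j : 'I_N, (i < j)%N -> B i < B j) -> injective B.
Proof.
move=> B_incr i j E; apply: ord_inj; case: (ltngtP i j) => // /B_incr; by rewrite E ltxx.
Qed.

Lemma leq_block_count n N K : (0 < K)%N -> (N <= n)%N -> (N <= (n %/ K).+1 * K)%N.
Proof. by move=> K0 Nn; apply: leq_trans Nn _; apply: ltnW; apply: ltn_ceil. Qed.

(** An elementary substitute for an incidence bound. Each rich line has a number of good cells
    proportional to [n], and two points in a cell determine the line. So pairs (line, cell) inject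
    into the O(n^2) patterns. *)
Lemma rich_lines k : exists C n0, forall n N (B : 'I_N -> R) (S : seq (R * R)),
  (n0 <= n)%N -> (N <= n)%N -> (forall i j : 'I_N, (i < j)%N -> B i < B j) -> uniq S ->
  (forall s, s \in S -> s.1 != 0 /\ (n <= k * #|line_pairs B s|)%N) -> (size S <= C * n)%N.
Proof.
(* The threshold is [m = 1], because two points determine a line, and the curves have degree
   [d = 1]. *)
have [K EK] : exists K, K = (8 * (k * 1 * (2 * 2))).+1 by eexists.
exists (2 * k * (K * K) * (4 * 2 ^ (K * K)))%N, K => n N B S Kn Nn B_incr uS richS.
have K0 : (0 < K)%N by rewrite EK.
pose r := (n %/ K)%N; have NK : (N <= r.+1 * K)%N := leq_block_count K0 Nn.
have rn : (r * K <= n)%N := leq_trunc_div n K.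
have n0 : (0 < n)%N := leq_trans K0 Kn.
pose sl (i : 'I_(size S)) := tnth (in_tuple S) i.
have slS i : sl i \in S by apply: mem_tnth.
pose E i := line_pairs B (sl i).
pose G i : {set 'I_r.+1 * 'I_r.+1} := @good_cells N K r 1 (E i).
have nG i : (n <= 2 * k * (K * K) * #|G i|)%N.
  have [a0 rich] := richS _ (slS i).
  apply: (many_good_cells B_incr K0 NK (P := (sl i).1 *: 'X + (sl i).2%:P) (Q := 'X) (d := 1)) => //.
  - by rewrite size_polyDl size_scale // size_polyX // ltnS size_polyC_leq1.
  - by rewrite size_polyX.
  - by move=> p; rewrite inE !hornerE => /eqP.
pose Z := [set z : 'I_(size S) * ('I_r.+1 * 'I_r.+1) | (z.1 \in [set: 'I_(size S)]) && (z.2 \in G z.1)].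
have cZ : (size S * n <= 2 * k * (K * K) * #|Z|)%N.
  rewrite card_pairs (eq_bigl predT) => [|i]; last by rewrite inE.
  rewrite big_distrr /= -[X in (X * _)%N]card_ord -sum_nat_const; exact: leq_sum.
pose key (z : 'I_(size S) * ('I_r.+1 * 'I_r.+1)) := (z.2, E z.1 :&: @cell_set N K r z.2).
have keyI : {in Z &, injective key}.
  move=> [i g] [j g']; rewrite !inE /= => gi _ [<-] Eij; congr (_, _).
  have [p [q [pA qA pq]]] : exists p q, [/\ p \in E i :&: @cell_set N K r g, q \in E i :&: @cell_set N K r g & p != q].
    by have /card_gt1P [p [q []]] := gi; exists p, q.
  have := pA; have := qA; rewrite Eij; move: pA qA; rewrite !inE.
  move=> /andP[/eqP pi _] /andP[/eqP qi _] /andP[/eqP qj _] /andP[/eqP pj _].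
  have Bpq : B p.1 - B q.1 != 0.
    rewrite subr_eq0; apply: contraNneq pq => /(incr_inj B_incr) e1.
    rewrite -pair_eqE /= /pair_eq e1 eqxx /=; apply/eqP; apply: (incr_inj B_incr).
    by rewrite pi qi e1.
  have E1 : (sl i).1 = (sl j).1.
    by apply: (mulIf Bpq); rewrite !mulrBr; move: pi qi pj qj => -> ->; lra.
  have E2 : (sl i).2 = (sl j).2.
    by move: pi pj; rewrite E1 => ->; lra.
  have : sl i = sl j by rewrite [sl i]surjective_pairing E1 E2 -surjective_pairing.
  rewrite /sl !(tnth_nth (0, 0)) /= => /eqP; rewrite nth_uniq //= => /eqP; exact: ord_inj.
have : (#|Z| <= r.+1 * r.+1 * 2 ^ (K * K))%N.
  rewrite -(card_in_imset keyI); apply: (card_cell_patterns K0 NK).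
  by move=> _ /imsetP [z _ ->] /=; apply: subsetIr.
have r2 : (r.+1 <= 2 * n)%N.
  have : (r <= n)%N by apply: leq_trans rn; apply: leq_pmulr.
  by rewrite mul2n -addnn -addn1 => rle; apply: leq_add.
move=> H; have {}H := leq_trans H (leq_mul (leq_mul r2 r2) (leqnn _)).
rewrite -(leq_pmul2r n0); apply: leq_trans cZ _.
apply: leq_trans (leq_mul (leqnn _) H) _; rewrite leq_eqVlt; apply/orP; left; apply/eqP.
by move: (2 ^ _)%N; clear; move=> L; lia.
Qed.

End RichLines.

(** * From rich curves to affine maps with O(n) values *)

Section Stage.
Variable R : rcfType.

Definition affine (s : R * R) : {poly R} := s.1 *: 'X + s.2%:P.

Lemma affine_horner s x : (affine s).[x] = s.1 * x + s.2.
Proof. by rewrite !hornerE. Qed.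

(** An affine map is determined by its values at 0 and 1, which solve Q = P(0) and Q = P(1). *)
Lemma affine_options d (P Q : {poly R}) : (1 < size Q <= d.+1)%N ->
  exists2 l : seq (R * R), (size l <= d * d)%N & forall s, P = Q \Po affine s -> s \in l.
Proof.
move=> /andP[sQ lQ].
have rl c : exists2 rs : seq R, (size rs <= d)%N & forall x, Q.[x] = c -> x \in rs.
  have Qc : Q - c%:P != 0.
    rewrite -size_poly_gt0 size_polyDl ?(ltnW sQ) // size_polyN.
    exact: leq_ltn_trans (size_polyC_leq1 _) _.
  have [rs [_ srs H]] := root_list Qc; exists rs.
    rewrite -ltnS; apply: leq_trans srs _; apply: leq_trans lQ.
    by rewrite size_polyDl // size_polyN; exact: leq_ltn_trans (size_polyC_leq1 _) _.
  by move=> x Qx; rewrite -H /root !hornerE Qx subrr.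
have [r0 sr0 H0] := rl P.[0]; have [r1 sr1 H1] := rl P.[1].
exists [seq (y - x, x) | x <- r0, y <- r1]; first by rewrite size_allpairs leq_mul.
move=> s E; apply/allpairsP; exists (s.2, s.1 + s.2); split => /=.
- by apply: H0; rewrite E horner_comp affine_horner mulr0 add0r.
- by apply: H1; rewrite E horner_comp affine_horner mulr1.
- by rewrite addrK -surjective_pairing.
Qed.

Lemma fiber_card d (P Q : {poly R}) N (B : 'I_N -> R) (E : {set 'I_N * 'I_N}) : injective B ->
  (1 < size Q <= d.+1)%N -> (forall p, p \in E -> P.[B p.1] = Q.[B p.2]) ->
  (#|E| <= d * #|[set p.1 | p in E]|)%N.
Proof.
move=> B_inj /andP[sQ lQ] H; rewrite -sum1_card (partition_big_imset (fun p => p.1)) /=.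
rewrite mulnC -sum_nat_const; apply: leq_sum => i _; rewrite sum1_card.
have Qc : Q - P.[B i]%:P != 0.
  rewrite -size_poly_gt0 size_polyDl ?(ltnW sQ) // size_polyN.
  exact: leq_ltn_trans (size_polyC_leq1 _) _.
have sc : size (Q - P.[B i]%:P) = size Q.
  by rewrite size_polyDl // size_polyN; exact: leq_ltn_trans (size_polyC_leq1 _) _.
rewrite -ltnS; apply: leq_trans lQ; rewrite -sc.
set A := (X in #|X|); have -> : #|A| = size [seq B p.2 | p <- enum A].
  by rewrite size_map cardE.
apply: max_poly_roots => //.
  apply/allP => x /mapP [p]; rewrite mem_enum => /andP[pE /eqP <-] ->.
  by rewrite /root !hornerE -H // subrr.
rewrite map_inj_in_uniq ?enum_uniq // => p q; rewrite !mem_enum.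
move=> /andP[_ /eqP e1] /andP[_ /eqP e2] /B_inj e3.
by rewrite [p]surjective_pairing [q]surjective_pairing e1 e2 e3.
Qed.

Lemma transversal_firsts N (E : {set 'I_N * 'I_N}) : exists2 l : seq ('I_N * 'I_N),
  uniq [seq p.1 | p <- l] & size l = #|[set p.1 | p in E]| /\ {subset l <= E}.
Proof.
pose A := [set p.1 | p in E].
have H a : a \in A -> exists p, p \in E /\ p.1 = a.
  by move=> /imsetP [p pE ->]; exists p.
have [h hP] : exists h : 'I_N -> 'I_N * 'I_N, forall a, a \in A -> h a \in E /\ (h a).1 = a.
  have [|h hP] := @choice _ _ (fun a p => a \in A -> p \in E /\ p.1 = a); last by exists h.
  move=> a; have [/H [p Hp]|na] := boolP (a \in A); first by exists p.
  by exists (a, a).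
exists [seq h a | a <- enum A].
  rewrite -map_comp map_id_in ?enum_uniq // => a; rewrite mem_enum => /hP [_ E'] /=; exact: E'.
split; first by rewrite size_map cardE.
by move=> p /mapP [a]; rewrite mem_enum => /hP [hE _] ->.
Qed.

Lemma coef_bound_gt d k : (d < coef_bound d k)%N.
Proof. by case: k => //= k; apply: leq_addr. Qed.

(* Every [w] in [W] gives a system of curves [P w i x = Q w i y] carrying the points [E w].
   Most pairs (w, cell) share their pattern [tau] with a [1/(kap n)] fraction of [W], and
   [affine_relation] applies to the family of all those parameters at once. *)
Lemma common_affine_relations d k : exists kap k' n0,
  forall n N D (B : 'I_N -> R) (TW : finType) (W : {set TW}) (I : Type)
    (P Q : TW -> I -> {poly R}) (E : TW -> {set 'I_N * 'I_N}),
  (n0 <= n)%N -> (N <= n)%N -> (forall i j : 'I_N, (i < j)%N -> B i < B j) -> (0 < D <= d)%N ->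
  (forall w i, w \in W -> (size (P w i) <= D.+1)%N /\ (size (Q w i) <= D.+1)%N) ->
  (forall w, w \in W -> exists i, (1 < size (P w i))%N /\ (1 < size (Q w i))%N) ->
  (forall w p i, w \in W -> p \in E w -> (P w i).[B p.1] = (Q w i).[B p.2]) ->
  (#|W| * n <= k * \sum_(w in W) #|E w|)%N ->
  (forall (W' : {set TW}) (tau : {set 'I_N * 'I_N}), W' \subset W -> W' != set0 ->
    (#|W| <= kap * n * #|W'|)%N -> (d < #|[set p.1 | p in tau]|)%N ->
    (forall w, w \in W' -> tau \subset E w) ->
    (exists w i, w \in W' /\ size (Q w i) = D.+1) /\
    (forall p : {poly R}, (2 < size p)%N ->
      exists w i, w \in W' /\ forall r, Q w i <> r \Po p)) ->
  exists (Wg : {set TW}) (T : TW -> R * R) (Ts : seq (R * R)),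
    [/\ uniq Ts, (size Ts <= k' * n)%N, Wg \subset W, (#|W| <= k' * #|Wg|)%N &
     forall w, w \in Wg ->
       [/\ T w \in Ts, (T w).1 != 0 & forall i, P w i = Q w i \Po affine (T w)]].
Proof.
set M := coef_bound d d.
(* A good cell holds more than [d * M] points, hence more than [M] first coordinates, since at most
   [d] points lie over each. The factor [2 * k] is the richness of a popular curve. *)
have [K EK] : exists K, K = (8 * ((2 * k) * (d * M) * (d.+1 * d.+1))).+1 by eexists.
have [L EL] : exists L, L = (2 ^ (K * K))%N by eexists.
have [k1 Ek1] : exists k1, k1 = (2 * k * d * (2 * (2 * k) * (K * K)))%N by eexists.
have [kr Ekr] : exists kr, kr = (4 * k1 * (d * d))%N by eexists.
have [C [n1 rich]] := rich_lines R kr.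
(* The first constant comes from |W| n <= k1 |Z| and |Z| <= 2 (2n)^2 L |W'|. *)
exists (8 * k1 * L)%N, (maxn C (4 * k1 * d)), (maxn K n1).
move=> n N D B TW W I P Q E; rewrite geq_max => /andP[Kn n1n] Nn B_incr /andP[D0 Dd].
move=> sPQ ncPQ vPQ cW HW.
have K0 : (0 < K)%N by rewrite EK.
have n0 : (0 < n)%N := leq_trans K0 Kn.
have B_inj := incr_inj B_incr.
have [r Er] : exists r, r = (n %/ K)%N by eexists.
have NK : (N <= r.+1 * K)%N by rewrite Er leq_block_count.
have rn : (r * K <= n)%N by rewrite Er leq_trunc_div.
have sQ w i : w \in W -> (size (Q w i) <= d.+1)%N.
  by move=> wW; apply: leq_trans (sPQ w i wW).2 _.
have sP w i : w \in W -> (size (P w i) <= d.+1)%N.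
  by move=> wW; apply: leq_trans (sPQ w i wW).1 _.
have fib w (S : {set 'I_N * 'I_N}) : w \in W -> S \subset E w ->
    (#|S| <= d * #|[set p.1 | p in S]|)%N.
  move=> wW SE; have [i [_ lQ]] := ncPQ w wW.
  apply: (@fiber_card d (P w i) (Q w i) N B) => //; first by rewrite lQ sQ.
  by move=> p pS; apply: vPQ => //; apply: (subsetP SE).
have bE w : w \in W -> (#|E w| <= d * n)%N.
  move=> wW; apply: leq_trans (fib w _ wW (subxx _)) _; rewrite leq_mul2l.
  by apply/orP; right; apply: leq_trans (max_card _) _; rewrite card_ord.
pose W1 := [set w in W | (n <= 2 * k * #|E w|)%N].
have W1W : W1 \subset W by apply/subsetP => w; rewrite inE => /andP[].
have cW1 : (#|W| <= 2 * k * d * #|W1|)%N := popular_card n0 cW bE.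
pose G w : {set 'I_r.+1 * 'I_r.+1} := @good_cells N K r (d * M) (E w).
have nG w : w \in W1 -> (n <= 2 * (2 * k) * (K * K) * #|G w|)%N.
  rewrite inE => /andP[wW rw]; have [i [lP lQ]] := ncPQ w wW.
  apply: (many_good_cells B_incr K0 NK (P := P w i) (Q := Q w i) (d := d)) => //.
  - by rewrite lP sP.
  - by rewrite lQ sQ.
  - by move=> p pE; apply: vPQ.
pose Z := [set z : TW * ('I_r.+1 * 'I_r.+1) | (z.1 \in W1) && (z.2 \in G z.1)].
have cZ : (#|W| * n <= k1 * #|Z|)%N.
  rewrite card_pairs.
  apply: leq_trans (leq_mul cW1 (leqnn n)) _; rewrite Ek1 -[X in (X <= _)%N]mulnA -[X in (_ <= X)%N]mulnA.
  rewrite leq_mul2l; apply/orP; right; rewrite big_distrr /= -sum_nat_const.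
  exact: leq_sum.
pose key (z : TW * ('I_r.+1 * 'I_r.+1)) := (z.2, E z.1 :&: @cell_set N K r z.2).
have ckey : (#|key @: Z| <= r.+1 * r.+1 * L)%N.
  rewrite EL; apply: (card_cell_patterns K0 NK).
  by move=> a /imsetP [z _ ->] /=; apply: subsetIr.
pose Zl := [set z in Z | (#|Z| <= 2 * (r.+1 * r.+1 * L) * #|[set y in Z | key y == key z]|)%N].
have cZl : (#|Z| <= 2 * #|Zl|)%N := popular_class ckey.
have ZlP w g : (w, g) \in Zl -> [/\ w \in W & g \in G w].
  by rewrite !inE /= => /andP[/andP[/andP[-> _] ->]].
have r2 : (r.+1 <= 2 * n)%N.
  have rle : (r <= n)%N by apply: leq_trans rn; apply: leq_pmulr.
  by rewrite mul2n -addnn -addn1; apply: leq_add.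
have Zl_affine w g : (w, g) \in Zl -> exists2 s : R * R,
    s.1 != 0 /\ (forall i, P w i = Q w i \Po affine s) &
    exists2 p, p \in line_pairs B s & @cell N K r p = g.
  move=> zl; have [wW gG] := ZlP _ _ zl.
  pose W' := [set w' in W1 | key (w', g) == key (w, g)]; pose tau := E w :&: @cell_set N K r g.
  have Mtau : (M < #|[set p.1 | p in tau]|)%N.
    have := fib w tau wW (subsetIl _ _); have : (d * M < #|tau|)%N by move: gG; rewrite inE.
    by move=> /leq_trans H /H; rewrite ltn_mul2l => /andP[_].
  have [|||||[w1 [i1 [w1W' s1]]] indec] := HW W' tau.
  - by apply/subsetP => w'; rewrite inE => /andP[/(subsetP W1W)].
  - apply/set0Pn; exists w; rewrite inE eqxx andbT.
    by move: zl; rewrite !inE /= => /andP[/andP[]].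
  - have cl : (#|Z| <= 2 * (r.+1 * r.+1 * L) * #|W'|)%N.
      move: zl; rewrite inE => /andP[_ /leq_trans]; apply; rewrite leq_mul2l; apply/orP; right.
      pose fstZ (z : TW * ('I_r.+1 * 'I_r.+1)) := z.1.
      rewrite -(card_in_imset (f := fstZ)).
        apply: subset_leq_card; apply/subsetP => _ /imsetP [[w' g'] + ->].
        rewrite !inE /= => /andP[/andP[-> _]] /eqP [Eg Ek] /=; by rewrite -Eg; apply/eqP; rewrite /key /= Eg -Ek Eg.
      move=> [w' g'] [w'' g'']; rewrite !inE /= => /andP[_ /eqP [-> _]] /andP[_ /eqP [-> _]].
      by rewrite /fstZ /= => ->.
    rewrite -(leq_pmul2r n0); apply: leq_trans cZ _.
    apply: leq_trans (leq_mul (leqnn k1) cl) _.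
    have := leq_mul (leq_mul r2 r2) (leqnn L); rewrite -(leq_pmul2l (_ : 0 < 2)%N) //.
    move=> /leq_mul/(_ (leqnn #|W'|))/(leq_mul (leqnn k1)) H; apply: leq_trans H _.
    by rewrite leq_eqVlt; apply/orP; left; apply/eqP; clear; lia.
  - exact: ltn_trans (coef_bound_gt d d) Mtau.
  - move=> w'; rewrite inE => /andP[_ /eqP [Et]]; rewrite /tau -Et; exact: subsetIl.
  have W'W w' : w' \in W' -> w' \in W by rewrite inE => /andP[/(subsetP W1W)].
  have wW' : w \in W' by rewrite inE eqxx andbT; move: zl; rewrite !inE /= => /andP[/andP[]].
  have tauE w' : w' \in W' -> tau \subset E w'.
    by rewrite inE => /andP[_ /eqP [Et]]; rewrite /tau -Et; exact: subsetIl.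
  have [l ul [sl lt]] := transversal_firsts tau.
  have [i2 [lP2 _]] := ncPQ w wW.
  pose P' (x : {w' : TW | w' \in W'} * I) := P (sval x.1) x.2.
  pose Q' (x : {w' : TW | w' \in W'} * I) := Q (sval x.1) x.2.
  have [|||||||||al [be [al0 PQ [p' pl' Ep]]]] := @affine_relation R _ P' Q' d D
    [seq (B p.1, B p.2) | p <- l] (exist _ w1 w1W', i1) (exist _ w wW', i2).
  - by rewrite D0.
  - by move=> [[w' w'W'] i]; apply: (sPQ w' i (W'W _ w'W')).1.
  - by move=> [[w' w'W'] i]; apply: (sPQ w' i (W'W _ w'W')).2.
  - exact: s1.
  - exact: lP2.
  - by move=> p sp; have [w' [i [w'W' Hi]]] := indec p sp; exists (exist _ w' w'W', i).
  - rewrite -map_comp (eq_map (g := B \o (fun p => p.1))) // map_comp map_inj_uniq //.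
  - by rewrite size_map sl ltnW.
  - move=> [[w' w'W'] i] _ /mapP [p pl ->] /=; apply: vPQ; first exact: W'W.
    by apply: (subsetP (tauE _ w'W')); apply: lt.
  exists (al, be).
    by split=> // i; have := PQ (exist _ w wW', i).
  move: pl' Ep => /mapP [p pl ->] /= Ep; exists p; first by rewrite inE Ep.
  by have := lt _ pl; rewrite !inE => /andP[_ /eqP].
pose X2 w := #|[set g | (w, g) \in Zl]|.
have cW2 : (#|W| * n <= 2 * k1 * \sum_(w in W) X2 w)%N.
  have -> : (\sum_(w in W) X2 w)%N = #|Zl|.
    rewrite -[RHS]sum1_card (eq_bigl (fun z => (z.1 \in W) && ((z.1, z.2) \in Zl))); last first.
      by move=> [w g]; case: (boolP (_ \in Zl)) => [/ZlP [-> _]|_]; rewrite ?andbF.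
    rewrite -(pair_big_dep (fun w => w \in W) (fun w g => (w, g) \in Zl) (fun _ _ => 1%N)) /=.
    by apply: eq_bigr => w _; rewrite /X2 -sum1_card; apply: eq_bigl => g; rewrite inE.
  apply: leq_trans cZ _; rewrite [(2 * k1)%N]mulnC -mulnA leq_mul2l cZl orbT //.
have bX2 w : w \in W -> (X2 w <= d * n)%N.
  move=> wW; apply: leq_trans (bE w wW); apply: leq_trans (leq_imset_card (@cell N K r) _).
  apply: subset_leq_card; apply/subsetP => g; rewrite inE => /ZlP [_].
  rewrite inE => /(leq_ltn_trans (leq0n _)); rewrite card_gt0 => /set0Pn [p].
  by rewrite !inE => /andP[pE /eqP <-]; apply: imset_f.
pose W2 := [set w in W | (n <= 2 * (2 * k1) * X2 w)%N].
have W2W : W2 \subset W by apply/subsetP => w; rewrite inE => /andP[].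
have cW2' : (#|W| <= 2 * (2 * k1) * d * #|W2|)%N := popular_card n0 cW2 bX2.
(* The good cells of [w] yield at most [d * d] different lines, so one line passes through a
   positive proportion of them and is rich. That is what allows [rich_lines] to bound the number of
   values of [T]. *)
have W2P w : w \in W2 -> exists s : R * R,
    [/\ s.1 != 0, forall i, P w i = Q w i \Po affine s & (n <= kr * #|line_pairs B s|)%N].
  rewrite inE => /andP[wW rw]; have [i [_ lQ]] := ncPQ w wW.
  have [l sl lP] := affine_options (d := d) (P w i) (Q := Q w i) (introT andP (conj lQ (sQ w i wW))).
  pose rel (g : 'I_r.+1 * 'I_r.+1) (s : R * R) := `[< (s.1 != 0 /\ forall i, P w i = Q w i \Po affine s) /\
    exists2 p, p \in line_pairs B s & @cell N K r p = g >].
  pose A : {set 'I_r.+1 * 'I_r.+1} := [set g | (w, g) \in Zl].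
  have A0 : A != set0.
    by rewrite -card_gt0; move: (leq_trans n0 rw); rewrite muln_gt0 => /andP[].
  have [|s sInl Hs] := @pigeonhole_seq _ _ A l rel A0.
    move=> g; rewrite inE => /Zl_affine [s Hs Hp]; exists s; last by apply/asboolP.
    by apply: lP; apply: Hs.2.
  have [g0 g0A] : exists g, g \in [set g in A | rel g s].
    apply/set0Pn; rewrite -card_gt0; move: A0; rewrite -card_gt0 => /leq_trans/(_ Hs).
    by rewrite muln_gt0 => /andP[].
  move: g0A; rewrite !inE => /andP[_ /asboolP [[s0 Hi] _]]; exists s; split=> //.
  apply: (leq_trans rw); rewrite Ekr mulnA -[X in (_ <= X)%N]mulnA; apply: leq_mul => //.
  apply: (leq_trans Hs); apply: leq_mul => //.
  apply: leq_trans (leq_imset_card (@cell N K r) _); apply: subset_leq_card.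
  apply/subsetP => g; rewrite !inE => /andP[_ /asboolP [_ [p pl <-]]]; exact: imset_f.
have [T HT] : exists T : TW -> R * R, forall w, w \in W2 ->
    [/\ (T w).1 != 0, forall i, P w i = Q w i \Po affine (T w) & (n <= kr * #|line_pairs B (T w)|)%N].
  have [|T HT] := @choice _ _ (fun w s => w \in W2 ->
    [/\ s.1 != 0, forall i, P w i = Q w i \Po affine s & (n <= kr * #|line_pairs B s|)%N]); last by exists T.
  by move=> w; have [/W2P [s Hs]|_] := boolP (w \in W2); [exists s | exists 0].
exists W2, T, (undup [seq T w | w <- enum W2]); split=> //.
- exact: undup_uniq.
- apply: leq_trans (_ : C * n <= _)%N; last by rewrite leq_mul2r leq_maxl orbT.
  apply: (rich n N B) => //; first exact: undup_uniq.
  by move=> s; rewrite mem_undup => /mapP [w]; rewrite mem_enum => /HT [? _ ?] ->.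
- apply: (leq_trans cW2'); rewrite leq_mul2r; apply/orP; right.
  by apply: leq_trans (leq_maxr _ _); rewrite mulnA.
move=> w wW2; have [? ? _] := HT w wW2; split=> //.
by rewrite mem_undup; apply: map_f; rewrite mem_enum.
Qed.

End Stage.

(** * Trivariate polynomials and their affine symmetries *)

Section Slices.
Variable R : rcfType.
Implicit Types (c : nat -> nat -> nat -> R) (V : {poly R} -> Prop).

(** A trivariate polynomial is kept as an array of coefficients with one degree bound per variable,
    so that permuting the variables only permutes arguments. *)
Definition slice d0 d1 d2 c (u v : R) : {poly R} :=
  \sum_(j < d1.+1) \sum_(k < d2.+1) (u ^+ j * v ^+ k) *: \poly_(i < d0.+1) c i j k.

Definition swap12 c := fun j i k => c i j k.
Definition rot3 c := fun k i j => c i j k.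

Lemma slice_horner d0 d1 d2 c x y z : (slice d0 d1 d2 c y z).[x] =
  \sum_(i < d0.+1) \sum_(j < d1.+1) \sum_(k < d2.+1) c i j k * x ^+ i * y ^+ j * z ^+ k.
Proof.
rewrite /slice horner_sum exchange_big /=; apply: eq_bigr => j _.
rewrite horner_sum exchange_big /=; apply: eq_bigr => k _.
rewrite hornerZ horner_poly big_distrr /=; apply: eq_bigr => i _; ring.
Qed.

Lemma slice_swap12 d0 d1 d2 c x y z :
  (slice d1 d0 d2 (swap12 c) x z).[y] = (slice d0 d1 d2 c y z).[x].
Proof.
rewrite !slice_horner exchange_big /=; apply: eq_bigr => i _; apply: eq_bigr => j _.
by apply: eq_bigr => k _; rewrite /swap12; ring.
Qed.

Lemma slice_rot3 d0 d1 d2 c x y z :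
  (slice d2 d0 d1 (rot3 c) x y).[z] = (slice d0 d1 d2 c y z).[x].
Proof.
rewrite !slice_horner exchange_big /=; apply: eq_bigr => i _; rewrite exchange_big /=.
by apply: eq_bigr => j _; apply: eq_bigr => k _; rewrite /rot3; ring.
Qed.

Lemma size_slice d0 d1 d2 c u v : (size (slice d0 d1 d2 c u v) <= d0.+1)%N.
Proof.
apply/leq_sizeP => i di; rewrite /slice coef_sum big1 // => j _; rewrite coef_sum big1 // => k _.
by rewrite coefZ coef_poly ltnNge di mulr0.
Qed.

Definition subspace V := V 0 /\ forall a p q, V p -> V q -> V (a *: p + q).

Lemma subspace_sum V (I : finType) (a : I -> R) (p : I -> {poly R}) : subspace V ->
  (forall i, V (p i)) -> V (\sum_i a i *: p i).
Proof. by move=> [V0 VL] Vp; apply: (big_rec V) => // i q _; apply: VL. Qed.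

(** The inverse Vandermonde matrix expresses each [v j] as a linear combination of the values at
    [d + 1] distinct points. *)
Lemma vandermonde_subspace V d (v : 'I_d.+1 -> {poly R}) (s : seq R) : subspace V -> uniq s ->
  (d < size s)%N -> (forall u, u \in s -> V (\sum_(j < d.+1) u ^+ j *: v j)) -> forall j, V (v j).
Proof.
move=> VS us ds Vs j.
pose a : 'rV[R]_d.+1 := \row_i s`_i.
have W1 : Vandermonde d.+1 a \in unitmx.
  rewrite unitmxE unitfE det_Vandermonde; apply/prodf_neq0 => i _; apply/prodf_neq0 => l il.
  rewrite !mxE subr_eq0 nth_uniq ?gtn_eqF //; exact: leq_trans (ltn_ord _) ds.
have -> : v j = \sum_(i < d.+1) invmx (Vandermonde d.+1 a) i j *: \sum_(l < d.+1) s`_i ^+ l *: v l.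
  under eq_bigr do rewrite scaler_sumr.
  rewrite exchange_big /= (bigD1 j) //= [X in _ + X]big1 ?addr0.
    rewrite -[LHS]scale1r; under eq_bigr do rewrite scalerA.
    rewrite -scaler_suml; congr (_ *: _).
    have := congr1 (fun A : 'M_d.+1 => A j j) (mulmxV W1); rewrite !mxE eqxx => E.
    rewrite -[LHS]/(true%:R : R) -E; by apply: eq_bigr => i _; rewrite !mxE mulrC.
  move=> l lj; under eq_bigr do rewrite scalerA.
  rewrite -scaler_suml; have := congr1 (fun A : 'M_d.+1 => A l j) (mulmxV W1).
  rewrite !mxE (negPf lj) => E; rewrite [X in X *: _](_ : _ = 0) ?scale0r //.
  rewrite -[RHS]/(false%:R : R) -E.
  by apply: eq_bigr => i _; rewrite !mxE mulrC.
apply: subspace_sum => // i; apply: Vs; apply: mem_nth; exact: leq_trans (ltn_ord _) ds.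
Qed.

Lemma slice_subspace1 V d0 d1 d2 c v (s : seq R) : subspace V -> uniq s -> (d1 < size s)%N ->
  (forall u, u \in s -> V (slice d0 d1 d2 c u v)) -> forall u, V (slice d0 d1 d2 c u v).
Proof.
move=> VS us ds Vs u.
have sliceE t : slice d0 d1 d2 c t v =
    \sum_(j < d1.+1) t ^+ j *: \sum_(k < d2.+1) v ^+ k *: \poly_(i < d0.+1) c i j k.
  by apply: eq_bigr => j _; rewrite scaler_sumr; apply: eq_bigr => k _; rewrite scalerA.
rewrite sliceE; apply: subspace_sum => //; apply: (vandermonde_subspace VS us ds).
by move=> t /Vs; rewrite sliceE.
Qed.

Lemma slice_subspace2 V d0 d1 d2 c u (s : seq R) : subspace V -> uniq s -> (d2 < size s)%N ->
  (forall v, v \in s -> V (slice d0 d1 d2 c u v)) -> forall v, V (slice d0 d1 d2 c u v).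
Proof.
move=> VS us ds Vs v.
have sliceE t : slice d0 d1 d2 c u t =
    \sum_(k < d2.+1) t ^+ k *: \sum_(j < d1.+1) u ^+ j *: \poly_(i < d0.+1) c i j k.
  rewrite /slice exchange_big; apply: eq_bigr => k _; rewrite scaler_sumr; apply: eq_bigr => j _.
  by rewrite scalerA mulrC.
rewrite sliceE; apply: subspace_sum => //; apply: (vandermonde_subspace VS us ds).
by move=> t /Vs; rewrite sliceE.
Qed.

Lemma subspace_size m : subspace (fun p => (size p <= m)%N).
Proof.
split=> [|a p q sp sq]; first by rewrite size_poly0.
apply: leq_trans (size_polyD _ _) _; rewrite geq_max sq andbT.
exact: leq_trans (size_scale_leq _ _) sp.
Qed.

Lemma subspace_comp (p : {poly R}) : subspace (fun q => exists r, q = r \Po p).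
Proof.
split=> [|a _ _ [r ->] [s ->]]; first by exists 0; rewrite comp_poly0.
by exists (a *: r + s); rewrite comp_polyD comp_polyZ.
Qed.

Lemma card_grid_le n N N' d1 d2 (S : {set 'I_N * 'I_N'}) (L : {set 'I_N'}) :
  (N <= n)%N -> (N' <= n)%N -> (#|L| <= d2)%N ->
  (forall l, l \notin L -> (#|[set j | (j, l) \in S]| <= d1)%N) -> (#|S| <= (d1 + d2) * n)%N.
Proof.
move=> Nn N'n cL row; have -> : #|S| = (\sum_l #|[set j | (j, l) \in S]|)%N.
  rewrite -sum1_card (eq_bigl (fun p => true && ((p.1, p.2) \in S))) => [|[j l]] //.
  rewrite -(pair_big_dep predT (fun j l => (j, l) \in S) (fun _ _ => 1%N)) /=.
  under eq_bigr do rewrite big_mkcond.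
  rewrite exchange_big /=; apply: eq_bigr => l _; rewrite -big_mkcond -sum1_card.
  by apply: eq_bigl => j; rewrite inE.
rewrite (bigID (mem L)) /= addnC mulnDl; apply: leq_add.
  apply: leq_trans (_ : \sum_(l in ~: L) d1 <= _)%N.
    rewrite [X in (X <= _)%N](eq_bigl (fun l => l \in ~: L)) => [|l]; last by rewrite inE.
    by apply: leq_sum => l; rewrite inE => /row.
  rewrite sum_nat_const mulnC leq_mul2l; apply/orP; right.
  by apply: leq_trans (max_card _) _; rewrite card_ord.
apply: leq_trans (_ : \sum_(l in L) n <= _)%N; last by rewrite sum_nat_const leq_mul2r cL orbT.
by apply: leq_sum => l _; apply: leq_trans (max_card _) _; rewrite card_ord.
Qed.

Lemma card_values N (B : 'I_N -> R) (S : {set 'I_N}) : injective B ->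
  exists2 s : seq R, uniq s & size s = #|S| /\ forall u, u \in s -> exists2 j, j \in S & u = B j.
Proof.
move=> B_inj; exists [seq B j | j <- enum S]; first by rewrite map_inj_uniq ?enum_uniq.
split; first by rewrite size_map cardE.
by move=> u /mapP [j]; rewrite mem_enum => jS ->; exists j.
Qed.

(** With so many points, more than [d2] rows contain more than [d1] points each; the condition
    spreads first along these rows and then to all rows. *)
Lemma slice_subspace V d0 d1 d2 c n N N' (B : 'I_N -> R) (C : 'I_N' -> R)
    (S : {set 'I_N * 'I_N'}) : subspace V -> injective B -> injective C ->
  (N <= n)%N -> (N' <= n)%N -> ((d1 + d2) * n < #|S|)%N ->
  (forall p, p \in S -> V (slice d0 d1 d2 c (B p.1) (C p.2))) ->
  forall u v, V (slice d0 d1 d2 c u v).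
Proof.
move=> VS B_inj C_inj Nn N'n cS VSp u.
pose L := [set l | (d1 < #|[set j | (j, l) \in S]|)%N].
have cL : (d2 < #|L|)%N.
  rewrite ltnNge; apply/negP => cL; move: cS; rewrite ltnNge => /negP; apply.
  by apply: (card_grid_le Nn N'n cL) => l; rewrite inE -leqNgt.
have [s us [sL sE]] := card_values L C_inj.
apply: (slice_subspace2 VS us); rewrite ?sL // => v /sE [l + ->]; rewrite inE => row.
have [t ut [st tE]] := card_values [set j | (j, l) \in S] B_inj.
apply: (slice_subspace1 VS ut); rewrite ?st // => w /tE [j + ->]; rewrite inE => jl.
exact: (VSp (j, l)).
Qed.

Lemma card_value_le N (B : 'I_N -> R) d (p : {poly R}) a : injective B -> (1 < size p <= d.+1)%N ->
  (#|[set j | p.[B j] == a]| <= d)%N.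
Proof.
move=> B_inj /andP[sp lp]; have [s us [ss sE]] := card_values [set j | p.[B j] == a] B_inj.
rewrite -ss -ltnS; apply: leq_trans lp.
have sc : size (p - a%:P) = size p.
  by rewrite size_polyDl // size_polyN; exact: leq_ltn_trans (size_polyC_leq1 _) _.
rewrite -sc; apply: max_poly_roots => //.
  by rewrite -size_poly_gt0 sc ltnW.
by apply/allP => x /sE [j]; rewrite inE => /eqP <- ->; rewrite /root !hornerE subrr.
Qed.

End Slices.

(** * The Cauchy-Schwarz inequality for fibres *)

Section Cauchy.
Local Open Scope nat_scope.

Lemma sum_square_le (I : Type) (s : seq I) (F : I -> nat) :
  (\sum_(i <- s) F i) ^ 2 <= size s * \sum_(i <- s) F i ^ 2.
Proof.
rewrite -(leq_pmul2l (_ : 0 < 2)) // -mulnn big_distrlr /= big_distrr /=.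
under eq_bigr do rewrite big_distrr /=.
apply: (@leq_trans (\sum_(i <- s) \sum_(j <- s) (F i ^ 2 + F j ^ 2))).
  by apply: leq_sum => i _; apply: leq_sum => j _; apply: nat_Cauchy.
under eq_bigr do rewrite big_split /=.
rewrite big_split /= big_const_seq count_predT iter_addn_0.
under eq_bigr do rewrite big_const_seq count_predT iter_addn_0.
by rewrite -big_distrl /= [X in X + _]mulnC [X in _ + X]mulnC mul2n addnn.
Qed.

(** The pairs inside fibres number the sum of the squared fibre sizes, and there are at most
    [size D] fibres. *)
Lemma card_fiber_pairs (T : finType) (X : eqType) (G : {set T}) (h : T -> X) (D : seq X) :
  (forall g, g \in G -> h g \in D) ->
  #|G| ^ 2 <= size D * #|[set p : T * T | [&& p.1 \in G, p.2 \in G & h p.1 == h p.2]]|.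
Proof.
move=> GD; pose s := undup D; pose F e := #|[set g in G | h g == e]|.
have sumF (Y : T -> nat) : \sum_(g in G) Y g = \sum_(e <- s) \sum_(g in G | h g == e) Y g.
  rewrite (exchange_big_dep (fun g => g \in G)) => [|e g _ /andP[]] //=.
  apply: eq_bigr => g gG; rewrite (eq_bigl (pred1 (h g))) => [|e]; last by rewrite gG /= eq_sym.
  by rewrite -big_filter filter_pred1_uniq ?undup_uniq ?mem_undup ?GD // big_seq1.
have -> : #|G| = \sum_(e <- s) F e.
  rewrite -sum1_card sumF; apply: eq_bigr => e _; rewrite sum1_card /F.
  by apply: eq_card => g; rewrite !inE.
apply: leq_trans (sum_square_le _ _) _; apply: leq_mul; first exact: size_undup.
rewrite leq_eqVlt; apply/orP; left; apply/eqP.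
rewrite -sum1_card (eq_bigl (fun p => (p.1 \in G) && ((p.2 \in G) && (h p.2 == h p.1)))); last first.
  by move=> p; rewrite inE [h p.2 == _]eq_sym.
rewrite -(pair_big_dep (fun g => g \in G) (fun g g' => (g' \in G) && (h g' == h g)) (fun _ _ => 1)) /=.
rewrite sumF; apply: eq_bigr => e _; rewrite -mulnn {1}/F -sum1_card big_distrl /=.
apply: eq_big => [g|g]; first by rewrite inE.
rewrite inE => /andP[_ /eqP he]; rewrite mul1n sum1_card /F; apply: eq_card => g'.
by rewrite !inE he.
Qed.

Lemma card_le_fibers (T U : finType) (W : {set T}) (f : T -> U) m :
  (forall u, u \in f @: W -> #|[set w in W | f w == u]| <= m) -> #|W| <= #|f @: W| * m.
Proof.
move=> H; rewrite -sum1_card (partition_big_imset f) /= -sum_nat_const.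
apply: leq_sum => u uW; rewrite sum1_card; apply: leq_trans (H u uW).
by apply: subset_leq_card; apply/subsetP => w; rewrite unfold_in inE.
Qed.

End Cauchy.

(** * Nondegenerate polynomials on a grid *)

Section Trivariate.
Variable R : rcfType.
Implicit Types (c : nat -> nat -> nat -> R).

(** An inequality [N <= n], because images of the given sets under inner polynomials can be smaller
    than the sets. *)
Definition grid n N (B : 'I_N -> R) :=
  (N <= n)%N /\ forall i j : 'I_N, (i < j)%N -> B i < B j.

Lemma grid_inj n N (B : 'I_N -> R) : grid n B -> injective B.
Proof. by case=> _; apply: incr_inj. Qed.

(** No inner polynomial of degree at least 2 is common to all slices; a single slice may well
    decompose. *)
Definition indecomposable d0 d1 d2 c := forall p : {poly R}, (2 < size p)%N ->
  exists u v, forall r, slice d0 d1 d2 c u v <> r \Po p.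

Definition exact_degree d0 d1 d2 c := exists u v, size (slice d0 d1 d2 c u v) = d0.+1.

(** The polynomial involves its first two variables, while [d2 = 0] is allowed, so that polynomials
    in two variables are covered too. *)
Record nondegenerate_poly d d0 d1 d2 c : Prop := {
  nd_deg0 : (0 < d0 <= d)%N; nd_deg1 : (0 < d1 <= d)%N; nd_deg2 : (d2 <= d)%N;
  nd_exact0 : exact_degree d0 d1 d2 c;
  nd_exact1 : exact_degree d1 d0 d2 (swap12 c);
  nd_exact2 : exact_degree d2 d0 d1 (rot3 c);
  nd_indec0 : indecomposable d0 d1 d2 c;
  nd_indec1 : indecomposable d1 d0 d2 (swap12 c);
  nd_indec2 : (0 < d2)%N -> indecomposable d2 d0 d1 (rot3 c) }.

Lemma exact_not_small d0 d1 d2 c m : exact_degree d0 d1 d2 c -> (m <= d0)%N ->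
  ~ forall u v, (size (slice d0 d1 d2 c u v) <= m)%N.
Proof. by move=> [u [v E]] md H; have := H u v; rewrite E leqNgt ltnS md. Qed.

(** Recorded in the first stage so that the curves of the second stage, in the second variable, are
    nonconstant. *)
Definition varies d0 d1 d2 c (z : R) := `[< exists x, (1 < size (slice d1 d0 d2 (swap12 c) x z))%N >].

Lemma card_not_varies d d0 d1 d2 c N (C : 'I_N -> R) : nondegenerate_poly d d0 d1 d2 c ->
  injective C -> (#|[set l | ~~ varies d0 d1 d2 c (C l)]| <= d2)%N.
Proof.
move=> nd C_inj; rewrite leqNgt; apply/negP => lt.
have [s us [ss sE]] := card_values [set l | ~~ varies d0 d1 d2 c (C l)] C_inj.
have [d10 _] := andP (nd_deg1 nd).
apply: (exact_not_small (nd_exact1 nd) d10) => x.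
apply: (slice_subspace2 (subspace_size R 1) us); rewrite ?ss // => v /sE [l + ->].
rewrite inE => /asboolPn nv; rewrite leqNgt; apply/negP => H; by apply: nv; exists x.
Qed.

Lemma card_grid_value d d0 d1 d2 c n N N' (B : 'I_N -> R) (C : 'I_N' -> R) x t :
  (d1 <= d)%N -> (d2 <= d)%N -> grid n B -> grid n C ->
  (exists z, (1 < size (slice d1 d0 d2 (swap12 c) x z))%N) ->
  (#|[set q : 'I_N * 'I_N' | (slice d0 d1 d2 c (B q.1) (C q.2)).[x] == t%R]| <= (d + d) * n)%N.
Proof.
move=> l1 l2 gB gC [z0 sz0].
apply: leq_trans (_ : (d1 + d2) * n <= _)%N; last by rewrite leq_mul2r leq_add ?orbT.
pose L := [set l | (size (slice d1 d0 d2 (swap12 c) x (C l)) <= 1)%N].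
apply: (card_grid_le (L := L)); [exact: gB.1 | exact: gC.1 | |].
  rewrite leqNgt; apply/negP => lt; have [s us [ss sE]] := card_values L (grid_inj gC).
  have := @slice_subspace2 R _ d1 d0 d2 (swap12 c) x s (subspace_size R 1) us.
  rewrite ss => /(_ lt) H; move: sz0; rewrite ltnNge => /negP; apply; apply: H.
  by move=> v /sE [l + ->]; rewrite inE.
move=> l; rewrite inE -ltnNge => sl.
apply: leq_trans (card_value_le (d := d1) (p := slice d1 d0 d2 (swap12 c) x (C l)) t (grid_inj gB) _).
  by apply: subset_leq_card; apply/subsetP => j; rewrite !inE slice_swap12.
by rewrite sl size_slice.
Qed.

End Trivariate.

(** * Affine relations in the first variable *)

Section FirstRelation.
Variable R : rcfType.
Implicit Types (c : nat -> nat -> nat -> R).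

Lemma card_degenerate d d0 d1 d2 c n N N' (B : 'I_N -> R) (C : 'I_N' -> R) :
  nondegenerate_poly d d0 d1 d2 c -> grid n B -> grid n C ->
  (#|[set q : 'I_N * 'I_N' | ~~ ((1 < size (slice d0 d1 d2 c (B q.1) (C q.2)))%N &&
        varies d0 d1 d2 c (C q.2))]| <= 3 * d * n)%N.
Proof.
move=> nd gB gC.
pose S1 := [set q : 'I_N * 'I_N' | (size (slice d0 d1 d2 c (B q.1) (C q.2)) <= 1)%N].
pose S2 := [set q : 'I_N * 'I_N' | ~~ varies d0 d1 d2 c (C q.2)].
have [d00 _] := andP (nd_deg0 nd); have [_ d1d] := andP (nd_deg1 nd); have d2d := nd_deg2 nd.
apply: leq_trans (_ : #|S1 :|: S2| <= _)%N.
  by apply: subset_leq_card; apply/subsetP => q; rewrite !inE negb_and -leqNgt.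
apply: leq_trans (_ : #|S1| + #|S2| <= _)%N; first by rewrite cardsU leq_subr.
have -> : (3 * d * n = (d + d) * n + (0 + d) * n)%N by clear; lia.
apply: leq_add.
  apply: leq_trans (_ : (d1 + d2) * n <= _)%N; last by rewrite leq_mul2r leq_add ?orbT.
  rewrite leqNgt; apply/negP => lt; apply: (exact_not_small (nd_exact0 nd) d00).
  apply: (slice_subspace (subspace_size R 1) (grid_inj gB) (grid_inj gC) gB.1 gC.1 lt).
  by move=> q; rewrite inE.
apply: (card_grid_le (L := [set l | ~~ varies d0 d1 d2 c (C l)]) gB.1 gC.1).
  by apply: leq_trans (card_not_varies nd (grid_inj gC)) d2d.
move=> l; rewrite inE negbK => vl; rewrite leqn0 cards_eq0; apply/eqP/setP => j.
by rewrite !inE vl.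
Qed.

Lemma first_relations d k : exists k' n0, forall n c d0 d1 d2 NA NB NC
    (A : 'I_NA -> R) (B : 'I_NB -> R) (C : 'I_NC -> R) (D : seq R),
  nondegenerate_poly d d0 d1 d2 c -> (n0 <= n)%N -> grid n A -> grid n B -> grid n C ->
  (size D <= n)%N ->
  (n ^ 3 <= k * #|[set p : 'I_NA * ('I_NB * 'I_NC) |
     (slice d0 d1 d2 c (B p.2.1) (C p.2.2)).[A p.1] \in D]|)%N ->
  exists (Wg : {set ('I_NB * 'I_NC) * ('I_NB * 'I_NC)}) T (Ts : seq (R * R)),
    [/\ uniq Ts, (size Ts <= k' * n)%N, (n ^ 4 <= k' * #|Wg|)%N &
     forall w, w \in Wg -> [/\ T w \in Ts, (T w).1 != 0,
       varies d0 d1 d2 c (C w.1.2), varies d0 d1 d2 c (C w.2.2) &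
       slice d0 d1 d2 c (B w.1.1) (C w.1.2) =
         slice d0 d1 d2 c (B w.2.1) (C w.2.2) \Po affine (T w)]].
Proof.
have [k4 Ek4] : exists k4, k4 = (4 * k ^ 2)%N by eexists.
have [kap [k1 [n1 H]]] := common_affine_relations R d k4.
have [ka Eka] : exists ka, ka = (k4 * d * kap)%N by eexists.
exists (maxn k1 (k4 * d * k1)), (maxn (maxn n1 (6 * k * d).+1) (2 * d * (2 * d) * ka).+1).
move=> n c d0 d1 d2 NA NB NC A B C D nd; rewrite !geq_max => /andP[/andP[n1n n2n] n3n].
move=> gA gB gC sD cnt.
have n0 : (0 < n)%N by apply: leq_ltn_trans n2n.
pose f (p : 'I_NA * ('I_NB * 'I_NC)) := (slice d0 d1 d2 c (B p.2.1) (C p.2.2)).[A p.1].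
pose ok (q : 'I_NB * 'I_NC) := ((1 < size (slice d0 d1 d2 c (B q.1) (C q.2)))%N &&
        varies d0 d1 d2 c (C q.2)).
pose G := [set p | (f p \in D) && ok p.2].
(* The degenerate parameters account for at most 3 d n^2 points, which is at most half of n^3 / k
   for large [n]. *)
have cG : (n ^ 3 <= 2 * k * #|G|)%N.
  have sub : [set p | f p \in D] \subset G :|: setX [set: 'I_NA] [set q | ~~ ok q].
    by apply/subsetP => p; rewrite !inE /= => ->; case: (ok _).
  have := leq_trans cnt (leq_mul (leqnn k) (subset_leq_card sub)); rewrite cardsU => H1.
  have := leq_trans H1 (leq_mul (leqnn k) (leq_subr _ _)); rewrite cardsX cardsT card_ord.
  have := leq_mul gA.1 (card_degenerate nd gB gC); rewrite -/ok.
  move: (NA * _)%N #|G| => X Y HX; rewrite mulnDr => H2.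
  have := leq_trans H2 (leq_add (leqnn _) (leq_mul (leqnn k) HX)).
  have : (2 * (k * (n * (3 * d * n))) <= n ^ 3)%N.
    rewrite (_ : 2 * _ = n * n * (6 * k * d))%N; last by clear; lia.
    by rewrite -[3%N]/(2 + 1)%N expnD expn1 -mulnn leq_mul2l (ltnW n2n) orbT.
  by clear; lia.
have n5 : (n ^ 5 <= k4 * #|[set p | [&& p.1 \in G, p.2 \in G & f p.1 == f p.2]]|)%N.
  rewrite -(leq_pmul2r n0) -expnSr Ek4.
  have -> : (n ^ 6 = (n ^ 3) ^ 2)%N by rewrite -expnM.
  apply: leq_trans (_ : (2 * k * #|G|) ^ 2 <= _)%N; first by rewrite leq_exp2r.
  rewrite !expnMn -[X in (_ <= X)%N]mulnA leq_mul2l; apply/orP; right.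
  rewrite mulnC; apply: leq_trans (leq_mul sD (leqnn _)).
  by apply: card_fiber_pairs => g; rewrite inE => /andP[].
pose W := [set w : ('I_NB * 'I_NC) * ('I_NB * 'I_NC) | ok w.1 && ok w.2].
pose P (w : ('I_NB * 'I_NC) * ('I_NB * 'I_NC)) (_ : unit) := slice d0 d1 d2 c (B w.1.1) (C w.1.2).
pose Q (w : ('I_NB * 'I_NC) * ('I_NB * 'I_NC)) (_ : unit) := slice d0 d1 d2 c (B w.2.1) (C w.2.2).
pose E (w : ('I_NB * 'I_NC) * ('I_NB * 'I_NC)) :=
  [set p : 'I_NA * 'I_NA | (P w tt).[A p.1] == (Q w tt).[A p.2]].
have cE : (#|[set p | [&& p.1 \in G, p.2 \in G & f p.1 == f p.2]]| <= \sum_(w in W) #|E w|)%N.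
  pose Y := [set x | (x.1 \in W) && (x.2 \in E x.1)].
  rewrite -card_pairs -/Y.
  pose h (p : ('I_NA * ('I_NB * 'I_NC)) * ('I_NA * ('I_NB * 'I_NC))) :=
    ((p.1.2, p.2.2), (p.1.1, p.2.1)).
  rewrite -(card_imset _ (_ : injective h)); last by move=> [[a q] [a' q']] [[b r] [b' r']] [-> -> -> ->].
  apply: subset_leq_card; apply/subsetP => _ /imsetP [[p p'] + ->].
  by rewrite !inE /= => /and3P[/andP[_ ->] /andP[_ ->]] /=.
have cW : (#|W| * n <= k4 * \sum_(w in W) #|E w|)%N.
  apply: leq_trans (leq_trans n5 (leq_mul (leqnn k4) cE)).
  rewrite expnSr leq_mul2r; apply/orP; right; apply: leq_trans (max_card _) _.
  rewrite !card_prod !card_ord -[4%N]/(2 + 2)%N expnD -mulnn.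
  by rewrite !leq_mul // ?gB.1 ?gC.1.
have [/andP[d00 d0d] /andP[d10 d1d]] := (nd_deg0 nd, nd_deg1 nd).
have okP w : w \in W -> (1 < size (P w tt))%N /\ (1 < size (Q w tt))%N.
  by rewrite inE => /andP[/andP[-> _] /andP[-> _]].
have bE w : w \in W -> (#|E w| <= d * n)%N.
  move=> wW; have [_ lQ] := okP w wW.
  apply: leq_trans (_ : d * #|[set p.1 | p in E w]| <= _)%N.
    apply: (@fiber_card _ d (P w tt) (Q w tt) _ A) => //; first exact: grid_inj gA.
      by rewrite lQ /=; apply: leq_trans (size_slice _ _ _ _ _ _) _.
    by move=> p; rewrite inE => /eqP.
  by rewrite leq_mul2l; apply/orP; right; apply: leq_trans (max_card _) _; rewrite card_ord gA.1.
have n4 : (n ^ 4 <= k4 * d * #|W|)%N.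
  rewrite -(leq_pmul2r n0) -expnSr; apply: leq_trans (leq_trans n5 (leq_mul (leqnn k4) cE)) _.
  rewrite -!mulnA leq_mul2l; apply/orP; right.
  apply: leq_trans (_ : \sum_(w in W) d * n <= _)%N; first exact: leq_sum.
  by rewrite sum_nat_const mulnCA.
have [|||||Wg [T [Ts [uT sT WgW cWg HT]]]] :=
  H n NA d0 A _ W unit P Q E n1n gA.1 gA.2 (nd_deg0 nd).
- by move=> w i _; split; apply: size_slice.
- by move=> w /okP; exists tt.
- by move=> w p [] _; rewrite inE => /eqP.
- exact: cW.
(* A class of order n^3 still sees all of f. Some first coordinate in [tau] makes f nonconstant in
   y, so each second point (y', z') goes with only O(n) first points (y, z). Hence more than (d1 +
   d2) n second points occur, as [slice_subspace] requires. *)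
- move=> W' tau W'W W'0 cW' ftau tauE.
  have n3 : (n ^ 3 <= ka * #|W'|)%N.
    rewrite -(leq_pmul2r n0) -expnSr; apply: leq_trans n4 _.
    apply: leq_trans (leq_mul (leqnn _) cW') _; rewrite Eka leq_eqVlt; apply/orP; left.
    by apply/eqP; clear; lia.
  have [i [iF [z0 sz0]]] : exists i, i \in [set p.1 | p in tau] /\
      exists z, (1 < size (slice d1 d0 d2 (swap12 c) (A i) z))%N.
    apply: contrapT => Hn; have [s us [ss sE]] := card_values [set p.1 | p in tau] (grid_inj gA).
    apply: (exact_not_small (nd_exact1 nd) d10) => x z; move: x.
    apply: (slice_subspace1 (subspace_size R 1) us); first by rewrite ss (leq_ltn_trans d0d).
    move=> u /sE [j jF ->]; rewrite leqNgt; apply/negP => Hj.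
    by apply: Hn; exists j; split=> //; exists z.
  have [p ptau Ep] := imsetP iF.
  pose pr (w : ('I_NB * 'I_NC) * ('I_NB * 'I_NC)) := w.2.
  have cpr : (#|W'| <= #|pr @: W'| * ((d + d) * n))%N.
    apply: card_le_fibers => u _.
    pose fstw (w : ('I_NB * 'I_NC) * ('I_NB * 'I_NC)) := w.1.
    rewrite -(card_in_imset (f := fstw)); last first.
      move=> [q q'] [r r']; rewrite !inE /pr /fstw /= => /andP[_ /eqP ->] /andP[_ /eqP ->] -> //.
    apply: leq_trans (card_grid_value (d := d) (x := A i)
      ((slice d0 d1 d2 c (B u.1) (C u.2)).[A p.2]) d1d (nd_deg2 nd) gB gC (ex_intro _ z0 sz0)).
    apply: subset_leq_card; apply/subsetP => _ /imsetP [[q q'] + ->].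
    rewrite !inE /= => /andP[wW' /eqP <-].
    by have := subsetP (tauE _ wW') _ ptau; rewrite inE /P /Q /= Ep.
  have lpr : ((d1 + d2) * n < #|pr @: W'|)%N.
    apply: leq_ltn_trans (_ : (d + d) * n < _)%N; first by rewrite leq_mul2r leq_add ?(nd_deg2 nd) ?orbT.
    rewrite ltnNge; apply/negP => le.
    have := leq_trans n3 (leq_mul (leqnn ka) (leq_trans cpr (leq_mul le (leqnn _)))).
    rewrite leqNgt => /negP; apply.
    rewrite (_ : ka * _ = n ^ 2 * (2 * d * (2 * d) * ka))%N; last by rewrite -mulnn; clear; lia.
    by rewrite -[3%N]/(2 + 1)%N expnD expn1 ltn_mul2l expn_gt0 n0.
  have sub V : subspace V -> (forall w, w \in W' -> V (Q w tt)) -> forall u v, V (slice d0 d1 d2 c u v).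
    move=> VS HV; apply: (slice_subspace VS (grid_inj gB) (grid_inj gC) gB.1 gC.1 lpr).
    by move=> _ /imsetP [w wW' ->]; apply: (HV w).
  split.
    apply: contrapT => Hn; apply: (exact_not_small (nd_exact0 nd) (leqnn d0)).
    apply: (sub _ (subspace_size R d0)) => w wW'.
    have := size_slice d0 d1 d2 c (B w.2.1) (C w.2.2); rewrite leq_eqVlt => /orP[/eqP E1|//].
    by case: Hn; exists w, tt.
  move=> q sq; apply: contrapT => Hn; have [u [v Hq]] := nd_indec0 nd sq.
  have [w wW'|r Er] := sub _ (subspace_comp q) _ u v; last exact: (Hq r).
  apply: contrapT => Hw; apply: Hn; exists w, tt; split=> // r Er.
  by apply: Hw; exists r.
exists Wg, T, Ts; split=> //.
- by apply: leq_trans sT _; rewrite leq_mul2r leq_maxl orbT.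
- apply: leq_trans n4 _; apply: leq_trans (leq_mul (leqnn _) cWg) _; rewrite mulnA leq_mul2r.
  by rewrite leq_maxr orbT.
move=> w wWg; have [? ? HPQ] := HT w wWg; have := subsetP WgW _ wWg.
by rewrite inE => /andP[/andP[_ ?] /andP[_ ?]]; split=> //; apply: (HPQ tt).
Qed.

End FirstRelation.

(** * Affine relations in the second variable *)

Section SecondRelation.
Variable R : rcfType.
Implicit Types (c : nat -> nat -> nat -> R).

Lemma affine_surj (s : R * R) y : s.1 != 0 -> exists x, (affine s).[x] = y.
Proof.
move=> s0; exists ((y - s.2) / s.1); rewrite affine_horner; field; exact: s0.
Qed.

Lemma size_gt1P (p : {poly R}) : (1 < size p)%N <-> exists i, p`_i.+1 != 0.
Proof.
split=> [sp|[i pi]].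
  exists (size p).-2; rewrite -[X in p`_X](_ : (size p).-1 = _); last by case: (size p) sp => [|[]].
  by rewrite -lead_coefE lead_coef_eq0 -size_poly_gt0 ltnW.
by rewrite ltnNge; apply/negP => sp; move: pi; rewrite nth_default ?eqxx //; apply: leq_trans sp _.
Qed.

Lemma slice_coef1 d0 d1 d2 c v i : exists p : {poly R}, forall u, p.[u] = (slice d0 d1 d2 c u v)`_i.
Proof.
exists (\sum_(j < d1.+1) \sum_(k < d2.+1) (v ^+ k * (\poly_(i < d0.+1) c i j k)`_i) *: 'X^j) => u.
rewrite horner_sum coef_sum; apply: eq_bigr => j _; rewrite horner_sum coef_sum.
by apply: eq_bigr => k _; rewrite hornerZ hornerXn coefZ; ring.
Qed.

Lemma slice_coef2 d0 d1 d2 c u i : exists p : {poly R}, forall v, p.[v] = (slice d0 d1 d2 c u v)`_i.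
Proof.
exists (\sum_(j < d1.+1) \sum_(k < d2.+1) (u ^+ j * (\poly_(i < d0.+1) c i j k)`_i) *: 'X^k) => v.
rewrite horner_sum coef_sum; apply: eq_bigr => j _; rewrite horner_sum coef_sum.
by apply: eq_bigr => k _; rewrite hornerZ hornerXn coefZ; ring.
Qed.

Lemma common_nonroot (p q : {poly R}) (s : R * R) x y : s.1 != 0 -> p.[x] != 0 -> q.[y] != 0 ->
  exists a, p.[a] != 0 /\ q.[(affine s).[a]] != 0.
Proof.
move=> s0 px qy; have p0 : p != 0 by apply: contraNneq px => ->; rewrite horner0.
have q0 : q \Po affine s != 0.
  have [a Ea] := affine_surj y s0.
  apply: contraNneq qy => Z; by rewrite -Ea -horner_comp Z horner0.
have [a] := poly_nonroot (mulf_neq0 p0 q0); rewrite hornerM mulf_eq0 negb_or horner_comp => /andP[].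
by exists a.
Qed.

(** One [a] has to serve both sides of the relation. On either side a nonvanishing coefficient is a
    nonzero polynomial in [a], and the two have a common nonroot. *)
Lemma common_nonconstant d0 d1 d2 c v v' (s : R * R) : s.1 != 0 ->
  (exists x, (1 < size (slice d0 d1 d2 c x v))%N) ->
  (exists x, (1 < size (slice d0 d1 d2 c x v'))%N) ->
  exists a, (1 < size (slice d0 d1 d2 c a v))%N /\ (1 < size (slice d0 d1 d2 c (affine s).[a] v'))%N.
Proof.
move=> s0 [x /size_gt1P [i xi]] [y /size_gt1P [j yj]].
have [p Ep] := slice_coef1 d0 d1 d2 c v i.+1; have [q Eq] := slice_coef1 d0 d1 d2 c v' j.+1.
have [||a [pa qa]] := @common_nonroot p q s x y s0; rewrite ?Ep ?Eq //.
by exists a; split; apply/size_gt1P; [exists i; rewrite -Ep | exists j; rewrite -Eq].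
Qed.

(** For fixed T, z and z', the curves f(a, y, z) = f(T a, y', z') in the plane (y, y'), one for
    every real [a], share the points of [E]. Since T takes O(n) values there are O(n^3) triples (T,
    z, z'), while [W1] supplies about n^4 points. *)
Lemma second_relations d k : exists k' n0, forall n c d0 d1 d2 NB NC (B : 'I_NB -> R) (C : 'I_NC -> R)
    (W1 : {set ('I_NB * 'I_NC) * ('I_NB * 'I_NC)}) T (Ts : seq (R * R)),
  nondegenerate_poly d d0 d1 d2 c -> (n0 <= n)%N -> grid n B -> grid n C ->
  uniq Ts -> (size Ts <= k * n)%N -> (n ^ 4 <= k * #|W1|)%N ->
  (forall w, w \in W1 -> [/\ T w \in Ts, (T w).1 != 0,
       varies d0 d1 d2 c (C w.1.2), varies d0 d1 d2 c (C w.2.2) &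
       slice d0 d1 d2 c (B w.1.1) (C w.1.2) =
         slice d0 d1 d2 c (B w.2.1) (C w.2.2) \Po affine (T w)]) ->
  exists (W2 : {set 'I_(size Ts) * ('I_NC * 'I_NC)}) S (Ss : seq (R * R)),
    [/\ uniq Ss, (size Ss <= k' * n)%N, (n ^ 3 <= k' * #|W2|)%N &
     forall w, w \in W2 -> [/\ S w \in Ss, (S w).1 != 0, (nth 0 Ts w.1).1 != 0 &
       forall a, slice d1 d0 d2 (swap12 c) a (C w.2.1) =
         slice d1 d0 d2 (swap12 c) (affine (nth 0 Ts w.1)).[a] (C w.2.2) \Po affine (S w)]].
Proof.
have [k4 Ek4] : exists k4, k4 = (k * k)%N by eexists.
have [kap [k1 [n1 H]]] := common_affine_relations R d k4.
have [ka Eka] : exists ka, ka = (k * d * kap)%N by eexists.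
exists (maxn k1 (k * d * k1)), (maxn (maxn n1 1) (ka * k * d * d).+1).
move=> n c d0 d1 d2 NB NC B C W1 T Ts nd; rewrite !geq_max => /andP[/andP[n1n n0] n3n].
move=> gB gC uTs sTs cW1 HT.
have [/andP[d00 d0d] /andP[d10 d1d]] := (nd_deg0 nd, nd_deg1 nd); have d2d := nd_deg2 nd.
pose tw (t : 'I_(size Ts)) := nth 0 Ts t.
pose fY := slice d1 d0 d2 (swap12 c).
pose W := [set w : 'I_(size Ts) * ('I_NC * 'I_NC) |
  [&& (tw w.1).1 != 0, varies d0 d1 d2 c (C w.2.1) & varies d0 d1 d2 c (C w.2.2)]].
pose P (w : 'I_(size Ts) * ('I_NC * 'I_NC)) a := fY a (C w.2.1).
pose Q (w : 'I_(size Ts) * ('I_NC * 'I_NC)) a := fY (affine (tw w.1)).[a] (C w.2.2).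
pose mk (p : 'I_NB * 'I_NB) (l : 'I_NC * 'I_NC) := ((p.1, l.1), (p.2, l.2)).
pose E (w : 'I_(size Ts) * ('I_NC * 'I_NC)) :=
  [set p : 'I_NB * 'I_NB | (mk p w.2 \in W1) && (T (mk p w.2) == tw w.1)].
have cE : (#|W1| <= \sum_(w in W) #|E w|)%N.
  pose Y := [set x | (x.1 \in W) && (x.2 \in E x.1)].
  rewrite -card_pairs -/Y.
  pose h (x : ('I_(size Ts) * ('I_NC * 'I_NC)) * ('I_NB * 'I_NB)) := mk x.2 x.1.2.
  apply: leq_trans (leq_imset_card h Y); apply: subset_leq_card; apply/subsetP => w wW1.
  have [Tw T0 v1 v2 _] := HT w wW1.
  have it : (index (T w) Ts < size Ts)%N by rewrite index_mem.
  apply/imsetP; exists ((Ordinal it, (w.1.2, w.2.2)), (w.1.1, w.2.1)).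
    rewrite !inE /= /tw /mk /= nth_index // T0 v1 v2 /=.
    by move: wW1 v1 v2 {T0 it Tw}; case: w => -[? ?] [? ?] /= -> _ _; rewrite eqxx.
  by rewrite /h /mk /= -!surjective_pairing.
have cW : (#|W| * n <= k4 * \sum_(w in W) #|E w|)%N.
  apply: leq_trans (_ : k4 * #|W1| <= _)%N; last by rewrite leq_mul2l cE orbT.
  apply: leq_trans (_ : k * n ^ 4 <= _)%N; last by rewrite Ek4 -mulnA leq_mul2l cW1 orbT.
  rewrite (_ : k * n ^ 4 = k * n * (n * n) * n)%N; last by rewrite !expnS expn0; clear; lia.
  rewrite leq_mul2r; apply/orP; right; apply: leq_trans (max_card _) _.
  rewrite !card_prod !card_ord; apply: leq_mul => //; apply: leq_mul; exact: gC.1.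
have vPQ w p a : w \in W -> p \in E w -> (P w a).[B p.1] = (Q w a).[B p.2].
  rewrite !inE => _ /andP[pW1 /eqP Tp]; have [_ _ _ _ Hs] := HT _ pW1.
  have -> : (P w a).[B p.1] = (slice d0 d1 d2 c (B p.1) (C w.2.1)).[a] := slice_swap12 _ _ _ _ _ _ _.
  have -> : (Q w a).[B p.2] = (slice d0 d1 d2 c (B p.2) (C w.2.2)).[(affine (tw w.1)).[a]] :=
    slice_swap12 _ _ _ _ _ _ _.
  by move: Hs; rewrite /mk /= => ->; rewrite horner_comp -Tp.
have ncPQ w : w \in W -> exists a, (1 < size (P w a))%N /\ (1 < size (Q w a))%N.
  by rewrite inE => /and3P[t0 /asboolP v1 /asboolP v2]; apply: common_nonconstant.
have bE w : w \in W -> (#|E w| <= d * n)%N.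
  move=> wW; have [a [_ lQ]] := ncPQ w wW.
  apply: leq_trans (_ : d * #|[set p.1 | p in E w]| <= _)%N.
    apply: (@fiber_card _ d (P w a) (Q w a) _ B); first exact: grid_inj gB.
      by rewrite lQ /=; apply: leq_trans (size_slice _ _ _ _ _ _) _.
    by move=> p; apply: vPQ.
  by rewrite leq_mul2l; apply/orP; right; apply: leq_trans (max_card _) _; rewrite card_ord gB.1.
have n3 : (n ^ 3 <= k * d * #|W|)%N.
  rewrite -(leq_pmul2r n0) -expnSr; apply: leq_trans (leq_trans cW1 (leq_mul (leqnn k) cE)) _.
  rewrite -!mulnA leq_mul2l; apply/orP; right.
  apply: leq_trans (_ : \sum_(w in W) d * n <= _)%N; first exact: leq_sum.
  by rewrite sum_nat_const mulnCA.
have [|||||W2 [S [Ss [uS sS W2W cW2 HS]]]] :=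
  H n NB d1 B _ W R P Q E n1n gB.1 gB.2 (nd_deg1 nd).
- by move=> w i _; split; apply: size_slice.
- exact: ncPQ.
- exact: vPQ.
- exact: cW.
(* As [a] runs over all reals and T is onto, more than [d2] levels z' suffice. If f involves z, it
   varies in z at some point of [tau], so T and z' leave at most [d] choices of z. With O(n) maps T,
   a class of order n^2 then has many levels z'. *)
- move=> W' tau W'W W'0 cW' ftau tauE.
  have n2 : (n ^ 2 <= ka * #|W'|)%N.
    rewrite -(leq_pmul2r n0) -expnSr; apply: leq_trans n3 _.
    apply: leq_trans (leq_mul (leqnn _) cW') _; rewrite Eka leq_eqVlt; apply/orP; left.
    by apply/eqP; clear; lia.
  pose pr (w : 'I_(size Ts) * ('I_NC * 'I_NC)) := w.2.2.
  have lpr : (d2 < #|pr @: W'|)%N.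
    have [d20|d2p] := posnP d2.
      by rewrite d20 card_gt0; have /set0Pn [w wW'] := W'0; apply/set0Pn; exists (pr w); apply: imset_f.
    have [j [jF [x0 sx0]]] : exists j, j \in [set p.1 | p in tau] /\
        exists x, (1 < size (slice d2 d0 d1 (rot3 c) x (B j)))%N.
      apply: contrapT => Hn; have [s us [ss sE]] := card_values [set p.1 | p in tau] (grid_inj gB).
      apply: (exact_not_small (nd_exact2 nd) d2p) => x y; move: y.
      apply: (slice_subspace2 (subspace_size R 1) us); first by rewrite ss (leq_ltn_trans d1d).
      move=> u /sE [j jF ->]; rewrite leqNgt; apply/negP => Hj.
      by apply: Hn; exists j; split=> //; exists x.
    have [p ptau Ep] := imsetP jF.
    have cpr : (#|W'| <= #|pr @: W'| * (size Ts * d))%N.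
      apply: card_le_fibers => u _; set Wu := [set w in W' | _].
      pose fstw (w : 'I_(size Ts) * ('I_NC * 'I_NC)) := w.1.
      apply: leq_trans (_ : #|fstw @: Wu| * d <= _)%N; last first.
        by rewrite leq_mul2r; apply/orP; right; apply: leq_trans (max_card _) _; rewrite card_ord.
      apply: card_le_fibers => t _.
      pose midw (w : 'I_(size Ts) * ('I_NC * 'I_NC)) := w.2.1.
      rewrite -(card_in_imset (f := midw)); last first.
        move=> [q [l l']] [r [m m']]; rewrite !inE /pr /fstw /midw /=.
        by move=> /andP[/andP[_ /eqP ->] /eqP ->] /andP[/andP[_ /eqP ->] /eqP ->] ->.
      apply: leq_trans (card_value_le (d := d) (p := slice d2 d0 d1 (rot3 c) x0 (B j))
        (fY (affine (tw t)).[x0] (C u)).[B p.2] (grid_inj gC) _); last first.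
        by rewrite sx0; apply: leq_trans (size_slice _ _ _ _ _ _) _.
      apply: subset_leq_card; apply/subsetP => _ /imsetP [w + ->].
      rewrite !inE /pr /fstw /midw => /andP[/andP[wW' /eqP <-] /eqP <-].
      have := vPQ w p x0 (subsetP W'W _ wW') (subsetP (tauE _ wW') _ ptau).
      rewrite /P /Q /fY => <-; rewrite Ep; apply/eqP.
      by rewrite slice_rot3; apply: esym; apply: slice_swap12.
    rewrite ltnNge; apply/negP => le.
    have := leq_trans n2 (leq_mul (leqnn ka) (leq_trans cpr (leq_mul (leq_trans le d2d) (leq_mul sTs (leqnn d))))).
    rewrite leqNgt => /negP; apply.
    rewrite (_ : ka * _ = n * (ka * k * d * d))%N; last by clear; lia.
    by rewrite -mulnn ltn_mul2l n0.
  have sub V : subspace V -> (forall w a, w \in W' -> V (Q w a)) -> forall x v, V (fY x v).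
    move=> VS HV x; have [s us [ss sE]] := card_values (pr @: W') (grid_inj gC).
    apply: (slice_subspace2 VS us); first by rewrite ss.
    move=> _ /sE [_ /imsetP [w wW' ->] ->].
    have := subsetP W'W _ wW'; rewrite inE => /and3P[t0 _ _].
    by have [a <-] := affine_surj x t0; apply: HV.
  split.
    apply: contrapT => Hn; apply: (exact_not_small (nd_exact1 nd) (leqnn d1)).
    apply: (sub _ (subspace_size R d1)) => w a wW'.
    have := size_slice d1 d0 d2 (swap12 c) (affine (tw w.1)).[a] (C w.2.2).
    rewrite leq_eqVlt => /orP[/eqP E1|//].
    by case: Hn; exists w, a.
  move=> q sq; apply: contrapT => Hn; have [u [v Hq]] := nd_indec1 nd sq.
  have [w a wW'|r Er] := sub _ (subspace_comp q) _ u v; last exact: (Hq r).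
  apply: contrapT => Hw; apply: Hn; exists w, a; split=> // r Er.
  by apply: Hw; exists r.
exists W2, S, Ss; split=> //.
- by apply: leq_trans sS _; rewrite leq_mul2r leq_maxl orbT.
- apply: leq_trans n3 _; apply: leq_trans (leq_mul (leqnn _) cW2) _; rewrite mulnA leq_mul2r.
  by rewrite leq_maxr orbT.
move=> w wW2; have [? ? HPQ] := HS w wW2; have := subsetP W2W _ wW2.
by rewrite inE => /and3P[? _ _]; split.
Qed.

End SecondRelation.

(** * Many symmetries with the same action on the third variable *)

Section ThirdRelation.
Variable R : rcfType.
Implicit Types (c : nat -> nat -> nat -> R).

Lemma common_nonconstant2 d0 d1 d2 c (s t : R * R) : s.1 != 0 -> t.1 != 0 ->
  (exists x y, (1 < size (slice d0 d1 d2 c x y))%N) ->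
  exists a b, (1 < size (slice d0 d1 d2 c a b))%N /\
    (1 < size (slice d0 d1 d2 c (affine s).[a] (affine t).[b]))%N.
Proof.
move=> s0 t0 [x [y sxy]]; have /size_gt1P [i xyi] := sxy.
have [p Ep] := slice_coef2 d0 d1 d2 c x i.+1.
have [||b [pb qb]] := @common_nonroot _ p p t y y t0; rewrite ?Ep //.
have [||a [sa1 sa2]] := @common_nonconstant _ d0 d1 d2 c b (affine t).[b] s s0.
- by exists x; apply/size_gt1P; exists i; rewrite -Ep.
- by exists x; apply/size_gt1P; exists i; rewrite -Ep.
by exists a, b.
Qed.

Lemma slice_constant d0 d1 c x z z' : slice d0 d1 0 c x z = slice d0 d1 0 c x z'.
Proof. by apply: eq_bigr => j _; rewrite !big_ord_recl !big_ord0 !expr0. Qed.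

Definition trivariate d0 d1 d2 c (x y z : R) := (slice d0 d1 d2 c y z).[x].

Lemma trivariate_swap12 d0 d1 d2 c x y z :
  trivariate d0 d1 d2 c x y z = (slice d1 d0 d2 (swap12 c) x z).[y].
Proof. by rewrite slice_swap12. Qed.

Lemma trivariate_rot3 d0 d1 d2 c x y z :
  trivariate d0 d1 d2 c x y z = (slice d2 d0 d1 (rot3 c) x y).[z].
Proof. by rewrite slice_rot3. Qed.

(** The parameters are now O(n^2) pairs (T, S), and the relation in z attaches a map U to each.
    Order n^2 of the pairs survive while U takes O(n) values, so some U belongs to many pairs. *)
Lemma many_symmetries d k m : exists n0, forall n c d0 d1 d2 NC (C : 'I_NC -> R) (Ts Ss : seq (R * R))
    (W2 : {set 'I_(size Ts) * ('I_NC * 'I_NC)}) S,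
  nondegenerate_poly d d0 d1 d2 c -> (n0 <= n)%N -> grid n C ->
  uniq Ts -> (size Ts <= k * n)%N -> uniq Ss -> (size Ss <= k * n)%N -> (n ^ 3 <= k * #|W2|)%N ->
  (forall w, w \in W2 -> [/\ S w \in Ss, (S w).1 != 0, (nth 0 Ts w.1).1 != 0 &
     forall a, slice d1 d0 d2 (swap12 c) a (C w.2.1) =
         slice d1 d0 d2 (swap12 c) (affine (nth 0 Ts w.1)).[a] (C w.2.2) \Po affine (S w)]) ->
  exists (L : seq ((R * R) * (R * R))) (U : R * R), [/\ uniq L, (m <= size L)%N, U.1 != 0 &
    forall p, p \in L -> [/\ p.1.1 != 0, p.2.1 != 0 & forall x y z,
      trivariate d0 d1 d2 c x y z =
      trivariate d0 d1 d2 c (affine p.1).[x] (affine p.2).[y] (affine U).[z]]].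
Proof.
have [kap [k1 [n1 H]]] := common_affine_relations R d (k * k * k).
exists (maxn (maxn n1 1) (maxn (k * d * k1 * k1 * m.+1) (k * m)).+1).
move=> n c d0 d1 d2 NC C Ts Ss W2 S nd; rewrite !geq_max gtn_max => /andP[/andP[n1n n0] /andP[n3n n4n]].
move=> gC uTs sTs uSs sSs cW2 HS; have d2d := nd_deg2 nd.
pose tw (q : 'I_(size Ts) * 'I_(size Ss)) := nth 0 Ts q.1.
pose sw (q : 'I_(size Ts) * 'I_(size Ss)) := nth 0 Ss q.2.
pose E (q : 'I_(size Ts) * 'I_(size Ss)) :=
  [set l : 'I_NC * 'I_NC | ((q.1, l) \in W2) && (S (q.1, l) == sw q)].
pose X := [set q | E q != set0].
have XP q : q \in X -> (tw q).1 != 0 /\ (sw q).1 != 0.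
  rewrite inE => /set0Pn [l]; rewrite inE => /andP[lW2 /eqP El].
  by have [_ s0 t0 _] := HS _ lW2; rewrite -El.
have cE : (#|W2| <= \sum_(q in X) #|E q|)%N.
  pose Y := [set x | (x.1 \in X) && (x.2 \in E x.1)].
  rewrite -card_pairs -/Y.
  pose h (x : ('I_(size Ts) * 'I_(size Ss)) * ('I_NC * 'I_NC)) := (x.1.1, x.2).
  apply: leq_trans (leq_imset_card h Y); apply: subset_leq_card; apply/subsetP => w wW2.
  have [Sw _ _ _] := HS w wW2; have it : (index (S w) Ss < size Ss)%N by rewrite index_mem.
  apply/imsetP; exists ((w.1, Ordinal it), w.2); last by rewrite /h /= -surjective_pairing.
  have wE : w.2 \in E (w.1, Ordinal it).
    by rewrite inE /sw /= -surjective_pairing wW2 nth_index /=.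
  by rewrite inE /= wE andbT inE; apply/set0Pn; exists w.2.
have n3 : (n ^ 3 <= k * \sum_(q in X) #|E q|)%N := leq_trans cW2 (leq_mul (leqnn k) cE).
suff [X' [U [X'X cX' U0 HU]]] : exists (X' : {set 'I_(size Ts) * 'I_(size Ss)}) (U : R * R),
    [/\ X' \subset X, (m <= #|X'|)%N, U.1 != 0 & forall q, q \in X' -> forall x y z,
      trivariate d0 d1 d2 c x y z =
      trivariate d0 d1 d2 c (affine (tw q)).[x] (affine (sw q)).[y] (affine U).[z]].
  exists [seq (tw q, sw q) | q <- enum X'], U; split=> //.
  - rewrite map_inj_uniq ?enum_uniq // => -[i j] [i' j'] [].
    rewrite /tw /sw /= => /eqP + /eqP; rewrite !nth_uniq // => /eqP e1 /eqP e2.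
    by congr (_, _); apply: ord_inj.
  - by rewrite size_map -cardE.
  move=> _ /mapP [q + ->]; rewrite mem_enum => qX'; have [? ?] := XP q (subsetP X'X _ qX').
  by split=> //; apply: HU.
(* If z does not occur, U is the identity and [W2] alone forces enough pairs. *)
have [d20|d2p] := posnP d2.
  exists X, (1, 0); split=> //; last 2 first.
  - by rewrite /= oner_neq0.
  - move=> q; rewrite inE => /set0Pn [l]; rewrite inE => /andP[lW2 /eqP El] x y z.
    have [_ _ _ Hq] := HS _ lW2; rewrite (trivariate_swap12 _ _ _ _ x y z).
    rewrite (trivariate_swap12 _ _ _ _ (affine (tw q)).[x]).
    move: Hq; rewrite d20 El /= => Hq; rewrite (slice_constant _ _ _ _ z (C l.1)) Hq horner_comp.
    by congr (_.[_]); apply: slice_constant.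
  have H1 : (n ^ 3 <= k * (#|X| * n ^ 2))%N.
    apply: leq_trans n3 _; rewrite leq_mul2l -sum_nat_const; apply/orP; right; apply: leq_sum => q _.
    by apply: leq_trans (max_card _) _; rewrite card_prod !card_ord -mulnn leq_mul // gC.1.
  have H2 : (n <= k * #|X|)%N.
    by rewrite -(leq_pmul2r (_ : 0 < n ^ 2)%N) ?expn_gt0 ?n0 // -expnS -mulnA.
  rewrite leqNgt; apply/negP => lt; have := leq_trans n4n (leq_trans H2 (leq_mul (leqnn k) (ltnW lt))).
  by rewrite ltnn.
pose P (q : 'I_(size Ts) * 'I_(size Ss)) (ab : R * R) := slice d2 d0 d1 (rot3 c) ab.1 ab.2.
pose Q (q : 'I_(size Ts) * 'I_(size Ss)) (ab : R * R) :=
  slice d2 d0 d1 (rot3 c) (affine (tw q)).[ab.1] (affine (sw q)).[ab.2].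
have vPQ q p ab : q \in X -> p \in E q -> (P q ab).[C p.1] = (Q q ab).[C p.2].
  rewrite [p \in _]inE => _ /andP[pW2 /eqP El]; have [_ _ _ Hq] := HS _ pW2.
  rewrite /P /Q -trivariate_rot3 -[RHS]trivariate_rot3 trivariate_swap12.
  rewrite [RHS]trivariate_swap12 /tw -El /=.
  by move: (Hq ab.1) => /= ->; rewrite horner_comp.
have ncPQ q : q \in X -> exists ab, (1 < size (P q ab))%N /\ (1 < size (Q q ab))%N.
  move=> /XP [t0 s0]; have [x [y Exy]] := nd_exact2 nd.
  have [|a [b Hab]] := @common_nonconstant2 d2 d0 d1 (rot3 c) (tw q) (sw q) t0 s0.
    by exists x, y; rewrite Exy.
  by exists (a, b).
have bE q : q \in X -> (#|E q| <= d * n)%N.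
  move=> qX; have [ab [_ lQ]] := ncPQ q qX.
  apply: leq_trans (_ : d * #|[set p.1 | p in E q]| <= _)%N.
    apply: (@fiber_card _ d (P q ab) (Q q ab) _ C); first exact: grid_inj gC.
      by rewrite lQ /=; apply: leq_trans (size_slice _ _ _ _ _ _) _.
    by move=> p; apply: vPQ.
  by rewrite leq_mul2l; apply/orP; right; apply: leq_trans (max_card _) _; rewrite card_ord gC.1.
have n2 : (n ^ 2 <= k * d * #|X|)%N.
  rewrite -(leq_pmul2r n0) -expnSr; apply: leq_trans n3 _.
  rewrite -!mulnA leq_mul2l; apply/orP; right.
  apply: leq_trans (_ : \sum_(w in X) d * n <= _)%N; first exact: leq_sum.
  by rewrite sum_nat_const mulnCA.
have cX : (#|X| * n <= k * k * k * \sum_(q in X) #|E q|)%N.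
  rewrite -mulnA; apply: leq_trans (leq_mul (leqnn (k * k)) n3).
  rewrite (_ : k * k * n ^ 3 = k * n * (k * n) * n)%N; last by rewrite !expnS expn0; clear; lia.
  rewrite leq_mul2r; apply/orP; right; apply: leq_trans (max_card _) _.
  by rewrite card_prod !card_ord leq_mul.
have [|||||Wg [U [Us [uU sU WgX cWg HU]]]] :=
  H n NC d2 C _ X (R * R)%type P Q E n1n gC.1 gC.2 (introT andP (conj d2p d2d)).
- by move=> w i _; split; apply: size_slice.
- exact: ncPQ.
- exact: vPQ.
- exact: cX.
(* T and S are onto, so a single pair already produces every slice of f. *)
- move=> W' tau W'X W'0 _ _ _; have [w wW'] := set0Pn _ W'0.
  have [t0 s0] := XP w (subsetP W'X _ wW').
  have onto u v : exists ab, Q w ab = slice d2 d0 d1 (rot3 c) u v.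
    have [a <-] := affine_surj u t0; have [b <-] := affine_surj v s0; by exists (a, b).
  split.
    by have [u [v <-]] := nd_exact2 nd; have [ab <-] := onto u v; exists w, ab.
  move=> p sp; have [u [v Hp]] := nd_indec2 nd d2p sp; have [ab Eab] := onto u v.
  by exists w, ab; split=> // r; rewrite Eab.
have n2' : (n ^ 2 <= k * d * k1 * #|Wg|)%N.
  by apply: leq_trans n2 _; rewrite -!mulnA !leq_mul2l cWg !orbT.
have Wg0 : Wg != set0.
  have n20 : (0 < n ^ 2)%N by rewrite expn_gt0 n0.
  by rewrite -card_gt0; move: (leq_trans n20 n2'); rewrite muln_gt0 => /andP[].
have [|u uUs Hu] := @pigeonhole_seq _ _ Wg Us (fun q u => U q == u) Wg0.
  by move=> q /HU [UqUs _ _]; exists (U q).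
exists [set q in Wg | U q == u], u; split.
- by apply/subsetP => q; rewrite inE => /andP[/(subsetP WgX)].
- rewrite leqNgt; apply/negP => lt.
  have := leq_trans n2' (leq_mul (leqnn _) (leq_trans Hu (leq_mul sU (ltnW (leqW lt))))).
  rewrite leqNgt => /negP; apply.
  rewrite (_ : _ * (k1 * n * m.+1) = n * (k * d * k1 * k1 * m.+1))%N; last by clear; lia.
  by rewrite -mulnn ltn_mul2l n0.
- have : [set q in Wg | U q == u] != set0.
    rewrite -card_gt0; move: Wg0; rewrite -card_gt0 => /leq_trans/(_ Hu).
    by rewrite muln_gt0 => /andP[].
  by move=> /set0Pn [q]; rewrite inE => /andP[/HU [_ + _] /eqP <-].
move=> q; rewrite inE => /andP[/HU [_ _ HPQ] /eqP <-] x y z.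
rewrite trivariate_rot3 [RHS]trivariate_rot3.
by have := HPQ (x, y); rewrite /P /= => ->; rewrite horner_comp.
Qed.

End ThirdRelation.

(** * A symmetry that fixes the third variable *)

Section Symmetry.
Variable R : rcfType.
Implicit Types (c : nat -> nat -> nat -> R) (s t : R * R).

(** Two pairs with the same U differ by a symmetry fixing z. There are four sign patterns for two
    slopes, so among 5 pairs two agree in signs. Their quotient has positive slopes, which excludes
    reflections: a slope of absolute value 1 equals 1. *)
Lemma affine_symmetry d k : exists n0, forall n c d0 d1 d2 NA NB NC
    (A : 'I_NA -> R) (B : 'I_NB -> R) (C : 'I_NC -> R) (D : seq R),
  nondegenerate_poly d d0 d1 d2 c -> (n0 <= n)%N -> grid n A -> grid n B -> grid n C ->
  (size D <= n)%N ->
  (n ^ 3 <= k * #|[set p : 'I_NA * ('I_NB * 'I_NC) |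
     trivariate d0 d1 d2 c (A p.1) (B p.2.1) (C p.2.2) \in D]|)%N ->
  exists s t, [/\ s.1 != 0 /\ t.1 != 0, (s, t) != ((1, 0), (1, 0)),
    (s.1 = 1 /\ t.1 = 1) \/ (`|s.1| != 1) || (`|t.1| != 1) &
    forall x y z, trivariate d0 d1 d2 c (affine s).[x] (affine t).[y] z = trivariate d0 d1 d2 c x y z].
Proof.
have [k1 [n1 H1]] := first_relations R d k; have [k2 [n2 H2]] := second_relations R d k1.
have [n3 H3] := many_symmetries R d (maxn k1 k2) 5.
exists (maxn n1 (maxn n2 n3)) => n c d0 d1 d2 NA NB NC A B C D nd.
rewrite !geq_max => /and3P[n1n n2n n3n] gA gB gC sD cnt.
have [W1 [T [Ts [uT sT cW1 HT]]]] := H1 n c d0 d1 d2 NA NB NC A B C D nd n1n gA gB gC sD cnt.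
have [W2 [S [Ss [uS sS cW2 HS]]]] := H2 n c d0 d1 d2 NB NC B C W1 T Ts nd n2n gB gC uT sT cW1 HT.
have [||| L [U [uL sL U0 HL]]] := H3 n c d0 d1 d2 NC C Ts Ss W2 S nd n3n gC uT _ uS _ _ HS.
- by apply: leq_trans sT _; rewrite leq_mul2r leq_maxl orbT.
- by apply: leq_trans sS _; rewrite leq_mul2r leq_maxr orbT.
- by apply: leq_trans cW2 _; rewrite leq_mul2r leq_maxr orbT.
have [p [q [pL qL pq kind]]] : exists p q, [/\ p \in L, q \in L, p != q &
    (p.1.1 = q.1.1 /\ p.2.1 = q.2.1) \/ (`|p.1.1| != `|q.1.1|) || (`|p.2.1| != `|q.2.1|)].
  apply: contrapT => Hn; pose sg (p : (R * R) * (R * R)) := (0 < p.1.1, 0 < p.2.1).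
  have : (size (map sg L) <= #|{: bool * bool}|)%N.
    rewrite -(card_uniqP _) ?max_card // map_inj_in_uniq // => p q pL qL.
    move=> [E1 E2]; apply/eqP/negPn/negP => pq; apply: Hn; exists p, q; split=> //.
    have [|] := boolP ((`|p.1.1| != `|q.1.1|) || (`|p.2.1| != `|q.2.1|)); first by right.
    rewrite negb_or !negbK => /andP[/eqP e1 /eqP e2]; left.
    have sgE (a b : R) : (0 < a) = (0 < b) -> `|a| = `|b| -> a = b.
      have [a0|a0] := ltP 0 a; have [b0|b0] := ltP 0 b => // _.
        by rewrite !gtr0_norm.
      by rewrite !ler0_norm // => /oppr_inj.
    by split; apply: sgE.
  rewrite size_map card_prod card_bool => le4.
  by have := leq_trans sL le4.
have [p10 p20 Hp] := HL p pL; have [q10 q20 Hq] := HL q qL.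
exists (p.1.1 / q.1.1, (p.1.2 - q.1.2) / q.1.1), (p.2.1 / q.2.1, (p.2.2 - q.2.2) / q.2.1).
split=> /=.
- by rewrite !mulf_neq0 ?invr_neq0.
- apply: contraNneq pq => -[e1 e2 e3 e4].
  rewrite [p]surjective_pairing [p.1]surjective_pairing [p.2]surjective_pairing.
  rewrite [q]surjective_pairing [q.1]surjective_pairing [q.2]surjective_pairing.
  have -> : p.1.1 = q.1.1 by rewrite -[LHS](divfK q10) e1 mul1r.
  have -> : p.2.1 = q.2.1 by rewrite -[LHS](divfK q20) e3 mul1r.
  have -> : p.1.2 = q.1.2 by apply/eqP; rewrite -subr_eq0 -[_ - _](divfK q10) e2 mul0r.
  have -> : p.2.2 = q.2.2 by apply/eqP; rewrite -subr_eq0 -[_ - _](divfK q20) e4 mul0r.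
  by [].
- case: kind => [[-> ->]|H]; first by left; rewrite !divff.
  right; apply: contraLR H; rewrite !negb_or !negbK !normf_div => /andP[/eqP e1 /eqP e2].
  by rewrite -[`|p.1.1|](divfK (_ : `|q.1.1| != 0)) ?normr_eq0 // e1 mul1r
             -[`|p.2.1|](divfK (_ : `|q.2.1| != 0)) ?normr_eq0 // e2 mul1r !eqxx.
move=> x y z; rewrite [RHS]Hp [LHS]Hq !affine_horner /=.
by congr (trivariate _ _ _ _ _ _ _); field.
Qed.

Lemma slice_coef_subspace (V : {poly R} -> Prop) d0 d1 d2 c : subspace V ->
  (forall u v, V (slice d0 d1 d2 c u v)) ->
  forall j k, (j <= d1)%N -> (k <= d2)%N -> V (\poly_(i < d0.+1) c i j k).
Proof.
move=> VS; pose s d := [seq x%:R : R | x <- iota 0 d.+1].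
have us d : uniq (s d) by rewrite map_inj_uniq ?iota_uniq // => a b /eqP; rewrite eqr_nat => /eqP.
have ss d : (d < size (s d))%N by rewrite size_map size_iota.
move=> H j k jd kd.
pose w (j : 'I_d1.+1) v := \sum_(k < d2.+1) v ^+ k *: \poly_(i < d0.+1) c i j k.
have wV v jj : V (w jj v).
  apply: (@vandermonde_subspace _ _ _ (fun jj => w jj v) _ VS (us d1) (ss d1)) => u _.
  rewrite (_ : \sum_j _ = slice d0 d1 d2 c u v) //.
  by apply: eq_bigr => l _; rewrite scaler_sumr; apply: eq_bigr => m _; rewrite scalerA.
have jd' : (j < d1.+1)%N by []; have kd' : (k < d2.+1)%N by [].
exact: (@vandermonde_subspace _ _ _ (fun k : 'I_d2.+1 => \poly_(i < d0.+1) c i j k) _ VS (us d2) (ss d2)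
    (fun v _ => wV v (Ordinal jd')) (Ordinal kd')).
Qed.

Lemma slice_eq0 d0 d1 d2 c : (forall u v, slice d0 d1 d2 c u v = 0) ->
  forall i j k, (i <= d0)%N -> (j <= d1)%N -> (k <= d2)%N -> c i j k = 0.
Proof.
have S0 : subspace (fun p : {poly R} => p = 0).
  by split=> // a p q -> ->; rewrite scaler0 addr0.
move=> H i j k id jd kd.
by have /polyP/(_ i) := slice_coef_subspace S0 H jd kd; rewrite coef_poly ltnS id coef0.
Qed.

Lemma poly_horner0 (p : {poly R}) : (forall x, p.[x] = 0) -> p = 0.
Proof.
by move=> H; apply: (@poly_eq_off R 1) => [|a _]; rewrite ?oner_neq0 // H horner0.
Qed.

Lemma trivariate_inj d0 d1 d2 c c' :
  (forall x y z, trivariate d0 d1 d2 c x y z = trivariate d0 d1 d2 c' x y z) ->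
  forall i j k, (i <= d0)%N -> (j <= d1)%N -> (k <= d2)%N -> c i j k = c' i j k.
Proof.
move=> H i j k id jd kd; apply/eqP; rewrite -subr_eq0; apply/eqP.
apply: (@slice_eq0 d0 d1 d2 (fun i j k => c i j k - c' i j k)) => // u v.
apply: poly_horner0 => x; transitivity ((slice d0 d1 d2 c u v).[x] - (slice d0 d1 d2 c' u v).[x]).
  rewrite !slice_horner -sumrB; apply: eq_bigr => a _; rewrite -sumrB; apply: eq_bigr => b _.
  by rewrite -sumrB; apply: eq_bigr => e _; ring.
by rewrite -/(trivariate d0 d1 d2 c x u v) H subrr.
Qed.

Lemma trivariate_shift d0 d1 d2 c a : exists c', forall x y z,
  trivariate d0 d1 d2 c' x y z = trivariate d0 d1 d2 c (x + a) y z.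
Proof.
exists (fun i j k => ((\poly_(i < d0.+1) c i j k) \Po ('X + a%:P))`_i) => x y z.
rewrite /trivariate slice_horner exchange_big /= [in RHS]/slice horner_sum; apply: eq_bigr => j _.
rewrite exchange_big /= horner_sum; apply: eq_bigr => k _; rewrite hornerZ.
have -> : (\poly_(i < d0.+1) c i j k).[x + a] = ((\poly_(i < d0.+1) c i j k) \Po ('X + a%:P)).[x].
  by rewrite horner_comp !hornerE.
rewrite (@horner_coef_wide _ d0.+1 (_ \Po _)); last first.
  have := size_comp_poly (\poly_(i < d0.+1) c i j k) ('X + a%:P).
  rewrite size_XaddC muln1 => E.
  have : (size (\poly_(i < d0.+1) c i j k) <= d0.+1)%N by apply: size_poly.
  by move: E; case: (size (_ \Po _)) => [//|m] /= ->; case: (size _).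
by rewrite big_distrr /=; apply: eq_bigr => i _; ring.
Qed.

Lemma coef_comp_scaleX (p : {poly R}) (la : R) j : (p \Po (la *: 'X))`_j = p`_j * la ^+ j.
Proof.
rewrite comp_polyE; under eq_bigr do rewrite exprZn scalerA.
by rewrite -(poly_def _ (fun i => p`_i * la ^+ i)) coef_poly; case: ltnP => // sj; rewrite nth_default ?mul0r.
Qed.

(** The coefficient p(x) of y^j satisfies p(x) = la^j p(x + be). Comparing leading coefficients
    gives la^j = 1, so p = 0 for j > 0. *)
Lemma translation_dilation_constant d0 d1 d2 c be (la : R) :
  (forall x y z, trivariate d0 d1 d2 c (x + be) (la * y) z = trivariate d0 d1 d2 c x y z) ->
  `|la| != 1 -> forall x z, (size (slice d1 d0 d2 (swap12 c) x z) <= 1)%N.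
Proof.
move=> H t1 x z; apply/leq_sizeP => j j1.
have [p Ep] := slice_coef1 d1 d0 d2 (swap12 c) z j; rewrite -Ep.
suff -> : p = 0 by rewrite horner0.
have E : p = la ^+ j *: (p \Po ('X + be%:P)).
  apply/eqP; rewrite -subr_eq0; apply/eqP/poly_horner0 => u.
  rewrite hornerD hornerN hornerZ horner_comp !Ep; apply/eqP; rewrite subr_eq0; apply/eqP.
  rewrite -[('X + be%:P).[u]](_ : u + be = _); last by rewrite !hornerE.
  have : slice d1 d0 d2 (swap12 c) u z = slice d1 d0 d2 (swap12 c) (u + be) z \Po (la *: 'X).
    apply/eqP; rewrite -subr_eq0; apply/eqP/poly_horner0 => y.
    rewrite hornerD hornerN horner_comp -!trivariate_swap12 hornerZ hornerX H subrr //.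
  by move=> ->; rewrite coef_comp_scaleX mulrC.
apply/eqP; rewrite -lead_coef_eq0; apply/negPn/negP => lp0.
have := congr1 lead_coef E; rewrite lead_coefZ lead_coef_comp ?size_XaddC // lead_coefXaddC expr1n mulr1.
move=> /(congr1 (fun a => a / lead_coef p)); rewrite divff // mulfK // => /(congr1 Num.norm) /esym.
rewrite normr1 normrX => /eqP; rewrite pexpr_eq1 ?normr_ge0 //.
by rewrite (negPf t1).
Qed.

End Symmetry.

(** * Polynomials with affine symmetries *)

Section Special.
Variable R : rcfType.
Implicit Types (c : nat -> nat -> nat -> R) (s t u : R * R).

Definition special (f : R -> R -> R -> R) := exists g k l m : {poly R},
  (forall x y z, f x y z = g.[k.[x] + l.[y] + m.[z]]) \/
  (forall x y z, f x y z = g.[k.[x] * l.[y] * m.[z]]).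

Lemma trivariate_shift3 d0 d1 d2 c a b e : exists c', forall x y z,
  trivariate d0 d1 d2 c' x y z = trivariate d0 d1 d2 c (x + a) (y + b) (z + e).
Proof.
have [c1 H1] := trivariate_shift d0 d1 d2 c a.
have [c2 H2] := trivariate_shift d1 d0 d2 (swap12 c1) b.
have [c3 H3] := trivariate_shift d2 d0 d1 (rot3 (swap12 c2)) e.
exists (fun i j k => c3 k i j) => x y z.
transitivity (trivariate d2 d0 d1 c3 z x y); first exact: trivariate_rot3.
rewrite H3; transitivity (trivariate d0 d1 d2 (swap12 c2) x y (z + e)).
  exact: esym (trivariate_rot3 _ _ _ _ _ _ _).
transitivity (trivariate d1 d0 d2 c2 y x (z + e)); first exact: trivariate_swap12.
rewrite H2; transitivity (trivariate d0 d1 d2 c1 x (y + b) (z + e)); last exact: H1.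
exact: esym (trivariate_swap12 _ _ _ _ _ _ _).
Qed.

Lemma constant_size (p : {poly R}) : (forall x, p.[x] = p.[0]) -> (size p <= 1)%N.
Proof.
move=> H; have -> : p = p.[0]%:P; last exact: size_polyC_leq1.
by apply/eqP; rewrite -subr_eq0; apply/eqP/poly_horner0 => x; rewrite !hornerE H subrr.
Qed.

Lemma periodic_constant (p : {poly R}) be : be != 0 -> (forall x, p.[x + be] = p.[x]) ->
  forall x, p.[x] = p.[0].
Proof.
move=> be0 H; have Hn n : p.[n%:R * be] = p.[0].
  elim: n => [|n IH]; first by rewrite mul0r.
  by rewrite -natr1 mulrDl mul1r H.
suff E : p - p.[0]%:P = 0.
  by move=> x; apply/eqP; rewrite -subr_eq0 -(hornerC p.[0] x) -hornerN -hornerD E horner0.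
apply/eqP; apply/negPn/negP => q0.
have := @max_poly_roots _ (p - p.[0]%:P) [seq i%:R * be | i <- iota 0 (size (p - p.[0]%:P))] q0.
rewrite size_map size_iota ltnn => F; apply: (notF (F _ _)).
  by apply/allP => _ /mapP [i _ ->]; rewrite /root !hornerE Hn subrr.
by rewrite map_inj_uniq ?iota_uniq // => i j /(mulIf be0) /eqP; rewrite eqr_nat => /eqP.
Qed.

Definition invariant12 d0 d1 d2 c s t := forall x y z,
  trivariate d0 d1 d2 c (affine s).[x] (affine t).[y] z = trivariate d0 d1 d2 c x y z.

Lemma invariant12_swap d0 d1 d2 c s t : invariant12 d0 d1 d2 c s t ->
  invariant12 d1 d0 d2 (swap12 c) t s.
Proof.
move=> H y x z; rewrite /trivariate.
rewrite (slice_swap12 d0 d1 d2 c) (slice_swap12 d0 d1 d2 c); exact: H.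
Qed.

(** With y centred at the fixed point of [t], a translation in x would make f independent of y by
    [translation_dilation_constant]. *)
Lemma dilation_both d0 d1 d2 c s t : (0 < d1)%N -> exact_degree d1 d0 d2 (swap12 c) ->
  invariant12 d0 d1 d2 c s t -> `|t.1| != 1 -> s.1 != 1.
Proof.
move=> d1p ex inv t1; apply/eqP => s1.
have t1' : 1 - t.1 != 0 by apply: contraNneq t1 => /eqP; rewrite subr_eq0 => /eqP <-; rewrite normr1.
pose y0 := t.2 / (1 - t.1).
have [c' Ec'] := trivariate_shift3 d0 d1 d2 c 0 y0 0.
have small := @translation_dilation_constant _ d0 d1 d2 c' s.2 t.1 _ t1.
apply: (exact_not_small ex d1p) => x z; apply: constant_size => y.
rewrite -!trivariate_swap12.
have E w : trivariate d0 d1 d2 c x w z = (slice d1 d0 d2 (swap12 c') x z).[w - y0].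
  by rewrite -trivariate_swap12 Ec' !addr0 subrK.
rewrite !E (size1_polyC (small _ _ _)) ?hornerC // => {x y z E} x y z; rewrite !Ec' !addr0.
rewrite -[RHS]inv !affine_horner s1 mul1r; congr (trivariate _ _ _ _ _ _ _).
by rewrite /y0; field.
Qed.

(** A translation of one variable alone would make f periodic, hence constant, in it; and a dilation
    cannot be paired with a translation. So both components have the same type. *)
Lemma symmetry_kind d d0 d1 d2 c s t : nondegenerate_poly d d0 d1 d2 c ->
  (s, t) != ((1, 0), (1, 0)) ->
  (s.1 = 1 /\ t.1 = 1) \/ (`|s.1| != 1) || (`|t.1| != 1) -> invariant12 d0 d1 d2 c s t ->
  [/\ s.1 = 1, t.1 = 1, s.2 != 0 & t.2 != 0] \/
  [/\ s.1 != 1, t.1 != 1 & (`|s.1| != 1) || (`|t.1| != 1)].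
Proof.
move=> nd st kind inv; have [/andP[d0p _] /andP[d1p _]] := (nd_deg0 nd, nd_deg1 nd).
case: kind => [[s1 t1]|kind].
  left; split=> //.
    apply: contraNneq st => s2; apply/eqP; rewrite [s]surjective_pairing [t]surjective_pairing.
    rewrite s1 t1 s2; do 2![congr (_, _)]; apply/eqP/negPn/negP => t2.
    apply: (exact_not_small (nd_exact1 nd) d1p) => x z; apply: constant_size.
    apply: (periodic_constant t2) => y; rewrite -!trivariate_swap12 -[RHS]inv.
    by rewrite !affine_horner s1 t1 s2 !mul1r addr0.
  apply: contraNneq st => t2; apply/eqP; rewrite [s]surjective_pairing [t]surjective_pairing.
  rewrite s1 t1 t2; do 2![congr (_, _)]; apply/eqP/negPn/negP => s2.
  apply: (exact_not_small (nd_exact0 nd) d0p) => y z; apply: constant_size.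
  apply: (periodic_constant s2) => x; rewrite -/(trivariate d0 d1 d2 c _ y z) -[RHS]inv.
  by rewrite !affine_horner s1 t1 t2 !mul1r addr0.
have neq1 a : `|a| != 1 -> a != 1 :> R by apply: contraNneq => ->; rewrite normr1.
right; split=> //; case/orP: kind => k1; try exact: neq1.
  exact: dilation_both (nd_exact1 nd) inv k1.
apply: (@dilation_both d1 d0 d2 (swap12 c) t s d0p) => //; last exact: invariant12_swap.
by have [y [z E]] := nd_exact0 nd; exists y, z.
Qed.

(** Along the direction of the translation f is a polynomial in [tau] of period 1, hence
    constant. *)
Lemma line_invariant d0 d1 d2 c be de ep :
  (forall x y z, trivariate d0 d1 d2 c (x + be) (y + de) (z + ep) = trivariate d0 d1 d2 c x y z) ->
  forall tau x y z, trivariate d0 d1 d2 c (x + tau * be) (y + tau * de) (z + tau * ep) =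
    trivariate d0 d1 d2 c x y z.
Proof.
move=> H tau x y z.
pose p : {poly R} := \sum_(i < d0.+1) \sum_(j < d1.+1) \sum_(k < d2.+1) (c i j k)%:P *
  (x%:P + be *: 'X) ^+ i * (y%:P + de *: 'X) ^+ j * (z%:P + ep *: 'X) ^+ k.
have Ep a : p.[a] = trivariate d0 d1 d2 c (x + a * be) (y + a * de) (z + a * ep).
  rewrite /trivariate slice_horner /p horner_sum; apply: eq_bigr => i _.
  rewrite horner_sum; apply: eq_bigr => j _; rewrite horner_sum; apply: eq_bigr => k _.
  by rewrite !(hornerM, horner_exp, hornerD, hornerZ, hornerC, hornerX) ![a * _]mulrC.
have := @periodic_constant p 1 (oner_neq0 R) _ tau.
rewrite !Ep !mul0r !addr0; apply => a; rewrite !Ep -[RHS]H.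
by congr (trivariate _ _ _ _ _ _ _); ring.
Qed.

(** Sliding along the first translation reaches x = 0 and along the second z = 0; the value of y on
    arrival is a linear form in x, y, z. *)
Lemma special_translation d0 d1 d2 c be de : be != 0 ->
  (forall x y z, trivariate d0 d1 d2 c (x + be) (y + de) z = trivariate d0 d1 d2 c x y z) ->
  d2 = 0%N \/ (exists de' ep, ep != 0 /\
   forall x y z, trivariate d0 d1 d2 c x (y + de') (z + ep) = trivariate d0 d1 d2 c x y z) ->
  special (trivariate d0 d1 d2 c).
Proof.
move=> be0 H1 H2.
have E1 x y z : trivariate d0 d1 d2 c x y z = trivariate d0 d1 d2 c 0 (y - x / be * de) z.
  rewrite -(line_invariant (be := be) (de := de) (ep := 0) _ (- (x / be)) x y z).
    by congr (trivariate _ _ _ _ _ _ _); [field | ring | ring].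
  by move=> x' y' z'; rewrite addr0.
have [r E2] : exists r, forall x y z,
    trivariate d0 d1 d2 c x y z = trivariate d0 d1 d2 c x (y + r * z) 0.
  case: H2 => [d20|[de' [ep [ep0 H2]]]].
    exists 0 => x y z; rewrite mul0r addr0 d20 !trivariate_swap12.
    by rewrite (slice_constant _ _ _ _ z 0).
  exists (- (de' / ep)) => x y z.
  rewrite -(line_invariant (be := 0) (de := de') (ep := ep) _ (- (z / ep)) x y z).
    by congr (trivariate _ _ _ _ _ _ _); [ring | field | field].
  by move=> x' y' z'; rewrite addr0.
exists (slice d1 d0 d2 (swap12 c) 0 0), (- (de / be) *: 'X), 'X, (r *: 'X); left => x y z.
rewrite !hornerE -trivariate_swap12 E1 E2; congr (trivariate _ _ _ _ _ _ _); ring.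
Qed.

(** The primitive vector (p1, p2, p3) is (i, j, k) divided by its gcd. Since p2 is coprime to
    gcd(p1, p3), it divides j', and j' / p2 is the multiple sought. *)
Lemma proportional_exponents i j k : (0 < j)%N -> exists p1 p2 p3, (0 < p2)%N /\
  forall i' j' k', (i * j' = i' * j -> j * k' = j' * k ->
    [/\ i' = j' %/ p2 * p1, j' = j' %/ p2 * p2 & k' = j' %/ p2 * p3])%N.
Proof.
move=> j0; pose g := gcdn j (gcdn i k).
have g0 : (0 < g)%N by rewrite gcdn_gt0 j0.
have gj : (g %| j)%N by apply: dvdn_gcdl.
have gi : (g %| i)%N by apply: dvdn_trans (dvdn_gcdr _ _) (dvdn_gcdl _ _).
have gk : (g %| k)%N by apply: dvdn_trans (dvdn_gcdr _ _) (dvdn_gcdr _ _).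
have [p1 Ei] := dvdnP gi; have [p2 Ej] := dvdnP gj; have [p3 Ek] := dvdnP gk.
have p20 : (0 < p2)%N by move: j0; rewrite Ej muln_gt0 => /andP[].
have cop : coprime p2 (gcdn p1 p3).
  have : gcdn (p2 * g) (gcdn (p1 * g) (p3 * g)) = g by rewrite -Ei -Ej -Ek.
  rewrite -!muln_gcdl -[RHS]mul1n => /eqP; rewrite eqn_mul2r => /orP[|//].
  by rewrite -leqn0 leqNgt g0.
exists p1, p2, p3; split=> // i' j' k'.
rewrite Ei Ej Ek => H1 H2.
have {}H1 : (p1 * j' = i' * p2)%N by apply/eqP; rewrite -(eqn_pmul2r g0); apply/eqP; lia.
have {}H2 : (p2 * k' = j' * p3)%N by apply/eqP; rewrite -(eqn_pmul2r g0); apply/eqP; lia.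
have dv : (p2 %| j')%N.
  rewrite -(Gauss_dvdr _ cop) muln_gcdl dvdn_gcd H1 dvdn_mull //=.
  by rewrite mulnC -H2 dvdn_mulr.
have Ej' : (j' = j' %/ p2 * p2)%N by rewrite divnK.
split=> //; apply/eqP; rewrite -(eqn_pmul2r p20); apply/eqP.
  by rewrite -H1 {1}Ej'; lia.
by rewrite mulnC H2 {1}Ej'; lia.
Qed.

(** In coordinates centred at (a, b, e) all exponents are multiples of one primitive vector, so f is
    a polynomial in one monomial; [j %/ p2] is the multiple. *)
Lemma special_monomials d0 d1 d2 c c' a b e :
  (forall x y z, trivariate d0 d1 d2 c' x y z = trivariate d0 d1 d2 c (x + a) (y + b) (z + e)) ->
  (exists i j k, [/\ (i <= d0)%N, (j <= d1)%N, (k <= d2)%N, (0 < j)%N & c' i j k != 0]) ->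
  (forall i j k i' j' k', (i <= d0)%N -> (j <= d1)%N -> (k <= d2)%N ->
     (i' <= d0)%N -> (j' <= d1)%N -> (k' <= d2)%N -> c' i j k != 0 -> c' i' j' k' != 0 ->
     (i * j' = i' * j /\ j * k' = j' * k)%N) ->
  special (trivariate d0 d1 d2 c).
Proof.
move=> Ec [i0 [j0 [k0 [i0d j0d k0d j00 c0]]]] H.
have [p1 [p2 [p3 [p20 Hp]]]] := proportional_exponents i0 k0 j00.
exists (\sum_(i < d0.+1) \sum_(j < d1.+1) \sum_(k < d2.+1) c' i j k *: 'X^(j %/ p2)).
exists (('X - a%:P) ^+ p1), (('X - b%:P) ^+ p2), (('X - e%:P) ^+ p3); right => x y z.
have -> : trivariate d0 d1 d2 c x y z = trivariate d0 d1 d2 c' (x - a) (y - b) (z - e).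
  by rewrite Ec !subrK.
rewrite /trivariate slice_horner !horner_exp !hornerE horner_sum; apply: eq_bigr => i _.
rewrite horner_sum; apply: eq_bigr => j _; rewrite horner_sum; apply: eq_bigr => k _.
rewrite hornerZ hornerXn; have [->|cn0] := eqVneq (c' i j k) 0; first by rewrite !mul0r.
have [h1 h2] := H i0 j0 k0 i j k i0d j0d k0d (ltn_ord i) (ltn_ord j) (ltn_ord k) c0 cn0.
have [e1 e2 e3] := Hp i j k h1 h2.
have w1 (w : R) : w ^+ i = (w ^+ p1) ^+ (j %/ p2) by rewrite -exprM mulnC -e1.
have w2 (w : R) : w ^+ j = (w ^+ p2) ^+ (j %/ p2) by rewrite -exprM mulnC -e2.
have w3 (w : R) : w ^+ k = (w ^+ p3) ^+ (j %/ p2) by rewrite -exprM mulnC -e3.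
by rewrite w1 w2 w3 -!mulrA -!exprMn.
Qed.

(** Raising both equations to suitable powers eliminates one base; the other, of absolute value
    different from 1, determines its exponent. *)
Lemma exponent_relation (al ga : R) i j i' j' : al != 0 -> ga != 0 ->
  (`|al| != 1) || (`|ga| != 1) -> al ^+ i * ga ^+ j = 1 -> al ^+ i' * ga ^+ j' = 1 ->
  (i * j' = i' * j)%N.
Proof.
move=> a0 g0 /orP ag H H'.
have inj (x : R) m n : x != 0 -> `|x| != 1 -> x ^+ m = x ^+ n -> m = n.
  move=> x0 x1 /(congr1 Num.norm); rewrite !normrX; apply: ieexprIn => //.
  by rewrite normr_gt0.
case: ag => [a1|g1].
  apply: (inj al) => //; have E1 := congr1 (fun w : R => w ^+ j') H; have E2 := congr1 (fun w : R => w ^+ j) H'.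
  move: E1 E2; rewrite !exprMn !expr1n -!exprM => E1 E2.
  apply: (mulIf (_ : ga ^+ (j * j') != 0)); first by rewrite expf_neq0.
  by rewrite E1 [(j * j')%N]mulnC E2.
apply: esym; rewrite mulnC [RHS]mulnC; apply: (inj ga) => //.
have E1 := congr1 (fun w : R => w ^+ i') H; have E2 := congr1 (fun w : R => w ^+ i) H'.
move: E1 E2; rewrite !exprMn !expr1n -!exprM => E1 E2.
apply: (mulfI (_ : al ^+ (i * i') != 0)); first by rewrite expf_neq0.
by rewrite E1 [(i * i')%N]mulnC E2.
Qed.

End Special.

(** * Combining two symmetries that share a variable *)

Section Core.
Variable R : rcfType.
Implicit Types (c : nat -> nat -> nat -> R) (s t : R * R).

Definition swap23 c := fun i k j => c i j k.
Definition swap13 c := fun k j i => c i j k.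

Lemma slice_flip d0 d1 d2 c u v : slice d0 d2 d1 (swap23 c) v u = slice d0 d1 d2 c u v.
Proof.
rewrite /slice exchange_big /=; apply: eq_bigr => j _; apply: eq_bigr => k _.
by rewrite /swap23 mulrC.
Qed.

Lemma trivariate_swap23 d0 d1 d2 c x y z :
  trivariate d0 d2 d1 (swap23 c) x z y = trivariate d0 d1 d2 c x y z.
Proof. by rewrite /trivariate slice_flip. Qed.

Lemma trivariate_swap13 d0 d1 d2 c x y z :
  trivariate d2 d1 d0 (swap13 c) z y x = trivariate d0 d1 d2 c x y z.
Proof.
rewrite [RHS]trivariate_rot3.
exact: (congr1 (fun p : {poly R} => p.[z]) (slice_flip d2 d0 d1 (rot3 c) x y)).
Qed.

(** The form of [nondegenerate_poly] that is stable under all permutations of the variables; any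
    degree may be 0. *)
Record reduced_poly d d0 d1 d2 c : Prop := {
  rd_deg0 : (d0 <= d)%N; rd_deg1 : (d1 <= d)%N; rd_deg2 : (d2 <= d)%N;
  rd_exact0 : exact_degree d0 d1 d2 c;
  rd_exact1 : exact_degree d1 d0 d2 (swap12 c);
  rd_exact2 : exact_degree d2 d0 d1 (rot3 c);
  rd_indec0 : (0 < d0)%N -> indecomposable d0 d1 d2 c;
  rd_indec1 : (0 < d1)%N -> indecomposable d1 d0 d2 (swap12 c);
  rd_indec2 : (0 < d2)%N -> indecomposable d2 d0 d1 (rot3 c) }.

Lemma reduced_nondegenerate d d0 d1 d2 c : (0 < d0)%N -> (0 < d1)%N ->
  reduced_poly d d0 d1 d2 c -> nondegenerate_poly d d0 d1 d2 c.
Proof. by move=> p0 p1 [b0 b1 b2 e0 e1 e2 i0 i1 i2]; split; rewrite ?p0 ?p1 //; auto. Qed.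

Lemma nondegenerate_reduced d d0 d1 d2 c : nondegenerate_poly d d0 d1 d2 c ->
  reduced_poly d d0 d1 d2 c.
Proof. by move=> [/andP[_ ?] /andP[_ ?] *]; split. Qed.

Lemma exact_degree_flip d0 d1 d2 c : exact_degree d0 d1 d2 c -> exact_degree d0 d2 d1 (swap23 c).
Proof. by move=> [u [v E]]; exists v, u; rewrite slice_flip. Qed.

Lemma indecomposable_flip d0 d1 d2 c : indecomposable d0 d1 d2 c ->
  indecomposable d0 d2 d1 (swap23 c).
Proof. by move=> H p sp; have [u [v E]] := H p sp; exists v, u => r; rewrite slice_flip. Qed.

Lemma reduced_swap23 d d0 d1 d2 c : reduced_poly d d0 d1 d2 c ->
  reduced_poly d d0 d2 d1 (swap23 c).
Proof.
move=> [b0 b1 b2 e0 e1 e2 i0 i1 i2]; split=> //; first exact: exact_degree_flip.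
by move=> /i0; apply: indecomposable_flip.
Qed.

Lemma reduced_swap13 d d0 d1 d2 c : reduced_poly d d0 d1 d2 c ->
  reduced_poly d d2 d1 d0 (swap13 c).
Proof.
move=> [b0 b1 b2 e0 e1 e2 i0 i1 i2]; split=> //.
- exact: exact_degree_flip e2.
- exact: exact_degree_flip e1.
- exact: exact_degree_flip e0.
- by move=> /i2 H; apply: indecomposable_flip H.
- by move=> /i1 H; apply: indecomposable_flip H.
- by move=> /i0 H; apply: indecomposable_flip H.
Qed.

Lemma scaling_exponents d0 d1 d2 c (al be ga : R) :
  (forall x y z, trivariate d0 d1 d2 c (al * x) (be * y) (ga * z) = trivariate d0 d1 d2 c x y z) ->
  forall i j k, (i <= d0)%N -> (j <= d1)%N -> (k <= d2)%N -> c i j k != 0 ->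
  al ^+ i * be ^+ j * ga ^+ k = 1.
Proof.
move=> H i j k id jd kd c0; apply: (mulfI c0); rewrite mulr1.
apply: (@trivariate_inj _ d0 d1 d2 (fun i j k => c i j k * (al ^+ i * be ^+ j * ga ^+ k))) => // x y z.
rewrite -[RHS]H /trivariate !slice_horner; apply: eq_bigr => a _; apply: eq_bigr => b _.
by apply: eq_bigr => e _; rewrite !exprMn; ring.
Qed.

Lemma exists_exponent d d0 d1 d2 c c' a b e : nondegenerate_poly d d0 d1 d2 c ->
  (forall x y z, trivariate d0 d1 d2 c' x y z = trivariate d0 d1 d2 c (x + a) (y + b) (z + e)) ->
  exists i j k, [/\ (i <= d0)%N, (j <= d1)%N, (k <= d2)%N, (0 < j)%N & c' i j k != 0].
Proof.
move=> nd Ec; apply: contrapT => Hn; have [/andP[d1p _]] := nd_deg1 nd.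
apply: (exact_not_small (nd_exact1 nd) d1p) => x z; apply: constant_size => y.
have small u v : (size (slice d1 d0 d2 (swap12 c') u v) <= 1)%N.
  apply/leq_sizeP => j j1; rewrite coef_sum big1 // => i _; rewrite coef_sum big1 // => k _.
  rewrite coefZ coef_poly; case: ltnP => jd; last by rewrite mulr0.
  have [->|c0] := eqVneq (swap12 c' j i k) 0; first by rewrite mulr0.
  by case: Hn; exists i, j, k; split; rewrite // -ltnS.
have E w : trivariate d0 d1 d2 c x w z = trivariate d0 d1 d2 c' (x - a) (w - b) (z - e).
  by rewrite Ec !subrK.
by rewrite -!trivariate_swap12 !E !trivariate_swap12 (size1_polyC (small _ _)) !hornerC.
Qed.

Lemma affine_fixpoint s x : s.1 != 1 ->
  (affine s).[x + s.2 / (1 - s.1)] = s.1 * x + s.2 / (1 - s.1).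
Proof.
move=> s1; rewrite affine_horner; field.
by rewrite subr_eq0 eq_sym.
Qed.

(** [affine_symmetry] is applied to (x, y) and, with x and z exchanged, to (z, y). The two actions
    on the shared variable y commute, so they have the same type and, for dilations, the same
    centre. *)
Lemma special_core d k : exists n0, forall n c d0 d1 d2 NA NB NC
    (A : 'I_NA -> R) (B : 'I_NB -> R) (C : 'I_NC -> R) (D : seq R),
  nondegenerate_poly d d0 d1 d2 c -> (n0 <= n)%N -> grid n A -> grid n B -> grid n C ->
  (size D <= n)%N ->
  (n ^ 3 <= k * #|[set p : 'I_NA * ('I_NB * 'I_NC) |
     trivariate d0 d1 d2 c (A p.1) (B p.2.1) (C p.2.2) \in D]|)%N ->
  special (trivariate d0 d1 d2 c).
Proof.
have [n0 H] := affine_symmetry R d k.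
exists n0 => n c d0 d1 d2 NA NB NC A B C D nd n0n gA gB gC sD cnt.
have [s [t [[s0 t0] st cond inv]]] := H n c d0 d1 d2 NA NB NC A B C D nd n0n gA gB gC sD cnt.
have kind := symmetry_kind nd st cond inv.
have [/andP[d0p _] /andP[d1p _]] := (nd_deg0 nd, nd_deg1 nd).
pose x0 := s.2 / (1 - s.1); pose y0 := t.2 / (1 - t.1).
have [d20|d2p] := posnP d2.
  case: kind => [[s1 t1 s2 t2]|[s1 t1 st1]].
    apply: (@special_translation _ d0 d1 d2 c s.2 t.2 s2); last by left.
    by move=> x y z; rewrite -[RHS]inv !affine_horner s1 t1 !mul1r.
  have [c' Ec'] := trivariate_shift3 d0 d1 d2 c x0 y0 0.
  have ex : forall i j k, (i <= d0)%N -> (j <= d1)%N -> (k <= d2)%N -> c' i j k != 0 ->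
      s.1 ^+ i * t.1 ^+ j = 1.
    move=> i j l id jd ld c0; have := @scaling_exponents d0 d1 d2 c' s.1 t.1 1 _ i j l id jd ld c0.
    rewrite expr1n mulr1; apply => x y z.
    by rewrite mul1r !Ec' -(affine_fixpoint x s1) -(affine_fixpoint y t1) inv.
  apply: (special_monomials Ec' (exists_exponent nd Ec')).
  move=> i j l i' j' l' id jd ld id' jd' ld' c0 c0'; split.
    by apply: (exponent_relation s0 t0 st1); [exact: ex c0 | exact: ex c0'].
  by move: ld ld'; rewrite d20 !leqn0 => /eqP -> /eqP ->; rewrite !muln0.
have nd' := reduced_nondegenerate d2p d1p (reduced_swap13 (nondegenerate_reduced nd)).
have cnt' : (n ^ 3 <= k * #|[set p : 'I_NC * ('I_NB * 'I_NA) |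
     trivariate d2 d1 d0 (swap13 c) (C p.1) (B p.2.1) (A p.2.2) \in D]|)%N.
  apply: leq_trans cnt _; rewrite leq_mul2l; apply/orP; right.
  pose h (p : 'I_NA * ('I_NB * 'I_NC)) := (p.2.2, (p.2.1, p.1)).
  rewrite -(card_imset _ (_ : injective h)); last by move=> [i [j l]] [i' [j' l']] [-> -> ->].
  apply: subset_leq_card; apply/subsetP => _ /imsetP [[i [j l]] + ->].
  by rewrite !inE /= trivariate_swap13.
have [u [t' [[u0 t'0] ut cond' inv']]] :=
  H n (swap13 c) d2 d1 d0 NC NB NA C B A D nd' n0n gC gB gA sD cnt'.
have kind' := symmetry_kind nd' ut cond' inv'.
have {}inv' x y z : trivariate d0 d1 d2 c x (affine t').[y] (affine u).[z] = trivariate d0 d1 d2 c x y z.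
  have E := trivariate_swap13 d0 d1 d2 c.
  by rewrite -(E x y z) -(E x (affine t').[y]); exact: inv'.
(* The commutator of the two symmetries fixes x and z and translates y by [ka]; a nonzero [ka] would
   make f periodic in y. *)
have commute : t.2 * (t'.1 - 1) = t'.2 * (t.1 - 1).
  pose ka := (t'.1 * t.2 + t'.2) - (t.1 * t'.2 + t.2).
  suff : ka = 0 by rewrite /ka => Hk; apply/eqP; rewrite -subr_eq0 -Hk; apply/eqP; ring.
  apply/eqP; apply/negPn/negP => ka0.
  apply: (exact_not_small (nd_exact1 nd) d1p) => x z; apply: constant_size.
  apply: (periodic_constant ka0) => w; rewrite -!trivariate_swap12.
  have [w1 Ew1] := affine_surj w t0; have [y Ey] := affine_surj w1 t'0.
  have [x1 <-] := affine_surj x s0; have [z1 <-] := affine_surj z u0.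
  have -> : w + ka = (affine t').[(affine t).[y]].
    by rewrite -Ew1 -Ey !affine_horner /ka; ring.
  by rewrite inv' inv -Ew1 -Ey inv inv'.
case: kind => [[s1 t1 s2 t2]|[s1 t1 st1]]; case: kind' => [[u1 t'1 u2 t'2]|[u1 t'1 ut1]].
- apply: (@special_translation _ d0 d1 d2 c s.2 t.2 s2).
    by move=> x y z; rewrite -[RHS]inv !affine_horner s1 t1 !mul1r.
  right; exists t'.2, u.2; split=> // x y z.
  by rewrite -[RHS]inv' !affine_horner u1 t'1 !mul1r.
- move/eqP: commute; rewrite t1 subrr mulr0 mulf_eq0 (negPf t2) subr_eq0 /=.
  by rewrite (negPf t'1).
- move/eqP: commute; rewrite t'1 subrr mulr0 eq_sym mulf_eq0 (negPf t'2) subr_eq0 /=.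
  by rewrite (negPf t1).
have [c' Ec'] := trivariate_shift3 d0 d1 d2 c x0 y0 (u.2 / (1 - u.1)).
have ex i j l : (i <= d0)%N -> (j <= d1)%N -> (l <= d2)%N -> c' i j l != 0 ->
    s.1 ^+ i * t.1 ^+ j = 1 /\ t'.1 ^+ j * u.1 ^+ l = 1.
  move=> id jd ld c0; split.
    have := @scaling_exponents d0 d1 d2 c' s.1 t.1 1 _ i j l id jd ld c0.
    rewrite expr1n mulr1; apply => x y z.
    by rewrite mul1r !Ec' -(affine_fixpoint x s1) -(affine_fixpoint y t1) inv.
  have := @scaling_exponents d0 d1 d2 c' 1 t'.1 u.1 _ i j l id jd ld c0.
  rewrite expr1n mul1r; apply => x y z.
  rewrite mul1r !Ec' -(affine_fixpoint z u1) -[RHS]inv'; congr (trivariate _ _ _ _ _ _ _).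
  have t1' : 1 - t.1 != 0 by rewrite subr_eq0 eq_sym.
  have Hy : y0 * (1 - t.1) = t.2 by rewrite divfK.
  (* By [commute] the fixed point of [t] is fixed by [t'] as well, so one shift centres both
     symmetries. *)
  have fix' : t'.1 * y0 + t'.2 = y0.
    by apply: (mulIf t1'); rewrite mulrDl -mulrA Hy; clear -commute; lra.
  by rewrite affine_horner mulrDr -addrA fix'.
apply: (special_monomials Ec' (exists_exponent nd Ec')).
move=> i j l i' j' l' id jd ld id' jd' ld' c0 c0'.
have [e1 e2] := ex _ _ _ id jd ld c0; have [e1' e2'] := ex _ _ _ id' jd' ld' c0'.
split; first exact: (exponent_relation s0 t0 st1 e1 e1').
by apply: (exponent_relation t'0 u0 _ e2 e2'); rewrite orbC.
Qed.

End Core.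

(** * Reduction to indecomposable polynomials *)

Section Decomposition.
Variable R : rcfType.
Implicit Types (c : nat -> nat -> nat -> R) (p q r : {poly R}).

Lemma lower_degree d0 d1 d2 c : (forall u v, (size (slice d0.+1 d1 d2 c u v) <= d0.+1)%N) ->
  forall x y z, trivariate d0.+1 d1 d2 c x y z = trivariate d0 d1 d2 c x y z.
Proof.
move=> H x y z; rewrite /trivariate; congr (_.[x]); apply/polyP => i.
have [di|di] := ltnP d0 i.
  by rewrite !nth_default //; [apply: leq_trans (size_slice _ _ _ _ _ _) _ | apply: leq_trans (H y z) _].
rewrite !coef_sum; apply: eq_bigr => j _; rewrite !coef_sum; apply: eq_bigr => k _.
by rewrite !coefZ !coef_poly !ltnS di leqW.
Qed.

(** The polynomials in [p] form a subspace, so each coefficient of f in y and z, not only each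
    slice, is a polynomial in [p]; the outer polynomials give [c']. *)
Lemma decompose_slice d0 d1 d2 c p : (2 < size p)%N ->
  (forall u v, exists r, slice d0 d1 d2 c u v = r \Po p) ->
  exists c', forall x y z, trivariate d0 d1 d2 c x y z =
    trivariate (d0 %/ (size p).-1) d1 d2 c' p.[x] y z.
Proof.
move=> sp H; have Hc := slice_coef_subspace (subspace_comp p) H.
have [r Hr] : exists r : nat * nat -> {poly R}, forall jk, (jk.1 <= d1)%N -> (jk.2 <= d2)%N ->
    \poly_(i < d0.+1) c i jk.1 jk.2 = r jk \Po p.
  have [|r Hr] := @choice _ _ (fun (jk : nat * nat) r => (jk.1 <= d1)%N -> (jk.2 <= d2)%N ->
    \poly_(i < d0.+1) c i jk.1 jk.2 = r \Po p); last by exists r.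
  move=> [j k] /=; have [jd|jd] := leqP j d1; last by exists 0.
  by have [kd|kd] := leqP k d2; [have [r Er] := Hc j k jd kd; exists r | exists 0].
exists (fun i j k => (r (j, k))`_i) => x y z.
rewrite /trivariate !horner_sum; apply: eq_bigr => j _; rewrite !horner_sum; apply: eq_bigr => k _.
rewrite !hornerZ; congr (_ * _); rewrite -horner_comp (Hr (val j, val k)) ?ltn_ord //=; last 2 first.
- exact: (ltn_ord j).
- exact: (ltn_ord k).
congr ((_ \Po p).[x]); apply/polyP => i; rewrite coef_poly; case: ltnP => // di.
rewrite nth_default //; apply: leq_trans di.
have := size_comp_poly (r (val j, val k)) p.
rewrite -(Hr (val j, val k)) /=; [|exact: (ltn_ord j)|exact: (ltn_ord k)] => E.
have : (((size (r (val j, val k))).-1 * (size p).-1) <= d0)%N.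
  rewrite -E; have := size_poly d0.+1 (fun i => c i j k).
  by case: (size _).
rewrite -leq_divRL; last by case: (size p) sp => [|[|]].
by case: (size (r _)).
Qed.

(** The product of inner and outer degree never exceeds [d]; [maxn e 1] keeps the inner degree
    bounded when the outer one is 0. *)
Definition inner_poly d e p := (1 < size p)%N /\ ((size p).-1 * maxn e 1 <= d)%N.

Definition composed d (f : R -> R -> R -> R) d0 d1 d2 := exists c p q r,
  [/\ forall x y z, f x y z = trivariate d0 d1 d2 c p.[x] q.[y] r.[z],
      inner_poly d d0 p, inner_poly d d1 q & inner_poly d d2 r].

Lemma inner_poly_le d e e' p : (e' <= e)%N -> inner_poly d e p -> inner_poly d e' p.
Proof.
move=> le [sp H]; split=> //; apply: leq_trans H; rewrite leq_mul2l; apply/orP; right.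
by rewrite geq_max !leq_max le /= leqnn orbT.
Qed.

(** If the degree bound is not attained it can be lowered, and at [d0 = 0] this means f = 0. If the
    slices share an inner polynomial [g], it is absorbed into [p] and [d0] is divided by its
    degree. *)
Lemma composed_reduce0 d f d0 d1 d2 c p q r :
  (forall x y z, f x y z = trivariate d0 d1 d2 c p.[x] q.[y] r.[z]) ->
  inner_poly d d0 p -> inner_poly d d1 q -> inner_poly d d2 r ->
  [\/ exact_degree d0 d1 d2 c /\ ((0 < d0)%N -> indecomposable d0 d1 d2 c),
      exists2 d0', (d0' < d0)%N & composed d f d0' d1 d2 |
      forall x y z, f x y z = 0].
Proof.
move=> Ef Ip Iq Ir; have [ex|nex] := pselect (exact_degree d0 d1 d2 c); last first.
  have small u v : (size (slice d0 d1 d2 c u v) <= d0)%N.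
    have := size_slice d0 d1 d2 c u v; rewrite leq_eqVlt => /orP[/eqP E|//].
    by case: nex; exists u, v.
  case: d0 Ef Ip nex small => [|d0] Ef Ip nex small.
    apply: Or33 => x y z; rewrite Ef /trivariate.
    by have := small q.[y] r.[z]; rewrite leqn0 size_poly_eq0 => /eqP ->; rewrite horner0.
  apply: Or32; exists d0 => //; exists c, p, q, r; split=> //.
    by move=> x y z; rewrite Ef lower_degree.
  exact: inner_poly_le (leqnSn d0) Ip.
have [i0|] := pselect ((0 < d0)%N -> indecomposable d0 d1 d2 c); first by apply: Or31.
move=> /not_implyP [d0p /existsNP [g /not_implyP [sg Hg]]].
have Hg' u v : exists s, slice d0 d1 d2 c u v = s \Po g.
  by apply: contrapT => Hn; apply: Hg; exists u, v => s Es; apply: Hn; exists s.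
have [c' Ec'] := decompose_slice sg Hg'.
have sg1 : (1 < (size g).-1)%N by case: (size g) sg => [|[|[|]]].
have dg : ((size g).-1 <= d0)%N.
  have [u [v E]] := ex; have [s Es] := Hg' u v; have := size_comp_poly s g.
  rewrite -Es E /= => Ed; move: d0p; rewrite Ed muln_gt0 => /andP[s0 _].
  exact: leq_pmull.
apply: Or32; exists (d0 %/ (size g).-1)%N; first by apply: ltn_Pdiv.
exists c', (g \Po p), q, r; split=> //.
  by move=> x y z; rewrite Ef Ec' horner_comp.
case: Ip => sp Hp; have sc := size_comp_poly g p.
have sgp : (0 < (size g).-1 * (size p).-1)%N.
  by rewrite muln_gt0 (ltnW sg1); case: (size p) sp => [|[]].
split; first by move: sgp; rewrite -sc; case: (size _) => [|[]].
rewrite sc; have -> : (maxn (d0 %/ (size g).-1) 1 = d0 %/ (size g).-1)%N.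
  by apply/maxn_idPl; rewrite divn_gt0 // ltnW.
apply: leq_trans Hp; rewrite mulnC mulnA [X in (_ <= X)%N]mulnC leq_mul2r; apply/orP; right.
by rewrite leq_max leq_trunc_div.
Qed.

End Decomposition.

Section Reduction.
Variable R : rcfType.
Implicit Types (c : nat -> nat -> nat -> R) (p q r : {poly R}) (f : R -> R -> R -> R).

Lemma composed_swap12 d f d0 d1 d2 : composed d f d0 d1 d2 ->
  composed d (fun y x z => f x y z) d1 d0 d2.
Proof.
move=> [c [p [q [r [Ef Ip Iq Ir]]]]]; exists (swap12 c), q, p, r; split=> // y x z.
by rewrite Ef; exact: trivariate_swap12.
Qed.

Lemma composed_swap13 d f d0 d1 d2 : composed d f d0 d1 d2 ->
  composed d (fun z y x => f x y z) d2 d1 d0.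
Proof.
move=> [c [p [q [r [Ef Ip Iq Ir]]]]]; exists (swap13 c), r, q, p; split=> // z y x.
by rewrite Ef; exact: esym (trivariate_swap13 _ _ _ _ _ _ _).
Qed.

Lemma inner_poly_bounds d e p : inner_poly d e p -> (e <= d)%N /\ (1 < size p <= d.+1)%N.
Proof.
move=> [sp H]; rewrite sp /=; have s1 : (0 < (size p).-1)%N by case: (size p) sp => [|[]].
split.
  by apply: leq_trans H; apply: leq_trans (leq_pmull _ s1); rewrite leq_maxl.
have : ((size p).-1 <= d)%N by apply: leq_trans H; apply: leq_pmulr; rewrite leq_max orbT.
by case: (size p).
Qed.

Lemma reduced_decomposition d f d0 d1 d2 : composed d f d0 d1 d2 ->
  (forall x y z, f x y z = 0) \/
  exists e0 e1 e2 c p q r, [/\ reduced_poly d e0 e1 e2 c,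
    forall x y z, f x y z = trivariate e0 e1 e2 c p.[x] q.[y] r.[z],
    (1 < size p <= d.+1)%N, (1 < size q <= d.+1)%N & (1 < size r <= d.+1)%N].
Proof.
have [n] := ubnP (d0 + d1 + d2)%N; elim: n d0 d1 d2 => // n IHn d0 d1 d2; rewrite ltnS => len.
move=> [c [p [q [r [Ef Ip Iq Ir]]]]].
case: (composed_reduce0 Ef Ip Iq Ir) => [[e0 i0]|[d0' lt0 C0]|]; last by left.
  2: by apply: IHn C0; apply: leq_trans len; rewrite !ltn_add2r.
have Ef1 y x z : f x y z = trivariate d1 d0 d2 (swap12 c) q.[y] p.[x] r.[z].
  by rewrite Ef; exact: trivariate_swap12.
case: (composed_reduce0 Ef1 Iq Ip Ir) => [[e1 i1]|[d1' lt1 C1]|H0]; last by left => x y z; apply: H0.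
  2: by apply: IHn (composed_swap12 C1); apply: leq_trans len; rewrite ltn_add2r ltn_add2l.
have Ef2 z y x : f x y z = trivariate d2 d1 d0 (swap13 c) r.[z] q.[y] p.[x].
  by rewrite Ef; exact: esym (trivariate_swap13 _ _ _ _ _ _ _).
case: (composed_reduce0 Ef2 Ir Iq Ip) => [[e2 i2]|[d2' lt2 C2]|H0]; last by left => x y z; apply: H0.
  2: by apply: IHn (composed_swap13 C2); apply: leq_trans len; rewrite ltn_add2l.
right; exists d0, d1, d2, c, p, q, r.
have [[b0 s0] [b1 s1] [b2 s2]] := And3 (inner_poly_bounds Ip) (inner_poly_bounds Iq) (inner_poly_bounds Ir).
split=> //; split=> //; first exact: exact_degree_flip e2.
by move=> /i2 H; apply: indecomposable_flip H.
Qed.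

Lemma special_one_variable g f :
  (forall x y z, f x y z = g.[x]) \/ (forall x y z, f x y z = g.[y]) \/
  (forall x y z, f x y z = g.[z]) -> special f.
Proof.
case=> [|[]] Ef.
- by exists g, 'X, 0, 0; left => x y z; rewrite Ef !hornerE.
- by exists g, 0, 'X, 0; left => x y z; rewrite Ef !hornerE.
- by exists g, 0, 0, 'X; left => x y z; rewrite Ef !hornerE.
Qed.

Lemma special_swap23 f : special (fun x z y => f x y z) -> special f.
Proof.
move=> [g [k [l [m [H|H]]]]]; exists g, k, m, l; [left | right] => x y z; rewrite H; congr (_.[_]); ring.
Qed.

Lemma special_swap13 f : special (fun z y x => f x y z) -> special f.
Proof.
move=> [g [k [l [m [H|H]]]]]; exists g, m, l, k; [left | right] => x y z; rewrite H; congr (_.[_]); ring.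
Qed.

Lemma special_ext f f' : (forall x y z, f x y z = f' x y z) -> special f' -> special f.
Proof.
move=> E [g [k [l [m H]]]]; exists g, k, l, m; case: H => H; [left | right] => x y z;
by rewrite E H.
Qed.

Lemma special_comp f p q r : special f -> special (fun x y z => f p.[x] q.[y] r.[z]).
Proof.
move=> [g [k [l [m H]]]]; exists g, (k \Po p), (l \Po q), (m \Po r).
by case: H => H; [left | right] => x y z; rewrite H !horner_comp.
Qed.

Lemma slice_constant00 d0 c u v u' v' : slice d0 0 0 c u v = slice d0 0 0 c u' v'.
Proof. by rewrite /slice !big_ord_recl !big_ord0 !expr0. Qed.

(** Two variables of positive degree are brought to the first two places; with at most one such
    variable f is univariate. *)
Lemma special_reduced d k : exists n0, forall n c d0 d1 d2 NA NB NC
    (A : 'I_NA -> R) (B : 'I_NB -> R) (C : 'I_NC -> R) (D : seq R),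
  reduced_poly d d0 d1 d2 c -> (n0 <= n)%N -> grid n A -> grid n B -> grid n C ->
  (size D <= n)%N ->
  (n ^ 3 <= k * #|[set p : 'I_NA * ('I_NB * 'I_NC) |
     trivariate d0 d1 d2 c (A p.1) (B p.2.1) (C p.2.2) \in D]|)%N ->
  special (trivariate d0 d1 d2 c).
Proof.
have [n0 H] := special_core R d k.
exists n0 => n c d0 d1 d2 NA NB NC A B C D rd n0n gA gB gC sD cnt.
have [d10|d1p] := posnP d1.
  have [d20|d2p] := posnP d2.
    apply: (@special_one_variable (slice d0 0 0 c 0 0)); left => x y z.
    by rewrite d10 d20 /trivariate (slice_constant00 _ _ y z 0 0).
  have [d00|d0p] := posnP d0.
    apply: (@special_one_variable (slice d2 0 0 (rot3 c) 0 0)); right; right => x y z.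
    by rewrite trivariate_rot3 d10 d00 (slice_constant00 _ _ x y 0 0).
  apply: special_swap23; apply: special_ext (fun x z y => esym (trivariate_swap23 d0 d1 d2 c x y z)) _.
  apply: H (reduced_nondegenerate d0p d2p (reduced_swap23 rd)) n0n gA gC gB sD _.
  apply: leq_trans cnt _; rewrite leq_mul2l; apply/orP; right.
  pose h (p : 'I_NA * ('I_NB * 'I_NC)) := (p.1, (p.2.2, p.2.1)).
  rewrite -(card_imset _ (_ : injective h)); last by move=> [i [j l]] [i' [j' l']] [-> -> ->].
  apply: subset_leq_card; apply/subsetP => _ /imsetP [[i [j l]] + ->].
  by rewrite !inE /= trivariate_swap23.
have [d00|d0p] := posnP d0; last by apply: H (reduced_nondegenerate d0p d1p rd) n0n gA gB gC sD cnt.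
have [d20|d2p] := posnP d2.
  apply: (@special_one_variable (slice d1 0 0 (swap12 c) 0 0)); right; left => x y z.
  by rewrite trivariate_swap12 d00 d20 (slice_constant00 _ _ x z 0 0).
apply: special_swap13; apply: special_ext (fun z y x => esym (trivariate_swap13 d0 d1 d2 c x y z)) _.
apply: H (reduced_nondegenerate d2p d1p (reduced_swap13 rd)) n0n gC gB gA sD _.
apply: leq_trans cnt _; rewrite leq_mul2l; apply/orP; right.
pose h (p : 'I_NA * ('I_NB * 'I_NC)) := (p.2.2, (p.2.1, p.1)).
rewrite -(card_imset _ (_ : injective h)); last by move=> [i [j l]] [i' [j' l']] [-> -> ->].
apply: subset_leq_card; apply/subsetP => _ /imsetP [[i [j l]] + ->].
by rewrite !inE /= trivariate_swap13.
Qed.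

Lemma sum_fibers d (A : seq R) p (h : R -> nat) : uniq A -> (1 < size p <= d.+1)%N ->
  (\sum_(a <- A) h p.[a] <= d * \sum_(b <- undup [seq p.[a] | a <- A]) h b)%N.
Proof.
move=> uA /andP[sp lp]; set s := undup _.
have -> : (\sum_(a <- A) h p.[a] = \sum_(b <- s) \sum_(a <- A | p.[a] == b) h b)%N.
  rewrite (exchange_big_dep predT) //= big_seq [RHS]big_seq; apply: eq_bigr => a aA.
  rewrite (eq_bigl (pred1 p.[a])) => [|b]; last by rewrite /= eq_sym.
  rewrite -big_filter filter_pred1_uniq ?undup_uniq ?big_seq1 // mem_undup; exact: map_f.
rewrite big_distrr /=; apply: leq_sum => b _; rewrite big_const_seq iter_addn_0 mulnC leq_mul2r.
apply/orP; right; rewrite -size_filter -ltnS; apply: leq_trans lp.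
have sc : size (p - b%:P) = size p.
  by rewrite size_polyDl // size_polyN; exact: leq_ltn_trans (size_polyC_leq1 _) _.
rewrite -sc; apply: max_poly_roots; last exact: filter_uniq.
  by rewrite -size_poly_gt0 sc ltnW.
by apply/allP => a; rewrite mem_filter => /andP[/eqP <- _]; rewrite /root !hornerE subrr.
Qed.

Lemma grid_of_seq n (A : seq R) : uniq A -> (size A <= n)%N -> exists2 B : 'I_(size A) -> R,
  grid n B & forall h : R -> nat, (\sum_(a <- A) h a = \sum_i h (B i))%N.
Proof.
move=> uA sA; pose s := sort <=%R A; have ss : size s = size A by rewrite size_sort.
exists (fun i => s`_i).
  split=> // i j ij; apply: (sorted_ltn_nth lt_trans) => //; rewrite ?inE ?ss //.
  by rewrite sort_lt_sorted.
move=> h; rewrite (perm_big s) /=; last by rewrite perm_sym perm_sort.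
by rewrite (big_nth 0) big_mkord ss.
Qed.

Lemma card_triples NA NB NC (P : 'I_NA -> 'I_NB -> 'I_NC -> bool) :
  #|[set p : 'I_NA * ('I_NB * 'I_NC) | P p.1 p.2.1 p.2.2]| =
  (\sum_i \sum_j \sum_l P i j l)%N.
Proof.
rewrite -sum1_card (eq_bigl (fun x => true && P x.1 x.2.1 x.2.2)) => [|x]; last by rewrite inE.
rewrite -(pair_big_dep predT (fun i x => P i x.1 x.2) (fun _ _ => 1%N)) /=.
apply: eq_bigr => i _.
rewrite (eq_bigl (fun x => true && P i x.1 x.2)) //.
rewrite -(pair_big_dep predT (fun j l => P i j l) (fun _ _ => 1%N)) /=.
by apply: eq_bigr => j _; rewrite big_mkcond; apply: eq_bigr => l _; case: (P i j l).
Qed.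

Lemma special_of_many_points d k : exists n0, forall n f c (A B C D : seq R),
  (forall x y z, f x y z = trivariate d d d c x y z) -> (0 < d)%N -> (n0 <= n)%N ->
  uniq A -> uniq B -> uniq C -> (size A <= n)%N -> (size B <= n)%N -> (size C <= n)%N ->
  (size D <= n)%N ->
  (n ^ 3 <= k * \sum_(a <- A) \sum_(b <- B) \sum_(e <- C) (f a b e \in D))%N ->
  special f.
Proof.
(* Replacing A, B, C by their images under the inner polynomials costs a factor of at most [d] in
   each variable. *)
have [n0 H] := special_reduced d (k * (d * (d * d))).
exists n0 => n f c A B C D Ef d0 n0n uA uB uC sA sB sC sD cnt.
have C0 : composed d f d d d.
  have I0 : inner_poly d d ('X : {poly R}).
    by split; rewrite size_polyX //= mul1n geq_max leqnn d0.
  by exists c, 'X, 'X, 'X; split=> // x y z; rewrite !hornerX.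
have [f0|[e0 [e1 [e2 [c' [p [q [r [rd Ef' sp sq sr]]]]]]]]] := reduced_decomposition C0.
  by exists 0, 0, 0, 0; left => x y z; rewrite f0 horner0.
apply: (special_ext Ef'); apply: special_comp.
have grid_image (E : seq R) (w : {poly R}) : (size E <= n)%N ->
    (size (undup [seq w.[a] | a <- E]) <= n)%N.
  by move=> sE; apply: leq_trans (size_undup _) _; rewrite size_map.
have [A' gA EA] := grid_of_seq (undup_uniq _) (grid_image A p sA).
have [B' gB EB] := grid_of_seq (undup_uniq _) (grid_image B q sB).
have [C' gC EC] := grid_of_seq (undup_uniq _) (grid_image C r sC).
apply: (H n c' e0 e1 e2 _ _ _ A' B' C' D rd n0n gA gB gC sD).
apply: leq_trans cnt _; rewrite -mulnA leq_mul2l; apply/orP; right.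
rewrite (card_triples (fun i j l => trivariate e0 e1 e2 c' (A' i) (B' j) (C' l) \in D)).
rewrite -!mulnA -(EA (fun x => \sum_j \sum_l (trivariate e0 e1 e2 c' x (B' j) (C' l) \in D))%N).
apply: leq_trans (_ : \sum_(a <- A) d * (d * \sum_j \sum_l
  (trivariate e0 e1 e2 c' p.[a] (B' j) (C' l) \in D)) <= _)%N; last first.
  rewrite -!big_distrr /= leq_mul2l; apply/orP; right; rewrite leq_mul2l; apply/orP; right.
  exact: (sum_fibers (fun x => \sum_j \sum_l (trivariate e0 e1 e2 c' x (B' j) (C' l) \in D))%N).
apply: leq_sum => a _.
rewrite -(EB (fun y => \sum_l (trivariate e0 e1 e2 c' p.[a] y (C' l) \in D))%N).
apply: leq_trans (_ : \sum_(b <- B) d * \sum_l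
  (trivariate e0 e1 e2 c' p.[a] q.[b] (C' l) \in D) <= _)%N; last first.
  rewrite -!big_distrr /= leq_mul2l; apply/orP; right.
  exact: (sum_fibers (fun y => \sum_l (trivariate e0 e1 e2 c' p.[a] y (C' l) \in D))%N).
apply: leq_sum => b _; rewrite -(EC (fun z => (trivariate e0 e1 e2 c' p.[a] q.[b] z \in D) : nat)).
under eq_bigr do rewrite Ef'.
exact: (sum_fibers (fun z => (trivariate e0 e1 e2 c' p.[a] q.[b] z \in D) : nat)).
Qed.

End Reduction.

(** * From multinomials to coefficient arrays *)

Section Multinomials.
Variable R : rcfType.

Lemma ev3_trivariate d (f : {mpoly R[3]}) : (msize f <= d.+1)%N ->
  exists c, forall x y z, ev3 f x y z = trivariate d d d c x y z.
Proof.
move=> sf; pose o (i : nat) : 'I_3 := inord i.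
(* A monomial is determined by its three exponents, so this sum has at most one term. *)
pose c i j k := \sum_(m <- msupp f | [&& m (o 0%N) == i, m (o 1%N) == j & m (o 2%N) == k]) f@_m.
exists c => x y z; rewrite /trivariate slice_horner.
transitivity (\sum_(m <- msupp f) f@_m * x ^+ m (o 0%N) * y ^+ m (o 1%N) * z ^+ m (o 2%N)).
  rewrite /ev3 mevalE; apply: eq_bigr => m _; rewrite !big_ord_recl big_ord0 mulr1 !mulrA.
  have o0 : ord0 = o 0%N by apply: ord_inj; rewrite inordK.
  have o1 : lift ord0 ord0 = o 1%N by apply: ord_inj; rewrite inordK.
  have o2 : lift ord0 (lift ord0 ord0) = o 2%N by apply: ord_inj; rewrite inordK.
  by rewrite o2 o1 o0 /o !inordK.
have md (m : 'X_{1..3}) i : m \in msupp f -> (m i < d.+1)%N.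
  move=> mf; apply: leq_trans sf; apply: leq_ltn_trans (msize_mdeg_lt mf).
  by rewrite mdegE (bigD1 i) //= leq_addr.
under [RHS]eq_bigr do under eq_bigr do under eq_bigr do rewrite /c !mulr_suml big_mkcond /=.
under [RHS]eq_bigr do under eq_bigr do rewrite exchange_big /=.
under [RHS]eq_bigr do rewrite exchange_big /=.
rewrite exchange_big /= big_seq [RHS]big_seq; apply: eq_bigr => m mf.
rewrite (bigD1 (Ordinal (md m (o 0%N) mf))) //= (bigD1 (Ordinal (md m (o 1%N) mf))) //=.
rewrite (bigD1 (Ordinal (md m (o 2%N) mf))) //= !eqxx /=.
rewrite big1 => [|k]; last by rewrite -val_eqE /= eq_sym => /negPf ->.
rewrite big1 => [|j]; last first.
  by rewrite -val_eqE /= eq_sym => /negPf jm; rewrite big1 // => k _; rewrite jm.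
rewrite big1 ?addr0 // => i; rewrite -val_eqE /= eq_sym => /negPf im.
by rewrite big1 // => j _; rewrite big1 // => k _; rewrite im.
Qed.

End Multinomials.

Theorem theorem1p4 (R : realType) (c : R) (d : nat) :
  0 < c -> (0 < d)%N ->
  exists n0 : nat,
    forall (f : {mpoly R[3]}), msize f = d.+1 ->
    forall (n : nat) (A B C D : seq R),
      (n0 < n)%N ->
      uniq A -> uniq B -> uniq C -> uniq D ->
      size A = n -> size B = n -> size C = n -> size D = n ->
      c * (n%:R ^+ 3) <= (graph_count f A B C D)%:R ->
      exists (g k l m : {poly R}),
        (forall x y z : R, ev3 f x y z = g.[k.[x] + l.[y] + m.[z]]) \/
        (forall x y z : R, ev3 f x y z = g.[k.[x] * l.[y] * m.[z]]).
Proof.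
(* The integer [k] exceeds 1/c, which turns the real bound into n^3 <= k times the number of
   points. *)
move=> c0 d0; pose k := Num.bound c^-1.
have [n0 H] := special_of_many_points R d k.
exists n0 => f sf n A B C D n0n uA uB uC uD sA sB sC sD cnt.
have [c' Ec'] := ev3_trivariate (eq_leq sf).
apply: (H n (ev3 f) c' A B C D Ec' d0 (ltnW n0n) uA uB uC); rewrite ?sA ?sB ?sC ?sD //.
rewrite -(ler_nat R) natrM natrX -/(graph_count f A B C D).
have kc : 1 <= k%:R * c.
  rewrite -ler_pdivrMr // mul1r; apply/ltW/archi_boundP; rewrite invr_ge0; exact: ltW.
apply: le_trans (_ : k%:R * (c * n%:R ^+ 3) <= _); last by rewrite ler_wpM2l // ler0n.
by rewrite mulrA ler_peMl // exprn_ge0 // ler0n.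
Qed.
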